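(* Let $H\in(1/2,1)$, $T>0$, let $b:\mathbb{R}^d\to\mathbb{R}^d$ be differentiable and let $\sigma:[0,T]\to\mathbb{R}^{d\times d}$ take values in the invertible matrices. Assume there are constants $K,\tilde K>0$, $L\ge0$, $\alpha_0$ with $H-1/2<\alpha_0\le1$ and $\beta_0$ with $1-\frac1{2H}<\beta_0\le1$ such that $|\nabla b(x)|\le K$ for all $x$, $\sigma$ is bounded, $|\sigma^{-1}(t)-\sigma^{-1}(s)|\le\tilde K|t-s|^{\alpha_0}$ for all $s,t\in[0,T]$, and $|\nabla b(x)-\nabla b(y)|\le L|x-y|^{\beta_0}$ for all $x,y\in\mathbb{R}^d$. Let $X^x$ be the solution of $\mathrm{d}X(t)=b(X(t))\,\mathrm{d}t+\sigma(t)\,\mathrm{d}B^H(t)$, $X(0)=x$, and $P(T)f(x)=\mathbb{E}f(X^x(T))$. Then $P(T)$ is strong Feller, i.e. $P(T)f$ is bounded and continuous on $\mathbb{R}^d$ for every bounded measurable $f:\mathbb{R}^d\to\mathbb{R}$.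
   Context: $B^H$ is a $d$-dimensional fractional Brownian motion on $[0,T]$ with Hurst parameter $H$: a continuous centered Gaussian process with $\mathbb{E}B_t^{H,i}B_s^{H,j}=\frac12(t^{2H}+s^{2H}-|t-s|^{2H})\delta_{ij}$. The integral $\int_0^t\sigma(s)\,\mathrm{d}B^H(s)$ is the integral of a deterministic function (Wiener integral, equal to the pathwise integral when the latter exists). *)

(* Defs.v *)
From HB Require Import structures.
From mathcomp Require Export all_boot all_order all_algebra.
From mathcomp Require Export all_classical all_reals all_analysis.

Set Implicit Arguments.
Unset Strict Implicit.
Unset Printing Implicit Defensive.

Import Order.TTheory GRing.Theory Num.Theory.
Export numFieldNormedType.Exports.

Local Open Scope classical_set_scope.
Local Open Scope ring_scope.

(* Points of R^d are row vectors, as required by the library's [jacobian];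
   a process is a function (t, omega) |-> W t omega of which only the times
   t in [0, T] matter. *)

Section Euclidean_space.
Context {R : realType}.

(* The topology of 'M[R]_(m, n) comes from the max norm; the analytic
   hypotheses are stated with the Euclidean norm of vectors, that is the
   Hilbert-Schmidt norm of matrices (invariant under transposition, so the
   row-vector convention of [jacobian] is immaterial). *)
Definition enorm m n (A : 'M[R]_(m, n)) : R :=
  Num.sqrt (\sum_(i < m) \sum_(j < n) A i j ^+ 2).

Definition borel_rV d := g_sigma_algebraType (@open 'rV[R]_d).

End Euclidean_space.
Arguments borel_rV R d : clear implicits.

Section fractional_Brownian_motion.
Context {dO : measure_display} {Omega : measurableType dO} {R : realType}.
Variable P : probability Omega R.

Definition continuous_paths (V : topologicalType) (T : R) (W : R -> Omega -> V)
    : Prop :=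
  {ae P, forall w, {within `[0, T], continuous (fun t => W t w)}}.

(* [normal_prob m 0] is not the Dirac mass at m, so degenerate Gaussian
   variables are treated apart. *)
Definition gaussian_rv (Y : Omega -> R) : Prop :=
  measurable_fun setT Y /\
  exists m s : R,
    if s == 0 then {ae P, forall w, Y w = m}
    else forall A : set R, measurable A -> P (Y @^-1` A) = normal_prob m s A.

(* Joint Gaussianity in time and in coordinates. *)
Definition gaussian_process d (T : R) (W : R -> Omega -> 'rV[R]_d) : Prop :=
  forall (n : nat) (t : 'I_n -> R) (c : 'I_n -> 'I_d -> R),
    (forall k, 0 <= t k <= T) ->
    gaussian_rv (fun w => \sum_(k < n) \sum_(i < d) c k i * W (t k) w ord0 i).

Definition fBm d (H T : R) (B : R -> Omega -> 'rV[R]_d) : Prop :=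
  [/\ continuous_paths T B,
      gaussian_process T B,
      forall (t : R) (i : 'I_d), 0 <= t <= T ->
        ('E_P[fun w => B t w ord0 i] = 0)%E
    & forall (t s : R) (i j : 'I_d), 0 <= t <= T -> 0 <= s <= T ->
        ('E_P[fun w => (B t w ord0 i * B s w ord0 j)%R] =
        (2^-1 * (t `^ (2 * H) + s `^ (2 * H) - `|t - s| `^ (2 * H))
          * (i == j)%:R)%:E)%E].

(* A step function sum_k c_k 1_{]u_k, v_k]} is given by its list of triples
   (c_k, (u_k, v_k)). *)
Definition step_in (t : R) (s : seq (R * (R * R))) : bool :=
  all (fun p => [&& 0 <= p.2.1, p.2.1 <= p.2.2 & p.2.2 <= t]) s.

Definition step_fun (s : seq (R * (R * R))) (r : R) : R :=
  \sum_(p <- s) p.1 * \1_(`]p.2.1, p.2.2]) r.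

Definition step_integral (W : R -> Omega -> R) (s : seq (R * (R * R)))
    (w : Omega) : R :=
  \sum_(p <- s) p.1 * (W p.2.2 w - W p.2.1 w).

(* Square of the norm of the space |H| of functions on [0, t],
     H (2H - 1) int_0^t int_0^t |g(r)| |g(s)| |r - s|^(2H-2) ds dr.
   For H > 1/2 it dominates the square norm of the reproducing Hilbert space,
   hence on step functions dominates the second moment of the integral. *)
Definition absH_norm2 (H t : R) (g : R -> R) : \bar R :=
  ((H * (2 * H - 1))%:E *
   \int[lebesgue_measure]_(r in `[0%R, t])
     \int[lebesgue_measure]_(s in `[0%R, t])
       (`|g r| * `|g s| * `|r - s| `^ (2 * H - 2))%:E)%E.

(* Y is (a version of) int_0^t phi dW, for W a scalar fractional Brownian
   motion of Hurst parameter H > 1/2: extension by continuity, from step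
   functions, of the map 1_{]u, v]} |-> W_v - W_u into L^2. *)
Definition wiener_integral (H : R) (W : R -> Omega -> R) (t : R)
    (phi : R -> R) (Y : Omega -> R) : Prop :=
  measurable_fun setT Y /\
  exists s : nat -> seq (R * (R * R)),
    [/\ forall n, step_in t (s n),
        absH_norm2 H t (phi \- step_fun (s n)) @[n --> \oo] --> 0%E
      & ('E_P[fun w => ((Y w - step_integral W (s n) w) ^+ 2)%R])%E
          @[n --> \oo] --> 0%E].

(* Z is a continuous version of t |-> int_0^t sigma(s) dB(s); coordinatewise,
   Z^i = sum_j int sigma_ij dB^j. *)
Definition wiener_integral_process d (H T : R) (B : R -> Omega -> 'rV[R]_d)
    (sigma : R -> 'M[R]_d) (Z : R -> Omega -> 'rV[R]_d) : Prop :=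
  continuous_paths T Z /\
  forall (t : R) (i : 'I_d), 0 <= t <= T ->
    exists Y : 'I_d -> Omega -> R,
      (forall j, wiener_integral H (fun r w => B r w ord0 j) t
                   (fun r => sigma r i j) (Y j)) /\
      {ae P, forall w, Z t w ord0 i = \sum_(j < d) Y j w}.

(* X solves dX = b(X) dt + sigma dB on [0, T] with X(0) = x. *)
Definition sde_solution d (H T : R) (B : R -> Omega -> 'rV[R]_d)
    (b : 'rV[R]_d -> 'rV[R]_d) (sigma : R -> 'M[R]_d) (x : 'rV[R]_d)
    (X : R -> Omega -> 'rV[R]_d) : Prop :=
  [/\ forall t : R, 0 <= t <= T ->
        measurable_fun setT (X t : Omega -> borel_rV R d),
      continuous_paths T X
    & exists2 Z : R -> Omega -> 'rV[R]_d,
        wiener_integral_process H T B sigma Z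
      & {ae P, forall w, forall t : R, 0 <= t <= T ->
          X t w = x
            + \row_(i < d) (\int[lebesgue_measure]_(s in `[0, t])
                              b (X s w) ord0 i)
            + Z t w}].

Definition semigroup d (X : 'rV[R]_d -> R -> Omega -> 'rV[R]_d) (t : R)
    (f : 'rV[R]_d -> R) (x : 'rV[R]_d) : R :=
  fine ('E_P[fun w => f (X x t w)])%E.

End fractional_Brownian_motion.

Definition strong_feller (R : realType) d
    (Q : ('rV[R]_d -> R) -> 'rV[R]_d -> R) : Prop :=
  forall f : 'rV[R]_d -> R,
    measurable_fun setT (f : borel_rV R d -> R) -> bounded_fun f ->
    bounded_fun (Q f) /\ continuous (Q f).

(* Main.v *)
Require Import Defs.
From HB Require Import structures.
From mathcomp Require Import ring lra measurable_realfun.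

(** The proof compares the law of X^x(T) with one fixed Gaussian law, uniformly
    in x, and then lets x vary.

    Let G = B_T - 2 B_(T-e) + B_(T-2e) for a small e > 0.  Its coordinates are
    independent, centered and nondegenerate ([noise_dot], [noise_var_gt0],
    [chaos_independence_prod]).  The driving integral Z(t) = int_0^t sigma dB
    lies in the first chaos of B, so that Z(t) = U(t) + v^-1 G h(t), where U is
    orthogonal to G, hence independent of it ([chaos_independence]), v is the
    variance of the coordinates of G and h(t) is the covariance of G and Z(t):
    the integral of sigma^T over [0, t] against the kernel [seckernel]
    ([wiener_coord_noise]).  This kernel is half the derivative of the second
    difference of |u|^(2H), taken at u = T - r.  Away from T it has mass O(e^2),
    whereas near T its mass is of order e^(2H), and 2H < 2; so as e tends to 0
    it concentrates at T ([seckernel_peak]).  As sigma is continuous with sigma(T) invertible, h(T)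
    is therefore nondegenerate, while the time average of |h| is negligible with
    respect to it ([response_dominates]).

    Freeze U and move G by g.  The driving path of the Euler scheme at T moves
    by v^-1 g h, and by a discrete Gronwall inequality the value of the scheme
    at T moves by at least v^-1 |g h(T)| minus a constant times the time average
    of v^-1 |g h|, hence by at least a constant times |g|, uniformly in the mesh
    ([euler_perturb]).  Integrating over U shows that the scheme lies in a given
    cube of side 2r with probability at most C r^d, where C depends neither on
    the mesh nor on x ([euler_density]).

    The law of G charges every cube of side r inside a bounded box with
    probability at least c r^d.  Covering an open set by small cells and passing
    to the limit in the scheme gives
      P(X^x(T) in O, |X^x(T)| < L) <= K_L P(G in O)
    for all open O, with K_L independent of x ([limit_domination]).

    Finally |X^x(T) - X^y(T)| <= e^(KT) |x - y| almost surely, K being a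
    Lipschitz constant of b, because all solutions are driven by the same
    integral ([driving_version], [solution_lipschitz]).  Every Borel set A lies between a closed and an open
    set whose difference D is small for the law of G.  By the domination D is
    then small for the law of X^x(T), uniformly in x; outside D the set A is
    both open and closed, so a small displacement of the starting point rarely
    makes the solution leave A ([event_stable]).  Slicing a bounded Borel f into
    level sets gives the continuity of x |-> E f(X^x(T)) ([integral_stable]). *)

Set Implicit Arguments.
Unset Strict Implicit.
Unset Printing Implicit Defensive.

Import Order.TTheory GRing.Theory Num.Theory.
Local Open Scope classical_set_scope.
Local Open Scope ring_scope.

(** * Real-valued integrals *)

Section Rintegral_dominated.
Context d (T : measurableType d) (R : realType).
Variables (mu : {measure set T -> \bar R}) (D : set T) (mD : measurable D).

Lemma Rdominated (f_ : nat -> T -> R) (f g : T -> R) :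
  (forall n, measurable_fun D (f_ n)) ->
  (forall x, D x -> f_ ^~ x @ \oo --> f x) ->
  mu.-integrable D (EFin \o g) ->
  (forall n x, D x -> `|f_ n x| <= g x) ->
  mu.-integrable D (EFin \o f) /\
  \int[mu]_(x in D) f_ n x @[n --> \oo] --> \int[mu]_(x in D) f x.
Proof.
move=> mf cf ig fg.
have mF : measurable_fun D f by apply: measurable_fun_cvg mf cf.
have ae1 : {ae mu, forall x, D x -> (EFin \o f_ ^~ x) @ \oo --> (f x)%:E}.
  by apply: aeW => x Dx; apply: cvg_EFin; [exact: nearW|exact: cf].
have ae2 : {ae mu, forall x n, D x -> (`|(f_ n x)%:E| <= (EFin \o g) x)%E}.
  by apply: aeW => x n Dx /=; rewrite lee_fin fg.
have [intf _ c] := @dominated_convergence _ _ _ mu D mD (fun n => EFin \o f_ n)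
  (EFin \o f) (EFin \o g) (fun n => (measurable_EFinP _ _).2 (mf n))
  ((measurable_EFinP _ _).2 mF) ae1 ig ae2.
split => //.
apply: fine_cvg; rewrite fineK//.
exact: integrable_fin_num intf.
Qed.

Lemma RintegrableD (f g : T -> R) : mu.-integrable D (EFin \o f) ->
  mu.-integrable D (EFin \o g) -> mu.-integrable D (EFin \o (fun x => f x + g x)).
Proof. exact: integrableD. Qed.

Lemma RintegrableB (f g : T -> R) : mu.-integrable D (EFin \o f) ->
  mu.-integrable D (EFin \o g) -> mu.-integrable D (EFin \o (fun x => f x - g x)).
Proof. exact: integrableB. Qed.

Lemma RintegrableZ k (f : T -> R) : mu.-integrable D (EFin \o f) ->
  mu.-integrable D (EFin \o (fun x => k * f x)).
Proof. exact: integrableZl. Qed.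

Lemma le_Rintegrable (f g : T -> R) : measurable_fun D f ->
  (forall x, D x -> `|f x| <= g x) ->
  mu.-integrable D (EFin \o g) -> mu.-integrable D (EFin \o f).
Proof.
move=> mf fg; apply: le_integrable => //; first exact/measurable_EFinP.
by move=> x Dx /=; rewrite lee_fin (le_trans (fg _ Dx))// ler_norm.
Qed.

End Rintegral_dominated.

Lemma is_derive_continuous {R : realType} (F f : R -> R) :
  (forall x : R, is_derive x 1 F (f x)) -> continuous F.
Proof.
by move=> dF x; apply: differentiable_continuous; apply/derivable1_diffP; case: (dF x).
Qed.

Lemma abs_cos_le1 {R : realType} (x : R) : `|cos x| <= 1.
Proof. by rewrite ler_norml cos_geN1 cos_le1. Qed.

Lemma abs_sin_le1 {R : realType} (x : R) : `|sin x| <= 1.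
Proof. by rewrite ler_norml sin_geN1 sin_le1. Qed.

Lemma FTC_Rintegral {R : realType} (F f : R -> R) (a b : R) :
  (forall x : R, is_derive x 1 F (f x)) -> continuous f -> a <= b ->
  \int[lebesgue_measure]_(x in `[a, b]) f x = F b - F a.
Proof.
move=> dF cf; rewrite le_eqVlt => /predU1P[<-|ab].
  by rewrite set_itv1 Rintegral_set1 subrr.
have cF := is_derive_continuous dF.
rewrite /Rintegral (@continuous_FTC2 _ f F)//.
- exact: continuous_subspaceT.
- split; [by move=> x _; case: (dF x)|exact/cvg_at_right_filter/cF|
    exact/cvg_at_left_filter/cF].
- by move=> x _; rewrite derive1E; case: (dF x).
Qed.

(** * Gaussian integrals and characteristic functions *)

Section gaussian_stein.
Context {R : realType}.
Local Notation mu := (@lebesgue_measure R).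
Implicit Types m s x : R.

(** Doubling the variance absorbs any quadratic factor, since 1 + y <= e^y. *)
Lemma normal_pdf_decay m s : s != 0 ->
  exists C : R, forall x,
  (1 + (x - m) ^+ 2) * normal_pdf m s x <= C * normal_pdf m (s * Num.sqrt 2) x.
Proof.
move=> s0.
have s20 : s * Num.sqrt 2 != 0 by rewrite mulf_neq0// sqrtr_eq0 -ltNge.
exists ((1 + 4 * s ^+ 2) * normal_peak s / normal_peak (s * Num.sqrt 2)) => x.
rewrite !normal_pdfE// /normal_fun; set u := x - m.
have ss : 0 < s ^+ 2 by rewrite exprn_even_gt0.
have q2 : Num.sqrt 2 ^+ 2 = 2 :> R by rewrite sqr_sqrtr.
rewrite [leRHS]mulrA divfK ?gt_eqF ?normal_peak_gt0//.
rewrite mulrCA [leRHS]mulrAC [leRHS]mulrC ler_pM2l ?normal_peak_gt0//.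
rewrite exprMn q2.
have -> : - u ^+ 2 / (s ^+ 2 *+ 2) = - u ^+ 2 / (s ^+ 2 * 2 *+ 2) + - u ^+ 2 / (s ^+ 2 * 2 *+ 2).
  by field; rewrite ?s0.
rewrite expRD mulrA ler_pM2r ?expR_gt0//.
rewrite -ler_pdivlMr ?expR_gt0// -expRN mulNr opprK.
apply: (@le_trans _ _ ((1 + 4 * s ^+ 2) * (1 + u ^+ 2 / (s ^+ 2 * 2 *+ 2)))); last first.
  by rewrite ler_pM2l ?expR_ge1Dx// addr_gt0// mulr_gt0.
have -> : (1 + 4 * s ^+ 2) * (1 + u ^+ 2 / (s ^+ 2 * 2 *+ 2)) =
  1 + (4 * s ^+ 2 * (u ^+ 2 / (s ^+ 2 * 2 *+ 2)) + (4 * s ^+ 2 + u ^+ 2 / (s ^+ 2 * 2 *+ 2))) by ring.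
rewrite lerD2l.
have -> : 4 * s ^+ 2 * (u ^+ 2 / (s ^+ 2 * 2 *+ 2)) = u ^+ 2.
  by field; rewrite ?s0.
rewrite lerDl; apply: addr_ge0; first by apply: mulr_ge0 => //; exact: sqr_ge0.
apply: mulr_ge0; first exact: sqr_ge0.
by rewrite invr_ge0 mulrn_wge0// mulr_ge0// ltW.
Qed.

Lemma normal_pdf_integrable_growth m s (f : R -> R) (C : R) : s != 0 ->
  measurable_fun setT f -> (forall x, `|f x| <= C * (1 + (x - m) ^+ 2)) ->
  mu.-integrable setT (EFin \o (fun x => f x * normal_pdf m s x)).
Proof.
move=> s0 mf fC.
have [D hD] := normal_pdf_decay m s0.
apply: (@le_Rintegrable _ _ R mu setT measurableT _ (fun x => `|C| * (D * normal_pdf m (s * Num.sqrt 2) x))).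
- by apply: measurable_funM => //; exact: measurable_normal_pdf.
- move=> x _; rewrite normrM (ger0_norm (normal_pdf_ge0 _ _ _)).
  apply: (@le_trans _ _ (`|C| * ((1 + (x - m) ^+ 2) * normal_pdf m s x))); last first.
    by rewrite ler_wpM2l.
  rewrite mulrA ler_wpM2r ?normal_pdf_ge0// (le_trans (fC _))//.
  by rewrite ler_wpM2r ?ler_norm// addr_ge0// sqr_ge0.
- by do 2 apply: RintegrableZ => //; exact: integrable_normal_pdf.
Qed.

Lemma normal_pdf_vanish m s : s != 0 ->
  normal_pdf m s n%:R @[n --> \oo] --> 0 /\ normal_pdf m s (- n%:R) @[n --> \oo] --> 0.
Proof.
move=> s0.
have ss : 0 < s ^+ 2 *+ 2 by rewrite pmulrn_lgt0// exprn_even_gt0.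
have key (u : nat -> R) : (forall n : nat, n%:R - `|m| <= `|u n - m|) ->
    normal_pdf m s (u n) @[n --> \oo] --> 0.
  move=> hu; rewrite -(mulr0 (normal_peak s)).
  under eq_cvg do rewrite normal_pdfE//.
  apply: cvgM; first exact: cvg_cst.
  have : expR (- ((n%:R - `|m|) / (s ^+ 2 *+ 2))) @[n --> \oo] --> 0.
    apply: (@cvg_comp _ _ _ (fun n : nat => (n%:R - `|m|) / (s ^+ 2 *+ 2)) (fun x => expR (- x)) _ +oo); last exact: cvgr_expR.
    apply/cvgryPge => a; near=> n.
    by rewrite ler_pdivlMr// lerBrDr; near: n; exact: nbhs_infty_ger.
  move=> h; apply: (@squeeze_cvgr _ _ _ _ (fun=> 0) _ _ _ _ _ h); last exact: cvg_cst.
  near=> n; rewrite expR_ge0/= ler_expR mulNr lerN2 ler_pM2r ?invr_gt0//.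
  rewrite -[leRHS]real_normK ?num_real// (le_trans (hu n))// ler_eXnr//.
  rewrite (le_trans _ (hu n))// lerBrDr; near: n.
  exact: nbhs_infty_ger.
split; apply: key => n.
  by rewrite -{1}(ger0_norm (ler0n R n)) lerB_dist.
by rewrite -{1}(ger0_norm (ler0n R n)) -{1}(normrN n%:R) lerB_dist.
Unshelve. all: by end_near. Qed.

Lemma is_derive_normal_pdf m s x : s != 0 ->
  is_derive x 1 (normal_pdf m s) (- ((x - m) / s ^+ 2 * normal_pdf m s x)).
Proof.
move=> s0; rewrite normal_pdfE// /normal_fun.
apply: is_derive_eq.
rewrite /GRing.scale/=.
by field; rewrite ?s0.
Qed.

(** Integration by parts: (x - m) / s^2 times the density is minus its derivative,
    and the boundary terms vanish by [normal_pdf_decay] and [normal_pdf_vanish]. *)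
Lemma gauss_stein m s (g g' : R -> R) (C : R) : s != 0 ->
  (forall x, is_derive x 1 g (g' x)) -> continuous g' ->
  (forall x, `|g x| <= C * (1 + `|x - m|)) -> (forall x, `|g' x| <= C) ->
  \int[mu]_x ((x - m) * g x * normal_pdf m s x) =
  s ^+ 2 * \int[mu]_x (g' x * normal_pdf m s x).
Proof.
move=> s0 dg cg' gC g'C.
pose F x := - (s ^+ 2 * (g x * normal_pdf m s x)).
pose f x := (x - m) * g x * normal_pdf m s x - s ^+ 2 * (g' x * normal_pdf m s x).
have C0 : 0 <= C by exact: le_trans (g'C 0).
have cg : continuous g.
  exact: is_derive_continuous dg.
have cp := @continuous_normal_pdf _ m _ s0.
have i1 : mu.-integrable setT (EFin \o (fun x => (x - m) * g x * normal_pdf m s x)).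
  apply: (@normal_pdf_integrable_growth _ _ _ (2 * C)) => //.
    apply: measurable_funM; first exact: measurable_funB.
    exact: continuous_measurable_fun.
  move=> x; rewrite normrM (le_trans (ler_wpM2l (normr_ge0 _) (gC x)))//.
  rewrite -(@real_normK _ (x - m)) ?num_real//.
  have t0 : 0 <= `|x - m| by [].
  move: t0; set t := `|x - m| => t0.
  suff : 0 <= C * (2 + t ^+ 2 *+ 2 - t * (1 + t)) by lra.
  by rewrite mulr_ge0//; nra.
have i2 : mu.-integrable setT (EFin \o (fun x => g' x * normal_pdf m s x)).
  apply: (@normal_pdf_integrable_growth _ _ _ C) => //.
    exact: continuous_measurable_fun.
  by move=> x; rewrite (le_trans (g'C x))// ler_peMr// lerDl sqr_ge0.
have ifx : mu.-integrable setT (EFin \o f).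
  by apply: RintegrableB => //; exact: RintegrableZ.
apply/eqP; rewrite -RintegralZl// -subr_eq0 -RintegralB//; last exact: RintegrableZ.
rewrite -/f.
have dF x : is_derive x 1 F (f x).
  have dp := is_derive_normal_pdf m x s0.
  apply: is_derive_eq; rewrite /GRing.scale/= /f.
  by field.
have cf : continuous f.
  move=> x; apply: cvgB; last first.
    by apply: cvgM; [exact: cvg_cst|apply: cvgM; [exact: cg'|exact: cp]].
  apply: cvgM; last exact: cp.
  apply: cvgM; last exact: cg.
  by apply: cvgB; [exact: cvg_id|exact: cvg_cst].
have FTC n : \int[mu]_(x in `[- n.+1%:R, n.+1%:R]) f x = F n.+1%:R - F (- n.+1%:R).
  by apply: FTC_Rintegral => //; rewrite (@le_trans _ _ 0) ?oppr_le0.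
have l1 : \int[mu]_x (f \_ `[- n.+1%:R, n.+1%:R]) x @[n --> \oo] --> \int[mu]_x f x.
  have [] // := @Rdominated _ _ R mu setT measurableT (fun n => f \_ `[- n.+1%:R, n.+1%:R]) f (fun x => `|f x|).
  - move=> n; apply/(measurable_restrictT _ _).1 => //.
    by apply: measurable_funTS; exact: continuous_measurable_fun.
  - move=> x _; apply: cvg_near_cst; near=> n.
    rewrite patchE mem_set//= in_itv/= -ler_norml; apply: ltW.
    by rewrite (@le_lt_trans _ _ n%:R) ?ltr_nat//; near: n; exact: nbhs_infty_ger.
  - exact: integrable_norm.
  - move=> n x _; rewrite patchE; case: ifP => //; by rewrite normr0.
have l2 : (F n.+1%:R - F (- n.+1%:R)) @[n --> \oo] --> 0.
  have s20 : s * Num.sqrt 2 != 0 by rewrite mulf_neq0// sqrtr_eq0 -ltNge.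
  have [D hD] := normal_pdf_decay m s0.
  have hF x : `|F x| <= s ^+ 2 * (2 * C * D) * normal_pdf m (s * Num.sqrt 2) x.
    rewrite /F normrN normrM (ger0_norm (sqr_ge0 _)) -mulrA ler_wpM2l ?sqr_ge0//.
    rewrite normrM (ger0_norm (normal_pdf_ge0 _ _ _)) -mulrA.
    apply: (@le_trans _ _ (2 * C * ((1 + (x - m) ^+ 2) * normal_pdf m s x))); last first.
      by rewrite ler_wpM2l// mulr_ge0.
    rewrite mulrA ler_wpM2r ?normal_pdf_ge0// (le_trans (gC x))//.
    rewrite -(@real_normK _ (x - m)) ?num_real//.
    have t0 : 0 <= `|x - m| by [].
    move: t0; set t := `|x - m| => t0.
    suff : 0 <= C * (1 + t ^+ 2 *+ 2 - t) by lra.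
    by rewrite mulr_ge0//; nra.
  have key (u : nat -> R) : normal_pdf m (s * Num.sqrt 2) (u n) @[n --> \oo] --> 0 ->
      F (u n) @[n --> \oo] --> 0.
    move=> hu; apply: norm_cvg0.
    apply: (@squeeze_cvgr _ _ _ _ (fun=> 0) (fun n => s ^+ 2 * (2 * C * D) * normal_pdf m (s * Num.sqrt 2) (u n))).
    - by near=> n; rewrite normr_ge0 hF.
    - exact: cvg_cst.
    - by rewrite -(mulr0 (s ^+ 2 * (2 * C * D))); apply: cvgM => //; exact: cvg_cst.
  have [v1 v2] := normal_pdf_vanish m s20.
  rewrite -(subrr 0); apply: cvgB.
    by move/key : v1; rewrite -[X in X -> _](@cvg_shiftS _ (fun n => F n%:R)).
  by move/key : v2; rewrite -[X in X -> _](@cvg_shiftS _ (fun n => F (- n%:R))).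
apply/eqP; apply: (cvg_unique _ l1) => //.
apply: cvg_trans l2; apply: near_eq_cvg; near=> n.
by rewrite -FTC Rintegral_mkcond.
Unshelve. all: by end_near.
Qed.

Lemma is_derive_cos_affine (c th : R) (a : R) :
  is_derive a 1 (fun a => cos (a * c + th)) (- c * sin (a * c + th)).
Proof. by apply: is_derive_eq; rewrite /GRing.scale/=; ring. Qed.

Lemma is_derive_sin_shift (a m th x : R) :
  is_derive x 1 (fun x => sin (a * (x - m) + th)) (a * cos (a * (x - m) + th)).
Proof. by apply: is_derive_eq; rewrite /GRing.scale/=; ring. Qed.

Lemma ler_norm_1sqr (x : R) : `|x| <= 1 + x ^+ 2.
Proof.
rewrite -(@real_normK _ x) ?num_real//; have : 0 <= `|x| by [].
by move: (`|x|) => t; nra.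
Qed.

Lemma continuous_cos_affine (a m th : R) : continuous (fun x : R => cos (a * (x - m) + th)).
Proof.
move=> x; apply: (@continuous_comp _ _ _ (fun x : R => a * (x - m) + th) cos).
  apply: cvgD; last exact: cvg_cst.
  apply: cvgM; first exact: cvg_cst.
  by apply: cvgB; [exact: cvg_id|exact: cvg_cst].
exact: continuous_cos.
Qed.

Let S (m s th a : R) : R := \int[mu]_x (cos (a * (x - m) + th) * normal_pdf m s x).

(** Differentiation under the integral followed by [gauss_stein] turns the
    characteristic function into the solution of S' = - s^2 a S. *)
Let is_derive_S (m s th a : R) : s != 0 -> is_derive a 1 (S m s th) (- (s ^+ 2 * a) * S m s th a).
Proof.
move=> s0.
pose f a x : R := cos (a * (x - m) + th) * normal_pdf m s x.
have df1 (b x : R) : is_derive b 1 (f ^~ x) (- (x - m) * sin (b * (x - m) + th) * normal_pdf m s x).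
  have h := is_derive_cos_affine (x - m) th b.
  by apply: is_derive_eq; rewrite /GRing.scale/=; ring.
have d1E b x : partial1of2 f b x = - (x - m) * sin (b * (x - m) + th) * normal_pdf m s x.
  by rewrite partial1of2E; case: (df1 b x).
have mcos b : measurable_fun setT (fun x => cos (b * (x - m) + th)).
  by apply: continuous_measurable_fun; exact: continuous_cos_affine.
have Ia : [set` `](a - 1), (a + 1)[] a by rewrite /= in_itv/= ltrDl gtrBl ltr01.
have intf x : [set` `](a - 1), (a + 1)[] x -> mu.-integrable setT (EFin \o f x).
  move=> _; apply: (@normal_pdf_integrable_growth _ _ _ 1) => // y.
  by rewrite mul1r (le_trans (abs_cos_le1 _))// lerDl sqr_ge0.
have der1 x y : [set` `](a - 1), (a + 1)[] x -> setT y -> derivable (f ^~ y) x 1.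
  by move=> _ _; case: (df1 x y).
pose G x := `|x - m| * normal_pdf m s x.
have G0 x : 0 <= G x by rewrite mulr_ge0 ?normal_pdf_ge0.
have intG : mu.-integrable setT (EFin \o G).
  apply: (@normal_pdf_integrable_growth _ _ _ 1) => //.
    by apply: measurableT_comp => //; exact: measurable_funB.
  by move=> y; rewrite mul1r normr_id ler_norm_1sqr.
have Gub x y : [set` `](a - 1), (a + 1)[] x -> setT y -> `|partial1of2 f x y| <= G y.
  move=> _ _; rewrite d1E !normrM normrN (ger0_norm (normal_pdf_ge0 _ _ _)).
  by rewrite ler_wpM2r ?normal_pdf_ge0// ler_piMr// abs_sin_le1.
have D1 := derivable_under_integral measurableT Ia intf der1 G0 intG Gub.
have D2 := differentiation_under_integral measurableT Ia intf der1 G0 intG Gub.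
apply: DeriveDef => //; rewrite -derive1E D2.
under eq_Rintegral do rewrite d1E.
have := @gauss_stein m s (fun x => sin (a * (x - m) + th)) (fun x => a * cos (a * (x - m) + th)) (1 + `|a|) s0 (is_derive_sin_shift a m th).
move=> st.
transitivity (- \int[mu]_x ((x - m) * sin (a * (x - m) + th) * normal_pdf m s x)).
  rewrite -[RHS]mulN1r -RintegralZl//.
    by apply: eq_Rintegral => x _; ring.
  apply: (@normal_pdf_integrable_growth _ _ _ 1) => //.
    apply: measurable_funM; first exact: measurable_funB.
    by apply: continuous_measurable_fun; apply: is_derive_continuous; exact: (is_derive_sin_shift a m th).
  move=> x; rewrite mul1r normrM (le_trans _ (ler_norm_1sqr _))//.
  by rewrite ler_piMr// abs_sin_le1.
rewrite st.
- rewrite mulNr; congr (- _); rewrite /S -[RHS]mulrA; congr (_ * _).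
  rewrite -[RHS]RintegralZl//; last exact: intf.
  by apply: eq_Rintegral => x _; rewrite mulrA.
- move=> x; apply: cvgM; first exact: cvg_cst.
  exact: continuous_cos_affine.
- move=> x; rewrite (le_trans (abs_sin_le1 _))// -[leLHS]mulr1 ler_pM// lerDl//.
- by move=> x; rewrite normrM (@le_trans _ _ `|a|)// ?ler_piMr ?abs_cos_le1// lerDr.
Qed.

Lemma normal_cf m s (th a : R) : s != 0 ->
  \int[mu]_x (cos (a * (x - m) + th) * normal_pdf m s x) =
  cos th * expR (- (a ^+ 2 * s ^+ 2 / 2)).
Proof.
move=> s0.
(* The differential equation of S says that E is constant. *)
pose E a := S m s th a * expR (a ^+ 2 * s ^+ 2 / 2).
have dE (b : R) : is_derive b 1 E 0.
  have h := is_derive_S m th b s0.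
  have h2 : is_derive b 1 (fun a : R => expR (a ^+ 2 * s ^+ 2 / 2))
      (b * s ^+ 2 * expR (b ^+ 2 * s ^+ 2 / 2)).
    by apply: is_derive_eq; rewrite /GRing.scale/=; field.
  by apply: (is_derive_eq (is_deriveM h h2)); rewrite /GRing.scale/=; ring.
have := @is_derive_0_is_cst _ E a 0 dE.
rewrite /E expr0n/= !mul0r expR0 mulr1.
have -> : S m s th 0 = cos th.
  rewrite /S; under eq_Rintegral do rewrite mul0r add0r.
  rewrite RintegralZl//; last exact: integrable_normal_pdf.
  by rewrite /Rintegral integral_normal_pdf mulr1.
by move=> <-; rewrite -/(S m s th a) -mulrA -expRD subrr expR0 mulr1.
Qed.

Lemma normal_mean m s : s != 0 -> \int[mu]_x (x * normal_pdf m s x) = m.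
Proof.
move=> s0.
have := @gauss_stein m s (fun=> 1) (fun=> 0) 1 s0 (fun x => is_derive_cst _ _ _) _ _ _.
have -> : \int[mu]_x (0 * normal_pdf m s x) = 0.
  under eq_Rintegral do rewrite mul0r.
  by rewrite Rintegral_cst// mul0r.
rewrite mulr0 => h0.
rewrite -[RHS]add0r -[in RHS]h0; first last.
- by move=> x; rewrite normr0.
- by move=> x; rewrite normr1 mul1r lerDl.
- by move=> x; exact: cvg_cst.
have i1 : mu.-integrable setT (EFin \o (fun x => m * normal_pdf m s x)).
  by apply: RintegrableZ => //; exact: integrable_normal_pdf.
have i2 : mu.-integrable setT (EFin \o (fun x => (x - m) * 1 * normal_pdf m s x)).
  apply: (@normal_pdf_integrable_growth _ _ _ 1) => //.
    by apply: measurable_funM => //; exact: measurable_funB.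
  by move=> x; rewrite mulr1 mul1r ler_norm_1sqr.
rewrite -[X in _ + X]mulr1 -[X in _ + _ * X](_ : \int[mu]_x normal_pdf m s x = 1); last first.
  by rewrite /Rintegral integral_normal_pdf.
rewrite -RintegralZl//; last exact: integrable_normal_pdf.
by rewrite -RintegralD//; apply: eq_Rintegral => x _; ring.
Qed.

Lemma normal_variance m s : s != 0 -> \int[mu]_x ((x - m) ^+ 2 * normal_pdf m s x) = s ^+ 2.
Proof.
move=> s0.
have dg (x : R) : is_derive x 1 (fun x : R => x - m) 1.
  by apply: is_derive_eq; rewrite /GRing.scale/=; ring.
have := @gauss_stein m s (fun x => x - m) (fun=> 1) 1 s0 dg.
under [in X in _ -> X]eq_Rintegral do rewrite expr2.
move=> ->.
- under eq_Rintegral do rewrite mul1r.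
  by rewrite /Rintegral integral_normal_pdf mulr1.
- by move=> x; exact: cvg_cst.
- by move=> x; rewrite mul1r lerDr.
- by move=> x; rewrite normr1.
Qed.

End gaussian_stein.

Section gaussian_characteristic_function.
Context {dO} {Omega : measurableType dO} {R : realType} (P : probability Omega R).
Local Notation mu := (@lebesgue_measure R).

Lemma integral_normal_prob (m s : R) (f : R -> R) : s != 0 ->
  measurable_fun setT f ->
  (normal_prob m s).-integrable setT (EFin \o f) ->
  \int[normal_prob m s]_x f x = \int[mu]_x (f x * normal_pdf m s x).
Proof.
move=> s0 mf finf; congr fine.
rewrite -(Radon_Nikodym_change_of_variables (normal_prob_dominates m s))//=.
have mf' := (measurable_EFinP _ _).2 mf.
under [RHS]eq_integral do rewrite EFinM.
apply: ae_eq_integral => //.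
- apply: emeasurable_funM => //; apply: (measurable_int mu).
  apply: (integrableS _ _ (@subsetT _ _)) => //=.
  by apply: Radon_Nikodym_integrable; exact: normal_prob_dominates.
- apply: emeasurable_funM => //=; apply/measurableT_comp => //=.
  exact: measurable_normal_pdf.
- apply: ae_eqe_mul2l => /=.
  rewrite Radon_NikodymE//=; first exact: normal_prob_dominates.
  move=> abmu.
  case: cid => /= h [h1 h2 h3].
  apply: integral_ae_eq => //=.
  + by apply/measurableT_comp =>//; exact: measurable_normal_pdf.
  + by move=> E E01 mE; rewrite -h3.
Qed.

Lemma gaussian_law_integral (Y : Omega -> R) (m s : R) (f : R -> R) : s != 0 ->
  measurable_fun setT Y ->
  (forall A : set R, measurable A -> P (Y @^-1` A) = normal_prob m s A) ->
  measurable_fun setT f -> P.-integrable setT (EFin \o (f \o Y)) ->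
  \int[P]_w f (Y w) = \int[mu]_x (f x * normal_pdf m s x).
Proof.
move=> s0 mY lY mf iY.
have mY2 : measurable_fun setT (Y : Omega -> measurableTypeR R) by exact: mY.
pose Ymix := isMeasurableFun.Build _ _ Omega (measurableTypeR R) Y mY2.
pose Y' : {mfun Omega >-> measurableTypeR R} := HB.pack Y Ymix.
have mf' := (measurable_EFinP _ _).2 mf.
have E (g : R -> \bar R) :
    (\int[distribution P Y']_x g x = \int[normal_prob m s]_x g x)%E.
  by apply: eq_measure_integral => A mA _; exact: lY.
have iN : (normal_prob m s).-integrable setT (EFin \o f).
  apply/integrableP; split => //.
  rewrite -(E (fun x => `|(EFin \o f) x|%E)) ge0_integral_distribution//; last exact: measurableT_comp.
  by case/integrableP : iY.
rewrite -integral_normal_prob//; congr fine.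
rewrite -(E (EFin \o f)).
by rewrite (@integral_distribution _ _ _ _ _ P Y' (EFin \o f)).
Qed.

Lemma Rintegral_prob_cst (c : R) : \int[P]_w c = c.
Proof. by rewrite /Rintegral integral_cst//= probability_setT mule1. Qed.

(** A centered Gaussian variable is either almost surely 0 or has a density;
    both cases obey the same formula.  The phase th encodes the sine transform, so
    that cosines alone replace complex exponentials. *)
Lemma gaussian_cf (Y : Omega -> R) (a th : R) : gaussian_rv P Y ->
  P.-integrable setT (EFin \o (fun w => Y w ^+ 2)) ->
  \int[P]_w Y w = 0 ->
  \int[P]_w cos (a * Y w + th) =
    cos th * expR (- (a ^+ 2 * (\int[P]_w (Y w ^+ 2)) / 2)).
Proof.
move=> [mY [m [s hs]]] iY2 EY0.
have iY : P.-integrable setT (EFin \o Y).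
  apply: (@le_Rintegrable _ _ R P setT measurableT _ (fun w => 1 + Y w ^+ 2)) => //.
    by move=> w _; exact: ler_norm_1sqr.
  by apply: RintegrableD => //; exact: finite_measure_integrable_cst.
case: eqVneq hs => [_ Ym|s0 lY].
  have ae_const (f : R -> R) : measurable_fun setT f -> \int[P]_w f (Y w) = f m.
    move=> mf; transitivity (\int[P]_w cst (f m) w).
      congr fine; apply: ae_eq_integral => //.
      - by apply/measurable_EFinP; exact: measurableT_comp.
      - by apply/measurable_EFinP.
      by apply: filterS Ym => w Yw _ /=; rewrite Yw.
    by rewrite Rintegral_prob_cst.
  have m0 : m = 0 by rewrite -EY0 (ae_const id).
  rewrite (ae_const (fun y => cos (a * y + th))); last first.
    by apply: continuous_measurable_fun => x; have := @continuous_cos_affine R a 0 th x; rewrite /continuous_at; under eq_cvg do rewrite subr0; rewrite subr0.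
  rewrite (ae_const (fun y => y ^+ 2)).
    by rewrite m0 expr0n/= !mulr0 add0r mul0r oppr0 expR0 mulr1.
  exact: exprn_measurable.
have m0 : m = 0.
  by rewrite -(normal_mean m s0) -(gaussian_law_integral s0 mY lY (f := id)).
have mcos : measurable_fun setT (fun x : R => cos (a * (x - m) + th)).
  by apply: continuous_measurable_fun; exact: continuous_cos_affine.
have -> : \int[P]_w (Y w ^+ 2) = s ^+ 2.
  rewrite -(normal_variance m s0) -(gaussian_law_integral s0 mY lY (f := fun x => (x - m) ^+ 2)).
  - by apply: eq_Rintegral => w _; rewrite m0 subr0.
  - by apply: measurable_funX; exact: measurable_funB.
  - by rewrite m0; under eq_fun do rewrite /= subr0.
rewrite -(normal_cf m th a s0) -(gaussian_law_integral s0 mY lY (f := fun x => cos (a * (x - m) + th)))//.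
  by apply: eq_Rintegral => w _; rewrite m0 subr0.
apply: measurable_bounded_integrable => //.
- by rewrite ltey_eq fin_num_measure.
- by apply: measurableT_comp => //.
- by exists 1; split => // M M1 w _ /=; rewrite (le_trans (abs_cos_le1 _))// ltW.
Qed.

End gaussian_characteristic_function.

(** * Uniqueness of characteristic functions *)

Lemma measurable_cosT (R : realType) : measurable_fun setT (@cos R).
Proof. by apply: continuous_measurable_fun => x; exact: continuous_cos. Qed.

Section fourier_uniqueness.
Context {dO} {Omega : measurableType dO} {R : realType} (P : probability Omega R).
Local Notation mu := (@lebesgue_measure R).

Lemma integrable_bounded (f : Omega -> R) (M : R) : measurable_fun setT f ->
  (forall w, `|f w| <= M) -> P.-integrable setT (EFin \o f).
Proof.
move=> mf fM; apply: measurable_bounded_integrable => //.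
- by rewrite ltey_eq fin_num_measure.
- by exists M; split; [exact: num_real|move=> r Mr w _ /=; rewrite (le_trans (fM w))// ltW].
Qed.

Lemma Rfubini (f : Omega * measurableTypeR R -> R) (g : R -> R) :
  measurable_fun setT f -> mu.-integrable setT (EFin \o g) ->
  (forall w x, `|f (w, x)| <= g x) ->
  \int[P]_w (\int[mu]_x f (w, x)) = \int[mu]_x (\int[P]_w f (w, x)).
Proof.
move=> mf ig fg.
have mf' := (measurable_EFinP _ _).2 mf.
have m1 x : measurable_fun setT (fun w => f (w, x)).
  by apply: (measurableT_comp mf); exact: measurable_pair2.
have m2 w : measurable_fun setT (fun x : measurableTypeR R => f (w, x)).
  by apply: (measurableT_comp mf); exact: measurable_pair1.
have i1 x : P.-integrable setT (EFin \o (fun w => f (w, x))).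
  exact: (integrable_bounded (m1 x) (fun w => fg w x)).
have i2 w : mu.-integrable setT (EFin \o (fun x => f (w, x))).
  by apply: (@le_Rintegrable _ _ R mu setT measurableT _ g) => //.
have iP : (P \x mu)%E.-integrable setT (EFin \o f).
  apply/integrable21ltyP => //.
  apply: (@le_lt_trans _ _ (\int[mu]_x (g x)%:E)%E); last exact: integrable_lty.
  apply: ge0_le_integral => //.
  - by move=> x _; exact: integral_ge0.
  - apply: (measurable_fun_fubini_tonelli_G (abse \o (EFin \o f))) => //.
      exact: measurableT_comp.
    by move=> z; exact: abse_ge0.
  - exact: measurable_int ig.
  move=> x _; apply: (@le_trans _ _ (\int[P]_w (cst (g x)%:E w))%E).
    apply: ge0_le_integral => //.
    + by apply/measurableT_comp => //; apply/measurable_EFinP.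
    + by move=> w _; rewrite lee_fin fg.
  by rewrite integral_cst//= probability_setT mule1.
have := Fubini iP.
have -> : (\int[P]_w \int[mu]_x (EFin \o f) (w, x) = \int[P]_w (\int[mu]_x f (w, x))%:E)%E.
  by apply: eq_integral => w _; rewrite /Rintegral fineK//; exact: integrable_fin_num (i2 w).
have -> : (\int[mu]_x \int[P]_w (EFin \o f) (w, x) = \int[mu]_x (\int[P]_w f (w, x))%:E)%E.
  by apply: eq_integral => w _; rewrite /Rintegral fineK//; exact: integrable_fin_num (i1 w).
by move=> /(congr1 fine).
Qed.

Section smoothing.
Variables (W U : Omega -> R) (M : R).
Hypotheses (mW : measurable_fun setT W) (mU : measurable_fun setT U).
Hypothesis WM : forall w, `|W w| <= M.
Hypothesis WU0 : forall a th : R, \int[P]_w (W w * cos (a * U w + th)) = 0.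

Let M0 : 0 <= M. Proof. exact: le_trans (WM point). Qed.

(** The Gaussian factor is itself a characteristic function, that is, an average
    of cosines, to which the hypothesis on W applies frequency by frequency. *)
Let smooth_exp (s y : R) : s != 0 ->
  \int[P]_w (W w * expR (- ((U w - y) ^+ 2 * s ^+ 2 / 2))) = 0.
Proof.
move=> s0.
transitivity (\int[P]_w (\int[mu]_a (W w * (cos (a * U w + - (a * y)) * normal_pdf 0 s a)))).
  apply: eq_Rintegral => w _; rewrite RintegralZl//; last first.
    apply: (@normal_pdf_integrable_growth _ _ _ _ 1) => //.
      apply: continuous_measurable_fun => x.
      have := @continuous_cos_affine R (U w - y) 0 0 x; rewrite /continuous_at.
      rewrite !subr0 !addr0.
      by under eq_cvg do rewrite subr0 addr0 mulrC mulrBr; rewrite mulrC mulrBr.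
    by move=> x; rewrite mul1r (le_trans (abs_cos_le1 _))// lerDl sqr_ge0.
  congr (_ * _).
  have := normal_cf 0 0 (U w - y) s0; rewrite cos0 mul1r => <-.
  by apply: eq_Rintegral => a _; rewrite subr0 addr0 -mulrBr mulrC [(_ - _) * _]mulrC mulrC.
rewrite (@Rfubini (fun z => W z.1 * (cos (z.2 * U z.1 + - (z.2 * y)) * normal_pdf 0 s z.2)) (fun a => M * normal_pdf 0 s a)).
- under eq_Rintegral.
    move=> a _ /=.
    under eq_Rintegral do rewrite mulrA.
    rewrite RintegralZr//; last first.
      apply: (@integrable_bounded _ M) => //.
        apply: measurable_funM => //.
        apply: measurableT_comp; first exact: measurable_cosT.
        by apply: measurable_funB => //; exact: measurable_funM.
      by move=> w; rewrite normrM -[leRHS]mulr1 ler_pM ?abs_cos_le1.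
    rewrite WU0 mul0r.
    over.
  by rewrite Rintegral_cst// mul0r.
- apply: measurable_funM.
    exact: measurableT_comp mW measurable_fst.
  apply: measurable_funM.
    apply: measurableT_comp; first exact: measurable_cosT.
    apply: measurable_funB; apply: measurable_funM => //.
    exact: measurableT_comp mU measurable_fst.
  by apply: measurableT_comp => //; exact: measurable_normal_pdf.
- by apply: RintegrableZ => //; exact: integrable_normal_pdf.
- move=> w x /=; rewrite !normrM (ger0_norm (normal_pdf_ge0 _ _ _)) mulrA.
  by rewrite ler_wpM2r ?normal_pdf_ge0// -[leRHS]mulr1 ler_pM// abs_cos_le1.
Qed.

Let smooth_interval (s al be : R) : s != 0 ->
  \int[P]_w (W w * \int[mu]_y (\1_(`]al, be]) y * normal_pdf (U w) s y)) = 0.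
Proof.
move=> s0.
have mI : measurable_fun setT (\1_(`]al, be]) : R -> R) by exact: measurable_indic.
transitivity (\int[P]_w (\int[mu]_y (W w * (\1_(`]al, be]) y * normal_pdf (U w) s y)))).
  apply: eq_Rintegral => w _; rewrite RintegralZl//.
  apply: (@normal_pdf_integrable_growth _ _ _ _ 1) => //.
  by move=> x; rewrite indicE mul1r; case: (_ \in _); rewrite ?normr1 ?normr0 ?lerDl ?addr_ge0 ?sqr_ge0.
rewrite (@Rfubini (fun z => W z.1 * (\1_(`]al, be]) z.2 * normal_pdf (U z.1) s z.2)) (fun y => (M * normal_peak s) * \1_(`]al, be]) y)).
- under eq_Rintegral.
    move=> y _ /=.
    have -> : \int[P]_w (W w * (\1_(`]al, be]) y * normal_pdf (U w) s y)) = 0.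
      transitivity (\int[P]_w (\1_(`]al, be]) y * normal_peak s * (W w * expR (- ((U w - y) ^+ 2 * (s^-1) ^+ 2 / 2))))).
        apply: eq_Rintegral => w _; rewrite normal_pdfE// /normal_fun.
        have -> : - (y - U w) ^+ 2 / (s ^+ 2 *+ 2) = - ((U w - y) ^+ 2 * s^-1 ^+ 2 / 2).
          by field; rewrite ?s0.
        ring.
      rewrite RintegralZl//.
        by rewrite smooth_exp ?mulr0// invr_eq0.
      apply: (@integrable_bounded _ M) => //.
        apply: measurable_funM => //; apply: measurableT_comp => //.
        apply: measurableT_comp => //; apply: measurable_funM => //.
        by apply: measurable_funM => //; apply: measurable_funX; exact: measurable_funB.
      move=> w; rewrite normrM -[leRHS]mulr1 ler_pM//.
      rewrite ger0_norm ?expR_ge0// -[leRHS]expR0 ler_expR oppr_le0.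
      by rewrite mulr_ge0// mulr_ge0// sqr_ge0.
    over.
  by rewrite Rintegral_cst// mul0r.
- apply: measurable_funM.
    exact: measurableT_comp mW measurable_fst.
  apply: measurable_funM.
    exact: measurableT_comp mI measurable_snd.
  have -> : (fun z : Omega * measurableTypeR R => normal_pdf (U z.1) s z.2) =
      (fun z => normal_peak s * expR (- (z.2 - U z.1) ^+ 2 / (s ^+ 2 *+ 2))).
    by apply/funext => z; rewrite normal_pdfE.
  apply: measurable_funM => //; apply: measurableT_comp => //.
  apply: measurable_funM => //; apply: measurableT_comp => //.
  apply: measurable_funX; apply: measurable_funB => //.
  exact: measurableT_comp mU measurable_fst.
- apply: RintegrableZ => //.
  exact: integrable_indic_itv.
- move=> w x /=; rewrite !normrM (ger0_norm (normal_pdf_ge0 _ _ _)).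
  rewrite [X in _ <= X]mulrAC -mulrA ler_pM//; first by rewrite mulr_ge0 ?normal_pdf_ge0.
  by rewrite ger0_norm ?indicE// ler_wpM2l// normal_pdf_ub.
Qed.

Let measurable_normal_pair (s : R) : s != 0 ->
  measurable_fun setT (fun z : Omega * measurableTypeR R => normal_pdf (U z.1) s z.2).
Proof.
move=> s0.
have -> : (fun z : Omega * measurableTypeR R => normal_pdf (U z.1) s z.2) =
    (fun z => normal_peak s * expR (- (z.2 - U z.1) ^+ 2 / (s ^+ 2 *+ 2))).
  by apply/funext => z; rewrite normal_pdfE.
apply: measurable_funM => //; apply: measurableT_comp => //.
apply: measurable_funM => //; apply: measurableT_comp => //.
apply: measurable_funX; apply: measurable_funB => //.
exact: measurableT_comp mU measurable_fst.
Qed.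

Let measurable_normal_interval (n : nat) (al be : R) :
  measurable_fun setT (fun w => \int[mu]_y (\1_(`]al, be]) y * normal_pdf (U w) (n.+1%:R^-1 ^+ 2) y)).
Proof.
set s := (_ ^+ 2); have s0 : s != 0 by rewrite expf_neq0// invr_eq0.
have mI : measurable_fun setT (\1_(`]al, be]) : R -> R) by exact: measurable_indic.
apply/measurable_EFinP.
have -> : EFin \o (fun w => \int[mu]_y (\1_(`]al, be]) y * normal_pdf (U w) s y)) =
    fubini_F mu (fun z => (\1_(`]al, be]) z.2 * normal_pdf (U z.1) s z.2)%:E).
  apply/funext => w; rewrite /fubini_F /= /Rintegral fineK//.
  apply: (integrable_fin_num measurableT).
  apply: (@normal_pdf_integrable_growth _ _ _ _ 1) => //.
  by move=> x; rewrite indicE mul1r; case: (_ \in _); rewrite ?normr1 ?normr0 ?lerDl ?addr_ge0 ?sqr_ge0.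
apply: measurable_fun_fubini_tonelli_F.
  apply/measurable_EFinP; apply: measurable_funM.
    exact: measurableT_comp mI measurable_snd.
  exact: measurable_normal_pair.
by move=> z; rewrite lee_fin mulr_ge0 ?normal_pdf_ge0.
Qed.

Lemma normal_prob_far (u s r : R) : s != 0 -> 0 < r ->
  mu.-integrable setT (EFin \o (fun y => \1_[set y | r <= `|y - u|] y * normal_pdf u s y)) /\
  \int[mu]_y (\1_[set y | r <= `|y - u|] y * normal_pdf u s y) <= s ^+ 2 / r ^+ 2.
Proof.
move=> s0 r0.
have mfar : measurable [set y : R | r <= `|y - u|].
  have mf : measurable_fun setT (fun y : R => `|y - u|).
    by apply: measurableT_comp => //; exact: measurable_funB.
  have := mf measurableT _ (measurable_itv `[r, +oo[).
  by rewrite setTI preimage_itvcy.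
have i1 : mu.-integrable setT (EFin \o (fun y => \1_[set y | r <= `|y - u|] y * normal_pdf u s y)).
  apply: (@normal_pdf_integrable_growth _ _ _ _ 1) => //.
  by move=> x; rewrite indicE mul1r; case: (_ \in _); rewrite ?normr1 ?normr0 ?lerDl ?addr_ge0 ?sqr_ge0.
split => //.
have i2 : mu.-integrable setT (EFin \o (fun y => (y - u) ^+ 2 * normal_pdf u s y)).
  apply: (@normal_pdf_integrable_growth _ _ _ _ 1) => //.
    by apply: measurable_funX; exact: measurable_funB.
  by move=> x; rewrite mul1r ger0_norm ?sqr_ge0// lerDr.
rewrite -(normal_variance u s0) mulrC -RintegralZl//.
apply: le_Rintegral => //; first exact: RintegrableZ.
move=> y _; rewrite mulrA ler_wpM2r ?normal_pdf_ge0// indicE.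
have [|] := boolP (y \in _); last by rewrite mulr_ge0 ?sqr_ge0// invr_ge0 sqr_ge0.
rewrite inE/= => ry; rewrite mulrC ler_pdivlMr ?exprn_gt0// mul1r -[leRHS]real_normK ?num_real//.
by rewrite ler_pXn2r ?nnegrE// ltW.
Qed.

(** Chebyshev: at distance dl from u, a Gaussian of standard deviation dl^2 has
    mass at most dl^4 / dl^2. *)
Let smooth_near (A : set R) (u c : R) (dl : R) : 0 < dl -> measurable A ->
  (forall y, `|y - u| < dl -> \1_A y = c) -> c = 0 \/ c = 1 ->
  `|\int[mu]_y (\1_A y * normal_pdf u (dl ^+ 2) y) - c| <= dl ^+ 2.
Proof.
move=> dl0 mA Ac c01.
have s0 : dl ^+ 2 != 0 by rewrite expf_neq0// gt_eqF.
have iA : mu.-integrable setT (EFin \o (fun y => \1_A y * normal_pdf u (dl ^+ 2) y)).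
  apply: (@normal_pdf_integrable_growth _ _ _ _ 1) => //.
  by move=> x; rewrite indicE mul1r; case: (_ \in _); rewrite ?normr1 ?normr0 ?lerDl ?addr_ge0 ?sqr_ge0.
have ip := integrable_normal_pdf u (dl ^+ 2).
have ic : mu.-integrable setT (EFin \o (fun y => c * normal_pdf u (dl ^+ 2) y)).
  exact: RintegrableZ.
rewrite -[X in _ - X]mulr1 -[X in _ - _ * X](_ : \int[mu]_x normal_pdf u (dl ^+ 2) x = 1); last first.
  by rewrite /Rintegral integral_normal_pdf.
rewrite -RintegralZl// -RintegralB//.
have iB := RintegrableB measurableT iA ic.
have [i3 far] := normal_prob_far u s0 dl0.
apply: (le_trans (le_normr_Rintegral _ iB)) => //.
have -> : dl ^+ 2 = (dl ^+ 2) ^+ 2 / dl ^+ 2 by rewrite expr2 mulfK.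
apply: le_trans far; rewrite expr2 mulfK//.
apply: le_Rintegral => //; first exact: integrable_norm.
move=> y _; rewrite -mulrBl normrM (ger0_norm (normal_pdf_ge0 _ _ _)) ler_wpM2r ?normal_pdf_ge0//.
rewrite [leRHS]indicE; have [|] := boolP (y \in _).
  move=> _; rewrite indicE; case: c01 => ->; case: (_ \in _) => /=;
    by rewrite ?subrr ?subr0 ?sub0r ?normrN ?normr1 ?normr0.
by rewrite notin_setE/= => /negP; rewrite -ltNge => /Ac ->; rewrite subrr normr0.
Qed.

(** The standard deviation is the square of the shift of the interval, so that the
    end points stay far from u at the scale of the Gaussian; shifting to the right
    selects the half-open interval in the limit. *)
Let smooth_limit (al be u : R) :
  \int[mu]_y (\1_(`](al + n.+1%:R^-1), (be + n.+1%:R^-1)]) y * normal_pdf u (n.+1%:R^-1 ^+ 2) y) @[n --> \oo] --> (\1_(`]al, be]) u : R).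
Proof.
apply/cvgrPdist_le => /= e e0.
pose dl n : R := n.+1%:R^-1.
have dl0 n : 0 < dl n by rewrite invr_gt0.
have dlc (r : R) : 0 < r -> \forall n \near \oo, dl n < r.
  by move=> r0; near=> n; rewrite /dl; near: n; exact: near_infty_natSinv_lt (PosNum r0).
have small : \forall n \near \oo, dl n ^+ 2 <= e.
  near=> n; have : dl n < Num.min e 1 by near: n; apply: dlc; rewrite lt_min e0 ltr01.
  rewrite lt_min => /andP[de d1]; rewrite (le_trans _ (ltW de))// expr2 ler_piMl// ltW//.
have [uA|uA] := boolP (u \in `]al, be]).
  move: (uA); rewrite in_itv/= => /andP[au ub].
  near=> n; rewrite distrC; apply: (@le_trans _ _ (dl n ^+ 2)); last by near: n.
  have -> : (\1_(`]al, be]) u : R) = 1 by rewrite indicE mem_set.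
  apply: smooth_near => //; last by right.
  move=> y; rewrite ltr_norml => /andP[y1 y2]; rewrite indicE mem_set//= in_itv/=.
  have : dl n < (u - al) / 2 by near: n; apply: dlc; rewrite divr_gt0// subr_gt0.
  move: y1 y2; rewrite -/(dl n); have := dl0 n; move: (dl n) => t.
  by move=> *; apply/andP; split; lra.
have -> : (\1_(`]al, be]) u : R) = 0 by rewrite indicE memNset//; apply/negP.
move: (uA); rewrite in_itv/= negb_and -leNgt -ltNge => uA'.
case/orP: uA' => uA'; near=> n; rewrite distrC; (apply: (@le_trans _ _ (dl n ^+ 2)); last by near: n);
  apply: smooth_near => //; try by left.
  move=> y; rewrite ltr_norml => /andP[y1 y2]; rewrite indicE memNset//= in_itv/= => /andP.
  rewrite -/(dl n) in y1 y2 *; case=> a1 a2.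
  by move: y1 y2 a1 a2 (uA'); move: (dl n) => t; lra.
move=> y; rewrite ltr_norml => /andP[y1 y2]; rewrite indicE memNset//= in_itv/= => /andP.
rewrite -/(dl n) in y1 y2 *; case=> a1 a2.
have : dl n < (u - be) / 2 by near: n; apply: dlc; rewrite divr_gt0// subr_gt0.
by move: y1 y2 a1 a2 (uA'); move: (dl n) => t; lra.
Unshelve. all: by end_near. Qed.

(** Convolving the indicator with ever narrower Gaussians and passing to the limit:
    a bounded weight whose cosine transform along U vanishes does not see U. *)
Lemma fourier_interval (al be : R) : \int[P]_w (W w * \1_(`]al, be]) (U w)) = 0.
Proof.
pose F n w : R := W w * \int[mu]_y (\1_(`](al + n.+1%:R^-1), (be + n.+1%:R^-1)]) y * normal_pdf (U w) (n.+1%:R^-1 ^+ 2) y).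
have [||||_ L] := @Rdominated _ _ R P setT measurableT F (fun w => W w * \1_(`]al, be]) (U w)) (fun=> M).
- move=> n; apply: measurable_funM => //; exact: measurable_normal_interval.
- move=> w _; apply: cvgM; first exact: cvg_cst.
  exact: smooth_limit.
- exact: finite_measure_integrable_cst.
- move=> n w _; rewrite /F normrM -[leRHS]mulr1 ler_pM//.
  set s := (_ ^+ 2); have s0 : s != 0 by rewrite expf_neq0// invr_eq0.
  rewrite ger0_norm; last first.
    by apply: Rintegral_ge0 => y _; rewrite mulr_ge0 ?normal_pdf_ge0.
  have <- : \int[mu]_x normal_pdf (U w) s x = 1 by rewrite /Rintegral integral_normal_pdf.
  have ip := integrable_normal_pdf (U w) s.
  have ic (I : set R) : measurable I -> mu.-integrable setT (EFin \o (fun y => \1_I y * normal_pdf (U w) s y)).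
    move=> mI; apply: (@normal_pdf_integrable_growth _ _ _ _ 1) => //.
    by move=> x; rewrite indicE mul1r; case: (_ \in _); rewrite ?normr1 ?normr0 ?lerDl ?addr_ge0 ?sqr_ge0.
  apply: le_Rintegral => //; first exact: ic.
  move=> y _; rewrite ler_piMl ?normal_pdf_ge0// indicE; by case: (_ \in _).
apply: (cvg_unique _ L) => //.
apply: cvg_near_cst; near=> n.
by rewrite smooth_interval// expf_neq0// invr_eq0.
Unshelve. all: by end_near. Qed.

(** Half-open intervals generate the Borel sets and are stable under intersection. *)
Lemma fourier_set (A : set R) : measurable A -> \int[P]_w (W w * \1_A (U w)) = 0.
Proof.
have W0 : \int[P]_w W w = 0.
  rewrite -[RHS](WU0 0 0); apply: eq_Rintegral => w _.
  by rewrite mul0r addr0 cos0 mulr1.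
have m1 (B : set R) : measurable B -> measurable_fun setT (fun w => \1_B (U w) : R).
  by move=> mB; apply: measurableT_comp => //; exact: measurable_indic.
have iW : P.-integrable setT (EFin \o W) by exact: integrable_bounded mW WM.
have i1 (B : set R) : measurable B -> P.-integrable setT (EFin \o (fun w => W w * \1_B (U w))).
  move=> mB; apply: (@integrable_bounded _ M).
    by apply: measurable_funM => //; exact: m1.
  by move=> w; rewrite normrM -[leRHS]mulr1 ler_pM// indicE; case: (_ \in _); rewrite ?normr1 ?normr0.
move=> mA.
apply: (@dynkin_induction _ _ (@ocitv R) (fun B => \int[P]_w (W w * \1_B (U w)) = 0) erefl (@ocitvI R) _ _ _ _ A mA).
- by rewrite -[RHS]W0; apply: eq_Rintegral => w _; rewrite indicT mulr1.
- by move=> _ [[a b] _ <-]; exact: fourier_interval.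
- move=> B mB B0.
  transitivity (\int[P]_w (W w - W w * \1_B (U w))).
    apply: eq_Rintegral => w _; rewrite !indicE in_setC.
    by case: (_ \in _) => /=; rewrite ?mulr1 ?mulr0 ?subrr ?subr0.
  by rewrite RintegralB// ?W0 ?B0 ?subrr//; exact: i1.
- move=> F mF tF F0.
  have mUF : measurable (\bigcup_k F k) by exact: bigcupT_measurable.
  have sumF u : (forall n, \sum_(k < n) \1_(F k) u = 0 :> R) /\ ~ (\bigcup_k F k) u \/
      exists k0, (forall n, \sum_(k < n) \1_(F k) u = (k0 < n)%:R :> R) /\ (\bigcup_k F k) u.
    have [[k0 _ Fu]|nF] := pselect ((\bigcup_k F k) u); last first.
      left; split => // n; rewrite big1// => k _; rewrite indicE memNset// => Fu.
      by apply: nF; exists k.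
    right; exists k0; split; last by exists k0.
    have other k : k != k0 -> \1_(F k) u = 0 :> R.
      move=> kk0; rewrite indicE memNset// => Fku; move/eqP: kk0; apply.
      by apply: (tF k k0) => //; exists u.
    elim=> [|n IH]; first by rewrite big_ord0.
    rewrite big_ord_recr/= IH ltnS; have [->|nk0] := eqVneq n k0.
      by rewrite ltnn leqnn indicE (mem_set Fu) add0r.
    by rewrite other// addr0 (ltn_neqAle k0) eq_sym nk0.
  pose f n w : R := \sum_(k < n) W w * \1_(F k) (U w).
  have [||||_ L] := @Rdominated _ _ R P setT measurableT f (fun w => W w * \1_(\bigcup_k F k) (U w)) (fun=> M).
  + by move=> n; apply: measurable_sum => k; apply: measurable_funM => //; exact: m1.
  + move=> w _; rewrite /f; case: (sumF (U w)) => [[h nU]|[k0 [h hU]]].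
      apply: cvg_near_cst; near=> n.
      by rewrite -mulr_sumr h indicE memNset.
    apply: cvg_near_cst; near=> n.
    rewrite -mulr_sumr h indicE mem_set//; suff -> : (k0 < n)%N by [].
    by near: n; exact: nbhs_infty_gt.
  + exact: finite_measure_integrable_cst.
  + move=> n w _; rewrite /f -mulr_sumr normrM -[leRHS]mulr1 ler_pM//.
    by case: (sumF (U w)) => [[-> _]|[k0 [-> _]]]; rewrite ?normr0//; case: (_ < _)%N; rewrite ?normr1 ?normr0.
  apply: (cvg_unique _ L) => //; apply: cvg_near_cst; apply: nearW => n.
  rewrite /f; elim: n => [|n IH].
    by under eq_Rintegral do rewrite big_ord0; rewrite Rintegral_prob_cst.
  under eq_Rintegral do rewrite big_ord_recr/=.
  rewrite RintegralD//; last exact: i1.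
    by rewrite IH F0 addr0.
  apply: (@integrable_bounded _ M).
    by apply: measurable_sum => k; apply: measurable_funM => //; exact: m1.
  move=> w; rewrite -mulr_sumr normrM -[leRHS]mulr1 ler_pM//.
  by case: (sumF (U w)) => [[-> _]|[k0 [-> _]]]; rewrite ?normr0//; case: (_ < _)%N; rewrite ?normr1 ?normr0.
Unshelve. all: by end_near. Qed.

End smoothing.

(** Induction on the number of variables: the indicator of the first one and the
    weight W form a new weight for the others, and the cosine of a sum is handled
    by product-to-sum formulas. *)
Lemma fourier_boxes (I : eqType) (l : seq I) (U : I -> Omega -> R) (A : I -> set R) :
  (forall i, measurable_fun setT (U i)) -> (forall i, measurable (A i)) -> uniq l ->
  forall (W : Omega -> R) (M : R), measurable_fun setT W -> (forall w, `|W w| <= M) ->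
  (forall (a : I -> R) (th : R),
     \int[P]_w (W w * cos (\sum_(i <- l) a i * U i w + th)) = 0) ->
  \int[P]_w (W w * \prod_(i <- l) \1_(A i) (U i w)) = 0.
Proof.
move=> mU mA; elim: l => [_ W M mW WM h|i l IH /= /andP[il ul] W M mW WM h].
  rewrite -[RHS](h (fun=> 0) 0); apply: eq_Rintegral => w _.
  by rewrite !big_nil addr0 cos0.
have mcos (a : I -> R) th : measurable_fun setT (fun w => cos (\sum_(i <- l) a i * U i w + th)).
  apply: measurableT_comp; first exact: measurable_cosT.
  apply: measurable_funD => //; apply: measurable_sum => k.
  exact: measurable_funM.
have m1 : measurable_fun setT (fun w => \1_(A i) (U i w) : R).
  by apply: measurableT_comp => //; exact: measurable_indic.
under eq_Rintegral do rewrite big_cons mulrA.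
apply: (IH ul _ M).
- exact: measurable_funM.
- by move=> w; rewrite normrM -[leRHS]mulr1 ler_pM// indicE; case: (_ \in _); rewrite ?normr1 ?normr0.
move=> a th.
rewrite -[RHS](@fourier_set (fun w => W w * cos (\sum_(i <- l) a i * U i w + th)) (U i) M _ _ _ _ (A i))//.
- by apply: eq_Rintegral => w _; rewrite mulrAC.
- exact: measurable_funM.
- by move=> w; rewrite normrM -[leRHS]mulr1 ler_pM// abs_cos_le1.
move=> b th'.
pose a' c j := if j == i then c else a j.
have E c w : \sum_(j <- i :: l) a' c j * U j w = c * U i w + \sum_(j <- l) a j * U j w.
  rewrite big_cons /a' eqxx; congr (_ + _); apply: eq_big_seq => j jl.
  by rewrite ifF//; apply/negbTE; apply: contraNneq il => <-.
have i0 c t : P.-integrable setT (EFin \o (fun w => W w * cos (c * U i w + \sum_(j <- l) a j * U j w + t))).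
  apply: (@integrable_bounded _ M).
    apply: measurable_funM => //.
    apply: measurableT_comp; first exact: measurable_cosT.
    apply: measurable_funD => //; apply: measurable_funD; first exact: measurable_funM.
    by apply: measurable_sum => k; exact: measurable_funM.
  by move=> w; rewrite normrM -[leRHS]mulr1 ler_pM// abs_cos_le1.
transitivity (\int[P]_w (2^-1 * (W w * cos (b * U i w + \sum_(j <- l) a j * U j w + (th + th')) +
    W w * cos (- b * U i w + \sum_(j <- l) a j * U j w + (th - th'))))).
  apply: eq_Rintegral => w _.
  set x := \sum_(j <- l) _; set y := U i w.
  have -> : b * y + x + (th + th') = (x + th) + (b * y + th') by ring.
  have -> : - b * y + x + (th - th') = (x + th) - (b * y + th') by ring.
  by move: (x + th) (b * y + th') => u v; rewrite cosD cosB; field.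
rewrite RintegralZl//; last exact: RintegrableD.
rewrite RintegralD//.
under eq_Rintegral do rewrite -E.
under [X in _ + X]eq_Rintegral do rewrite -E.
by rewrite !h addr0 mulr0.
Qed.

(** [fourier_boxes] applied twice, each time with a centered weight: first the
    cosine in V against boxes in U, then the indicator in U against boxes in V. *)
Lemma fourier_independence (I J : eqType) (l1 : seq I) (l2 : seq J)
    (U : I -> Omega -> R) (V : J -> Omega -> R) (A : I -> set R) (B : J -> set R) :
  (forall i, measurable_fun setT (U i)) -> (forall i, measurable (A i)) -> uniq l1 ->
  (forall i, measurable_fun setT (V i)) -> (forall i, measurable (B i)) -> uniq l2 ->
  (forall (a : I -> R) (c : J -> R) (th th' : R),
     \int[P]_w (cos (\sum_(i <- l1) a i * U i w + th) * cos (\sum_(j <- l2) c j * V j w + th')) =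
     \int[P]_w cos (\sum_(i <- l1) a i * U i w + th) *
     \int[P]_w cos (\sum_(j <- l2) c j * V j w + th')) ->
  \int[P]_w (\prod_(i <- l1) \1_(A i) (U i w) * \prod_(j <- l2) \1_(B j) (V j w)) =
  \int[P]_w (\prod_(i <- l1) \1_(A i) (U i w)) * \int[P]_w (\prod_(j <- l2) \1_(B j) (V j w)).
Proof.
move=> mU mA ul1 mV mB ul2 h.
have mcos (K : eqType) (l : seq K) (X : K -> Omega -> R) (a : K -> R) th :
    (forall i, measurable_fun setT (X i)) ->
    measurable_fun setT (fun w => cos (\sum_(i <- l) a i * X i w + th)).
  move=> mX; apply: measurableT_comp; first exact: measurable_cosT.
  apply: measurable_funD => //; apply: measurable_sum => k.
  exact: measurable_funM.
have mprod (K : eqType) (l : seq K) (X : K -> Omega -> R) (C : K -> set R) :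
    (forall i, measurable_fun setT (X i)) -> (forall i, measurable (C i)) ->
    measurable_fun setT (fun w => \prod_(i <- l) \1_(C i) (X i w) : R).
  move=> mX mC; apply: measurable_prod => k _.
  by apply: measurableT_comp => //; exact: measurable_indic.
have bprod (K : eqType) (l : seq K) (X : K -> Omega -> R) (C : K -> set R) w :
    `|\prod_(i <- l) \1_(C i) (X i w) : R| <= 1.
  elim: l => [|k l IH]; first by rewrite big_nil normr1.
  rewrite big_cons normrM -[leRHS]mulr1 ler_pM// indicE.
  by case: (_ \in _); rewrite ?normr1 ?normr0.
have icos (K : eqType) (l : seq K) (X : K -> Omega -> R) (a : K -> R) th :
    (forall i, measurable_fun setT (X i)) ->
    P.-integrable setT (EFin \o (fun w => cos (\sum_(i <- l) a i * X i w + th))).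
  by move=> mX; apply: (@integrable_bounded _ 1) => [|w]; [exact: mcos|exact: abs_cos_le1].
have iprod := fun K l X C mX mC => @integrable_bounded _ 1 (mprod K l X C mX mC) (@bprod K l X C).
have bE (f : Omega -> R) : measurable_fun setT f -> (forall w, `|f w| <= 1) -> `|\int[P]_w f w| <= 1.
  move=> mf f1; have i_f := integrable_bounded mf f1.
  rewrite (le_trans (le_normr_Rintegral _ i_f))// -[leRHS](Rintegral_prob_cst P).
  by apply: le_Rintegral => //; [exact: integrable_norm|exact: finite_measure_integrable_cst].
have bW (f g : Omega -> R) : measurable_fun setT g -> (forall w, `|f w| <= 1) -> (forall w, `|g w| <= 1) ->
    forall w, `|f w - \int[P]_w g w| <= 2.
  by move=> mg f1 g1 w; rewrite (le_trans (ler_normB _ _))// -[leRHS]/(1 + 1) lerD// bE.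
have step1 c th' : \int[P]_w (\prod_(i <- l1) \1_(A i) (U i w) * cos (\sum_(j <- l2) c j * V j w + th')) =
    \int[P]_w (\prod_(i <- l1) \1_(A i) (U i w)) * \int[P]_w cos (\sum_(j <- l2) c j * V j w + th').
  set E := \int[P]_w cos (\sum_(j <- l2) c j * V j w + th').
  have := @fourier_boxes I l1 U A mU mA ul1 (fun w => cos (\sum_(j <- l2) c j * V j w + th') - E) 2 _ _ _.
  have iM : P.-integrable setT (EFin \o (fun w => \prod_(i <- l1) \1_(A i) (U i w) * cos (\sum_(j <- l2) c j * V j w + th'))).
    apply: (@integrable_bounded _ 1); first by apply: measurable_funM; [exact: mprod|exact: mcos].
    by move=> w; rewrite normrM -[leRHS]mulr1 ler_pM// abs_cos_le1.
  have iE : P.-integrable setT (EFin \o (fun w => E * \prod_(i <- l1) \1_(A i) (U i w))).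
    by apply: RintegrableZ => //; exact: iprod.
  rewrite mulrC => H; apply/eqP; rewrite -subr_eq0 -RintegralZl//; last exact: iprod.
  rewrite -RintegralB//; apply/eqP.
  under eq_Rintegral do rewrite [X in X - _]mulrC -mulrBl.
  apply: H.
  - by apply: measurable_funB => //; exact: mcos.
  - by apply: bW => [|w|w]; [exact: mcos|exact: abs_cos_le1|exact: abs_cos_le1].
  move=> a th.
  under eq_Rintegral do rewrite mulrBl [X in X - _]mulrC.
  rewrite RintegralB//; last 2 first.
  - apply: (@integrable_bounded _ 1); first by apply: measurable_funM; exact: mcos.
    by move=> w; rewrite normrM -[leRHS]mulr1 ler_pM// abs_cos_le1.
  - by apply: RintegrableZ => //; exact: icos.
  by rewrite h RintegralZl//; [rewrite mulrC subrr|exact: icos].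
set E := \int[P]_w \prod_(i <- l1) \1_(A i) (U i w).
have := @fourier_boxes J l2 V B mV mB ul2 (fun w => \prod_(i <- l1) \1_(A i) (U i w) - E) 2 _ _ _.
have iM : P.-integrable setT (EFin \o (fun w => \prod_(i <- l1) \1_(A i) (U i w) * \prod_(j <- l2) \1_(B j) (V j w))).
  apply: (@integrable_bounded _ 1); first by apply: measurable_funM; exact: mprod.
  by move=> w; rewrite normrM -[leRHS]mulr1 ler_pM.
have iE : P.-integrable setT (EFin \o (fun w => E * \prod_(j <- l2) \1_(B j) (V j w))).
  by apply: RintegrableZ => //; exact: iprod.
move=> H; apply/eqP; rewrite -subr_eq0 -RintegralZl//; last exact: iprod.
rewrite -RintegralB//; apply/eqP.
under eq_Rintegral do rewrite -mulrBl.
apply: H.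
- by apply: measurable_funB => //; exact: mprod.
- by apply: bW => //; exact: mprod.
move=> c th.
under eq_Rintegral do rewrite mulrBl.
rewrite RintegralB//; last 2 first.
- apply: (@integrable_bounded _ 1); first by apply: measurable_funM; [exact: mprod|exact: mcos].
  by move=> w; rewrite normrM -[leRHS]mulr1 ler_pM// abs_cos_le1.
- by apply: RintegrableZ => //; exact: icos.
by rewrite step1 RintegralZl//; [rewrite subrr|exact: icos].
Qed.

End fourier_uniqueness.

(** * Borel sets of R^d and disintegration of independent families *)

Section vectors.
Context {R : realType} {d : nat}.

Lemma ball_rVP (x y : 'rV[R]_d) (e : R) : 0 < e ->
  ball x e y <-> forall i, `|x ord0 i - y ord0 i| < e.
Proof.
move=> e0; split=> [[_ h] i|h]; first exact: h.
by split=> // i j; rewrite (ord1 i); exact: h.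
Qed.

Lemma continuous_coord (i : 'I_d) : continuous (fun x : 'rV[R]_d => x ord0 i).
Proof.
by move=> x; apply: differentiable_continuous; exact: differentiable_coord.
Qed.

Lemma open_measurable_rV (A : set 'rV[R]_d) : open A -> measurable (A : set (borel_rV R d)).
Proof. by move=> oA; apply: sub_sigma_algebra. Qed.

Lemma continuous_borel_rV (g : 'rV[R]_d -> R) : continuous g ->
  measurable_fun setT (g : borel_rV R d -> R).
Proof.
move=> cg; apply: (measurability _ (RGenOInfty.measurableE R)) => //.
move=> _ [_ [x ->] <-]; rewrite setTI.
apply: open_measurable_rV; apply: open_comp; last exact: rray_open.
by move=> y _; exact: cg.
Qed.

(** An open set is a countable union of balls with rational centers and radii
    1/(n+1), and balls of the max norm are boxes. *)
Lemma measurable_rV {dO} {Omega : measurableType dO} (f : Omega -> 'rV[R]_d) :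
  (forall i, measurable_fun setT (fun w => f w ord0 i)) ->
  measurable_fun setT (f : Omega -> borel_rV R d).
Proof.
move=> mf.
apply: (@measurability _ _ Omega (borel_rV R d) setT f (@open 'rV[R]_d) erefl).
move=> _ [A oA <-].
pose q (c : {ffun 'I_d -> rat}) : 'rV[R]_d := \row_i ratr (c i).
pose B (cn : {ffun 'I_d -> rat} * nat) : set Omega :=
  if `[< ball (q cn.1) cn.2.+1%:R^-1 `<=` A >] then f @^-1` (ball (q cn.1) cn.2.+1%:R^-1) else set0.
have -> : setT `&` f @^-1` A = \bigcup_cn B cn.
  rewrite setTI; apply/seteqP; split=> w; last first.
    by move=> [cn _]; rewrite /B; case: ifPn => // /asboolP; apply.
  rewrite /preimage/= => Afw.
  have /nbhs_ballP[e/= e0 eA] : nbhs (f w) A by exact: open_nbhs_nbhs.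
  have [n ne] : exists n : nat, n.+1%:R^-1 < e / 2.
    have [n _ /(_ n (leqnn n))] := near_infty_natSinv_lt (PosNum (divr_gt0 e0 (ltr0n R 2))).
    by exists n.
  have n0 : 0 < n.+1%:R^-1 :> R by rewrite invr_gt0.
  have qex i : exists c : rat, `|ratr c - f w ord0 i| < n.+1%:R^-1.
    have [|c] := @rat_in_itvoo R (f w ord0 i - n.+1%:R^-1) (f w ord0 i + n.+1%:R^-1).
      by rewrite ltrBlDr -addrA ltrDl addr_gt0.
    by rewrite in_itv/= => /andP[c1 c2]; exists c; rewrite ltr_distl c1 c2.
  pose c := [ffun i => projT1 (cid (qex i))].
  have cw : ball (q c) n.+1%:R^-1 (f w).
    by apply/ball_rVP => // i; rewrite mxE ffunE; exact: (projT2 (cid (qex i))).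
  exists (c, n) => //; rewrite /B ifT//; apply/asboolP => y cy; apply: eA.
  rewrite (splitr e); apply: (@ball_triangle _ _ (q c)).
    by apply: ball_sym; apply: le_ball cw; exact: ltW.
  by apply: le_ball cy; exact: ltW.
apply: countable_bigcupT_measurable => [|cn]; first exact: countableP.
rewrite /B; case: ifPn => // _.
have n0 : 0 < cn.2.+1%:R^-1 :> R by rewrite invr_gt0.
have -> : f @^-1` ball (q cn.1) cn.2.+1%:R^-1 =
    \bigcap_(i in [set: 'I_d]) [set w | `|q cn.1 ord0 i - f w ord0 i| < cn.2.+1%:R^-1].
  apply/seteqP; split=> w /=; rewrite /preimage/= ball_rVP//.
    by move=> h i _; exact: h.
  by move=> h i; exact: h.
apply: fin_bigcap_measurable => // i _.
have mg : measurable_fun setT (fun w => `|q cn.1 ord0 i - f w ord0 i|).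
  by apply: measurableT_comp => //; exact: measurable_funB.
have := mg measurableT _ (measurable_itv `]-oo, (cn.2.+1%:R^-1 : R)[).
by rewrite setTI preimage_itvNyo.
Qed.

End vectors.

Lemma measurable_coordwise {dO} {Omega : measurableType dO} {R : realType} (K : finType)
    (X : K -> Omega -> R) (A : K -> set R) :
  (forall i, measurable_fun setT (X i)) -> (forall i, measurable (A i)) ->
  measurable [set w | forall i, A i (X i w)].
Proof.
move=> mX mA.
have -> : [set w | forall i, A i (X i w)] = \bigcap_(k in [set: K]) ((X k) @^-1` A k).
  by apply/seteqP; split=> w /= h k; [move=> _|]; exact: h.
by apply: fin_bigcap_measurable => // k _; rewrite -[X in measurable X]setTI; exact: mX.
Qed.

Lemma measurable_cube {dO} {Omega : measurableType dO} {R : realType} {d : nat}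
    (X : Omega -> 'rV[R]_d) (y : 'rV[R]_d) (r : R) :
  (forall i, measurable_fun setT (fun w => X w ord0 i)) ->
  measurable [set w | forall i, `|X w ord0 i - y ord0 i| <= r].
Proof.
move=> mX; have -> : [set w | forall i, `|X w ord0 i - y ord0 i| <= r] =
    [set w | forall i, `[y ord0 i - r, y ord0 i + r]%classic (X w ord0 i)].
  by apply/seteqP; split=> w /= h i; have := h i; rewrite /= in_itv/= ler_distl.
by apply: (@measurable_coordwise _ _ _ _ (fun i w => X w ord0 i)
  (fun i => `[y ord0 i - r, y ord0 i + r]%classic)).
Qed.

Section boxes.
Context {R : realType} (K : finType).

Definition boxes : set (set (K -> R)) :=
  [set S | exists A : K -> set R, (forall k, measurable (A k)) /\
     S = [set v | forall k, A k (v k)]].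

(** Functions on a finite set with the product sigma-algebra, for which the boxes
    form a generating pi-system. *)
Definition boxT := g_sigma_algebraType boxes.

Lemma boxes_setI : setI_closed boxes.
Proof.
move=> _ _ [A [mA ->]] [B [mB ->]]; exists (fun k => A k `&` B k); split.
  by move=> k; exact: measurableI.
by apply/seteqP; split=> v /= => [[Av Bv] k|h]; [split|split=> k; case: (h k)].
Qed.

Lemma boxes_setT : boxes setT.
Proof. by exists (fun=> setT); split => //; apply/seteqP; split. Qed.

Lemma measurable_box (A : K -> set R) : (forall k, measurable (A k)) ->
  measurable ([set v | forall k, A k (v k)] : set boxT).
Proof. by move=> mA; apply: sub_sigma_algebra; exists A. Qed.

Lemma measurable_box_coord (k : K) : measurable_fun setT (fun v : boxT => v k : R).
Proof.
move=> _ A mA; rewrite setTI.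
have -> : (fun v : boxT => v k : R) @^-1` A = [set v | forall j, (if j == k then A else setT) (v j)].
  apply/seteqP; split=> v /= => [Av j|/(_ k)]; last by rewrite eqxx.
  by case: eqVneq => [->|].
by apply: (@measurable_box (fun j => if j == k then A else setT)) => j; case: ifP.
Qed.

Lemma measurable_to_box {dO} {Omega : measurableType dO} (f : Omega -> (K -> R)) :
  (forall k, measurable_fun setT (fun w => f w k)) ->
  measurable_fun setT (f : Omega -> boxT).
Proof.
move=> mf; apply: (@measurability _ _ Omega boxT setT f boxes erefl).
move=> _ [_ [A [mA ->]] <-]; rewrite setTI.
exact: (@measurable_coordwise _ _ _ _ (fun k w => f w k)).
Qed.

End boxes.
Arguments boxT : clear implicits.

Section disintegration.
Context {dO} {Omega : measurableType dO} {R : realType} (P : probability Omega R).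
Variables (I J : finType) (U : I -> Omega -> R) (V : J -> Omega -> R).
Hypotheses (mU : forall i, measurable_fun setT (U i)).
Hypotheses (mV : forall j, measurable_fun setT (V j)).
Hypothesis indep : forall (A : I -> set R) (B : J -> set R),
  (forall i, measurable (A i)) -> (forall j, measurable (B j)) ->
  P ([set w | forall i, A i (U i w)] `&` [set w | forall j, B j (V j w)]) =
  (P [set w | forall i, A i (U i w)] * P [set w | forall j, B j (V j w)])%E.

Definition glue (u : I -> R) (v : J -> R) (k : I + J) : R :=
  match k with inl i => u i | inr j => v j end.

Let phi1 (w : Omega) : boxT R (I + J)%type := glue (U ^~ w) (V ^~ w).
Let phi2 (z : Omega * Omega) : boxT R (I + J)%type := glue (U ^~ z.1) (V ^~ z.2).

Let mphi1 : measurable_fun setT phi1.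
Proof. by apply: measurable_to_box => -[i|j]; [exact: mU|exact: mV]. Qed.

Let mphi2 : measurable_fun setT phi2.
Proof.
apply: measurable_to_box => -[i|j].
  exact: (measurableT_comp (mU i) measurable_fst).
exact: (measurableT_comp (mV j) measurable_snd).
Qed.

Let mixin1 := isMeasurableFun.Build _ _ _ _ phi1 mphi1.
Let f1 : {mfun Omega >-> boxT R (I + J)%type} := HB.pack phi1 mixin1.
Let mixin2 := isMeasurableFun.Build _ _ _ _ phi2 mphi2.
Let f2 : {mfun (Omega * Omega)%type >-> boxT R (I + J)%type} := HB.pack phi2 mixin2.

(** The law of (U, V) is a product because both measures agree on boxes; the formula
    is then the definition of a product measure. *)
Lemma disintegration (S : set (boxT R (I + J)%type)) : measurable S ->
  P [set w | S (glue (U ^~ w) (V ^~ w))] =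
  (\int[P]_w P [set w' | S (glue (U ^~ w) (V ^~ w'))])%E.
Proof.
move=> mS.
have E : pushforward P f1 S = pushforward (P \x P)%E f2 S.
  apply: (@measure_unique _ R (boxT R (I + J)%type) (@boxes R (I + J)%type) (fun=> setT)
    erefl (@boxes_setI _ _) (fun=> @boxes_setT _ _)) => //.
  - by rewrite bigcup_const.
  - move=> _ [A [mA ->]].
    set Q := [set v | _]; change (P (phi1 @^-1` Q) = (P \x P)%E (phi2 @^-1` Q)); rewrite {}/Q.
    have -> : phi1 @^-1` [set v | forall k, A k (v k)] =
        [set w | forall i, A (inl i) (U i w)] `&` [set w | forall j, A (inr j) (V j w)].
      apply/seteqP; split=> w /= => [h|[h1 h2] [i|j]]; last 2 first.
      - exact: h1.
      - exact: h2.
      by split=> k; [exact: (h (inl k))|exact: (h (inr k))].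
    have -> : phi2 @^-1` [set v | forall k, A k (v k)] =
        [set w | forall i, A (inl i) (U i w)] `*` [set w | forall j, A (inr j) (V j w)].
      apply/seteqP; split=> w /= => [h|[h1 h2] [i|j]]; last 2 first.
      - exact: h1.
      - exact: h2.
      by split=> k; [exact: (h (inl k))|exact: (h (inr k))].
    rewrite (@indep (fun i => A (inl i)) (fun j => A (inr j)))// product_measure1E//.
      exact: (@measurable_coordwise _ _ _ _ U (fun i => A (inl i))).
    exact: (@measurable_coordwise _ _ _ _ V (fun j => A (inr j))).
  - by move=> _; change (P setT < +oo)%E; rewrite probability_setT ltry.
change (pushforward P f1 S = (\int[P]_w P [set w' | S (glue (U ^~ w) (V ^~ w'))])%E).
rewrite {}E; change ((P \x P)%E (phi2 @^-1` S) = (\int[P]_w P [set w' | S (glue (U ^~ w) (V ^~ w'))])%E).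
rewrite /product_measure1.
apply: eq_integral => w _ /=; congr (P _).
by apply/seteqP; split=> w'; rewrite /xsection/= inE.
Qed.

Lemma disintegration_le (S : set (boxT R (I + J)%type)) (c : \bar R) : measurable S ->
  (forall w, P [set w' | S (glue (U ^~ w) (V ^~ w'))] <= c)%E ->
  (P [set w | S (glue (U ^~ w) (V ^~ w))] <= c)%E.
Proof.
move=> mS h; rewrite disintegration//.
have c0 : (0 <= c)%E by apply: le_trans (h point).
apply: (@le_trans _ _ (\int[P]_w (cst c w))%E); last first.
  by rewrite integral_cst//= probability_setT mule1.
apply: ge0_le_integral => //.
have -> : (fun w => P [set w' | S (glue (U ^~ w) (V ^~ w'))]) = P \o xsection (phi2 @^-1` S).
  apply/funext => w /=; congr (P _).
  by apply/seteqP; split=> w'; rewrite /xsection/= inE.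
apply: measurable_fun_xsection.
by rewrite -[X in measurable X]setTI; exact: mphi2.
Qed.

End disintegration.

(** * Square-integrable variables and the first chaos *)

Lemma cvg_ext {R : realType} (u v : nat -> R) (l l' : R) :
  (forall n, u n = v n) -> l' = l -> v n @[n --> \oo] --> l' -> u n @[n --> \oo] --> l.
Proof. by move=> /funext -> ->. Qed.

Section square_integrable.
Context {dO} {Omega : measurableType dO} {R : realType} (P : probability Omega R).
Implicit Types X Y Z : Omega -> R.

Definition L2 Y := measurable_fun setT Y /\
  P.-integrable setT (EFin \o (fun w => Y w ^+ 2)).

Definition dot X Y : R := \int[P]_w (X w * Y w).

Lemma L2_mul X Y : L2 X -> L2 Y -> P.-integrable setT (EFin \o (fun w => X w * Y w)).
Proof.
move=> [mX iX] [mY iY].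
apply: (@le_Rintegrable _ _ R P setT measurableT _ (fun w => X w ^+ 2 + Y w ^+ 2)).
- exact: measurable_funM.
- move=> w _; rewrite normrM -(@real_normK _ (X w)) ?num_real// -(@real_normK _ (Y w)) ?num_real//.
  by have := normr_ge0 (X w); have := normr_ge0 (Y w); move: `|X w| `|Y w| => x y; nra.
- exact: RintegrableD.
Qed.

Lemma L2_cst c : L2 (fun=> c).
Proof. by split => //; exact: finite_measure_integrable_cst. Qed.

Lemma L2Z c Y : L2 Y -> L2 (fun w => c * Y w).
Proof.
move=> [mY iY]; split; first exact: measurable_funM.
have := RintegrableZ measurableT (c ^+ 2) iY.
by rewrite /comp; under eq_fun do rewrite -exprMn.
Qed.

Lemma L2D X Y : L2 X -> L2 Y -> L2 (fun w => X w + Y w).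
Proof.
move=> X2 Y2; have [mX iX] := X2; have [mY iY] := Y2; split; first exact: measurable_funD.
have := RintegrableD measurableT (RintegrableD measurableT iX iY) (RintegrableZ measurableT 2 (L2_mul X2 Y2)).
rewrite /comp; under eq_fun => w do
  (have -> : X w ^+ 2 + Y w ^+ 2 + 2 * (X w * Y w) = (X w + Y w) ^+ 2 by ring).
by [].
Qed.

Lemma L2B X Y : L2 X -> L2 Y -> L2 (fun w => X w - Y w).
Proof.
move=> X2 Y2; have := L2D X2 (L2Z (-1) Y2).
by congr L2; apply/funext => w; rewrite mulN1r.
Qed.

Lemma L2_sum (I : eqType) (s : seq I) (F : I -> Omega -> R) :
  (forall i, i \in s -> L2 (F i)) -> L2 (fun w => \sum_(i <- s) F i w).
Proof.
elim: s => [_|i s IH h]; first by under eq_fun do rewrite big_nil; exact: L2_cst.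
under eq_fun do rewrite big_cons; apply: L2D; first by apply: h; rewrite mem_head.
by apply: IH => j js; apply: h; rewrite in_cons js orbT.
Qed.

Lemma dotC X Y : dot X Y = dot Y X.
Proof. by apply: eq_Rintegral => w _; rewrite mulrC. Qed.

Lemma dotDl X Y Z : L2 X -> L2 Y -> L2 Z -> dot (fun w => X w + Y w) Z = dot X Z + dot Y Z.
Proof.
move=> X2 Y2 Z2; rewrite /dot -RintegralD//; try exact: L2_mul.
by apply: eq_Rintegral => w _; rewrite mulrDl.
Qed.

Lemma dotZl c X Z : L2 X -> L2 Z -> dot (fun w => c * X w) Z = c * dot X Z.
Proof.
move=> X2 Z2; rewrite /dot -RintegralZl//; last exact: L2_mul.
by apply: eq_Rintegral => w _; rewrite mulrA.
Qed.

Lemma dotBl X Y Z : L2 X -> L2 Y -> L2 Z -> dot (fun w => X w - Y w) Z = dot X Z - dot Y Z.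
Proof.
move=> X2 Y2 Z2; rewrite /dot -RintegralB//; try exact: L2_mul.
by apply: eq_Rintegral => w _; rewrite mulrBl.
Qed.

Lemma dot_suml (I : eqType) (s : seq I) (F : I -> Omega -> R) Z :
  (forall i, i \in s -> L2 (F i)) -> L2 Z ->
  dot (fun w => \sum_(i <- s) F i w) Z = \sum_(i <- s) dot (F i) Z.
Proof.
elim: s => [_ Z2|i s IH h Z2].
  rewrite big_nil /dot; under eq_Rintegral do rewrite big_nil mul0r.
  exact: Rintegral_prob_cst.
have hs j : j \in s -> L2 (F j) by move=> js; apply: h; rewrite in_cons js orbT.
rewrite big_cons -IH// -dotDl//; last 2 first.
- by apply: h; rewrite mem_head.
- exact: L2_sum.
by apply: eq_Rintegral => w _; rewrite big_cons.
Qed.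

Lemma dot_ge0 X : 0 <= dot X X.
Proof. by apply: Rintegral_ge0 => w _; rewrite -expr2 sqr_ge0. Qed.

(** The free weight l does the work of the Cauchy-Schwarz inequality when a factor
    tends to 0. *)
Lemma dot_young X Y (l : R) : 0 < l -> L2 X -> L2 Y ->
  `|dot X Y| <= l * dot X X + l^-1 * dot Y Y.
Proof.
move=> l0 X2 Y2.
rewrite (le_trans (le_normr_Rintegral _ (L2_mul X2 Y2)))//.
rewrite /dot -!RintegralZl//; try exact: L2_mul.
rewrite -RintegralD//; try by (apply: RintegrableZ => //; exact: L2_mul).
apply: le_Rintegral => //.
- by apply: integrable_norm; exact: L2_mul.
- by apply: RintegrableD => //; (apply: RintegrableZ => //; exact: L2_mul).
move=> w _; rewrite normrM -!expr2 -(@real_normK _ (X w)) ?num_real// -(@real_normK _ (Y w)) ?num_real//.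
have := normr_ge0 (X w); have := normr_ge0 (Y w); move: `|X w| `|Y w| => x y x0 y0.
have -> : l * x ^+ 2 + l^-1 * y ^+ 2 = l * (x - l^-1 * y) ^+ 2 + 2 * (x * y).
  by field; exact: lt0r_neq0.
have : 0 <= l * (x - l^-1 * y) ^+ 2 by rewrite mulr_ge0 ?sqr_ge0// ltW.
have : 0 <= x * y by rewrite mulr_ge0.
lra.
Qed.

Lemma dot_small (D : nat -> Omega -> R) X :
  (forall n, L2 (D n)) -> L2 X -> dot (D n) (D n) @[n --> \oo] --> 0 ->
  dot X (D n) @[n --> \oo] --> 0.
Proof.
move=> D2 X2 D0; apply/cvgr0Pnorm_le => e e0.
(* Half of e bounds l times dot X X, the other half the term in D n. *)
pose l := e / (2 * (dot X X + 1)).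
have c0 : 0 < dot X X + 1 by rewrite ltr_wpDl// dot_ge0.
have l0 : 0 < l by rewrite divr_gt0// mulr_gt0.
have : \forall n \near \oo, dot (D n) (D n) <= l * (e / 2).
  near=> n; rewrite (le_trans (ler_norm _))//; near: n.
  by move/cvgr0Pnorm_le : D0; apply; rewrite mulr_gt0// divr_gt0.
apply: filterS => n hn; rewrite (le_trans (dot_young l0 X2 (D2 n)))//.
rewrite (splitr e) lerD//; last first.
  by rewrite mulrC ler_pdivrMr// mulrC.
rewrite /l -mulrA ler_pM2l// mulrC ler_pdivrMr ?mulr_gt0// mulrA mulVf// mul1r.
by rewrite lerDl.
Unshelve. all: by end_near. Qed.

Lemma dot_cvg (Yn : nat -> Omega -> R) Y X :
  (forall n, L2 (Yn n)) -> L2 Y -> L2 X ->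
  dot (fun w => Y w - Yn n w) (fun w => Y w - Yn n w) @[n --> \oo] --> 0 ->
  dot (Yn n) X @[n --> \oo] --> dot Y X.
Proof.
move=> Yn2 Y2 X2 h.
have D2 n : L2 (fun w => Y w - Yn n w) by exact: L2B.
have := dot_small D2 X2 h.
move=> h0.
have E n : dot (Yn n) X = dot Y X - dot X (fun w => Y w - Yn n w).
  by rewrite (dotC X) dotBl// opprB addrC subrK.
apply: (cvg_ext E (subr0 _)).
by apply: cvgB => //; exact: cvg_cst.
Qed.

Lemma dot_sq_cvg (Yn : nat -> Omega -> R) Y :
  (forall n, L2 (Yn n)) -> L2 Y ->
  dot (fun w => Y w - Yn n w) (fun w => Y w - Yn n w) @[n --> \oo] --> 0 ->
  dot (Yn n) (Yn n) @[n --> \oo] --> dot Y Y.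
Proof.
move=> Yn2 Y2 h.
have E n : dot (Yn n) (Yn n) = dot (fun w => Y w - Yn n w) (fun w => Y w - Yn n w) + 2 * dot (Yn n) Y - dot Y Y.
  have D2 : L2 (fun w => Y w - Yn n w) by exact: L2B.
  have e1 : dot Y (fun w => Y w - Yn n w) = dot Y Y - dot (Yn n) Y by rewrite dotC dotBl.
  have e2 : dot (Yn n) (fun w => Y w - Yn n w) = dot (Yn n) Y - dot (Yn n) (Yn n).
    by rewrite dotC dotBl// (dotC Y).
  by rewrite [in RHS]dotBl// e1 e2; ring.
apply: (@cvg_ext _ _ _ _ (0 + 2 * dot Y Y - dot Y Y) E); first by ring.
apply: cvgB; last exact: cvg_cst.
apply: cvgD => //; apply: cvgM; first exact: cvg_cst.
exact: dot_cvg.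
Qed.

Lemma ler_dist_cos (x y : R) : `|cos x - cos y| <= `|x - y|.
Proof.
wlog xy : x y / x < y.
  move=> wl; have [/wl//|/wl|->] := ltgtP x y; last by rewrite !subrr.
  by rewrite distrC [leRHS]distrC.
have [c _ E] := @MVT R cos (fun x => - sin x) x y xy (fun x _ => is_derive_cos x)
   (continuous_subspaceT (@continuous_cos R)).
by rewrite distrC E normrM normrN (distrC x) ler_piMl// abs_sin_le1.
Qed.

Lemma cos_cvg (Yn : nat -> Omega -> R) Y (a th : R) :
  (forall n, L2 (Yn n)) -> L2 Y ->
  dot (fun w => Y w - Yn n w) (fun w => Y w - Yn n w) @[n --> \oo] --> 0 ->
  \int[P]_w cos (a * Yn n w + th) @[n --> \oo] --> \int[P]_w cos (a * Y w + th).
Proof.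
move=> Yn2 Y2 h.
pose D n w := `|Y w - Yn n w|.
have D2 n : L2 (D n).
  have [mD iD] := L2B Y2 (Yn2 n); split; first exact: measurableT_comp.
  by rewrite /comp/D; under eq_fun do rewrite real_normK ?num_real//.
have D0 : dot (D n) (D n) @[n --> \oo] --> 0.
  under eq_cvg => n do
    (have -> : dot (D n) (D n) = dot (fun w => Y w - Yn n w) (fun w => Y w - Yn n w)
      by apply: eq_Rintegral => w _; rewrite -!expr2 real_normK ?num_real).
  exact: h.
have ic (Z : Omega -> R) : L2 Z -> P.-integrable setT (EFin \o (fun w => cos (a * Z w + th))).
  move=> [mZ _]; apply: (@integrable_bounded _ _ _ _ _ 1) => [|w]; last exact: abs_cos_le1.
  apply: measurableT_comp; first exact: measurable_cosT.
  by apply: measurable_funD => //; exact: measurable_funM.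
have k0 : `|a| * dot (fun=> 1) (D n) @[n --> \oo] --> 0.
  rewrite -(mulr0 `|a|); apply: cvgM; first exact: cvg_cst.
  exact: dot_small D2 (L2_cst 1) D0.
apply/subr_cvg0; apply: norm_cvg0.
apply: (@squeeze_cvgr _ _ _ _ (fun=> 0) (fun n => `|a| * dot (fun=> 1) (D n))) => //; last exact: cvg_cst.
near=> n; rewrite normr_ge0/= -RintegralB//; try exact: ic.
have iB := RintegrableB measurableT (ic _ (Yn2 n)) (ic _ Y2).
rewrite (le_trans (le_normr_Rintegral _ iB))//.
rewrite /dot -RintegralZl//; last exact: L2_mul (L2_cst 1) (D2 n).
apply: le_Rintegral => //.
- exact: integrable_norm.
- by apply: RintegrableZ => //; exact: L2_mul (L2_cst 1) (D2 n).
move=> w _; rewrite (le_trans (ler_dist_cos _ _))//.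
by rewrite mul1r /D opprD addrACA subrr addr0 -mulrBr normrM distrC.
Unshelve. all: by end_near. Qed.

Lemma dot0_ae Y : L2 Y -> dot Y Y = 0 -> {ae P, forall w, Y w = 0}.
Proof.
move=> [mY iY] Y0.
have h : (\int[P]_w `|(Y w ^+ 2)%:E| = 0)%E.
  under eq_integral do rewrite gee0_abs ?lee_fin ?sqr_ge0//.
  by rewrite -[LHS]fineK ?[fine _]Y0//; exact: integrable_fin_num iY.
have mY2 : measurable_fun setT (fun w => (Y w ^+ 2)%:E).
  by apply/measurable_EFinP; exact: measurable_funX.
move/(ae_eq_integral_abs P measurableT mY2).1 : h.
apply: filterS => w /(_ I)[] /eqP.
by rewrite sqrf_eq0 => /eqP.
Qed.

End square_integrable.

Section first_chaos.
Context {dO} {Omega : measurableType dO} {R : realType} (P : probability Omega R).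
Variables (d : nat) (H T : R) (B : R -> Omega -> 'rV[R]_d).
Hypotheses (T0 : 0 < T) (fB : fBm P H T B).

Definition covR (t s : R) : R :=
  2^-1 * (t `^ (2 * H) + s `^ (2 * H) - `|t - s| `^ (2 * H)).

Let gB : gaussian_process P T B. Proof. by case: fB. Qed.

(** A list of triples (c, (t, i)) stands for the linear combination of the c B_t^i. *)
Definition lincomb (s : seq (R * (R * 'I_d))) (w : Omega) : R :=
  \sum_(p <- s) p.1 * B p.2.1 w ord0 p.2.2.

Definition in_time (s : seq (R * (R * 'I_d))) : bool := all (fun p => 0 <= p.2.1 <= T) s.

Lemma lincomb_gaussian s : in_time s -> gaussian_rv P (lincomb s).
Proof.
move=> /allP os; have [->|s0] := eqVneq s [::].
  have [] := @gB 0 (fun=> 0) (fun _ _ => 0); first by case.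
  move=> m h; split.
    by move: m; congr measurable_fun; apply/funext => w; rewrite /lincomb big_nil big_ord0.
  move: h; congr ex; apply/funext => m'; congr ex; apply/funext => s'.
  have -> : lincomb [::] = (fun w => \sum_(k < 0) \sum_(i < d) 0 * B 0 w ord0 i).
    by apply/funext => w; rewrite /lincomb big_nil big_ord0.
  by [].
have [p0 _] : exists p0, p0 \in s by case: s s0 {os} => // p s _; exists p; rewrite mem_head.
have := @gB (size s) (fun k => (nth p0 s k).2.1)
  (fun k i => if i == (nth p0 s k).2.2 then (nth p0 s k).1 else 0).
have -> : (fun w => \sum_(k < size s) \sum_(i < d) (if i == (nth p0 s k).2.2 then (nth p0 s k).1 else 0) *
    B (nth p0 s k).2.1 w ord0 i) = lincomb s.
  apply/funext => w; rewrite /lincomb (big_nth p0) big_mkord; apply: eq_bigr => k _.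
  rewrite (bigD1 (nth p0 s k).2.2)//= eqxx big1 ?addr0// => i /negPf ->.
  by rewrite mul0r.
by apply=> k; apply: os; exact: mem_nth.
Qed.

Lemma B_measurable t i : 0 <= t <= T -> measurable_fun setT (fun w => B t w ord0 i).
Proof.
move=> tT; have [] := @lincomb_gaussian [:: (1, (t, i))]; first by rewrite /in_time /= tT.
by move=> m _; move: m; congr measurable_fun; apply/funext => w; rewrite /lincomb big_seq1 mul1r.
Qed.

Lemma B_L2 t i : 0 <= t <= T -> L2 P (fun w => B t w ord0 i).
Proof.
move=> tT; split; first exact: B_measurable.
apply/integrableP; split.
  by apply/measurable_EFinP; apply: measurable_funX; exact: B_measurable.
have [_ _ _ /(_ t t i i tT tT)] := fB; rewrite unlock => E.
have -> : (\int[P]_w `|(EFin \o (fun w => (B t w ord0 i ^+ 2)%R)) w| =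
   \int[P]_w (B t w ord0 i * B t w ord0 i)%:E)%E.
  by apply: eq_integral => w _; rewrite /= ger0_norm ?sqr_ge0.
by rewrite E ltry.
Qed.

Lemma B_dot t s i j : 0 <= t <= T -> 0 <= s <= T ->
  dot P (fun w => B t w ord0 i) (fun w => B s w ord0 j) = covR t s * (i == j)%:R.
Proof.
move=> tT sT; have [_ _ _ /(_ t s i j tT sT)] := fB.
by rewrite unlock /dot /Rintegral => ->.
Qed.

Lemma B_mean t i : 0 <= t <= T -> \int[P]_w B t w ord0 i = 0.
Proof.
by move=> tT; have [_ _ /(_ t i tT)] := fB; rewrite unlock /Rintegral => ->.
Qed.

Let inT s p : in_time s -> p \in s -> 0 <= p.2.1 <= T.
Proof. by move=> /allP; apply. Qed.

Lemma lincomb_L2 s : in_time s -> L2 P (lincomb s).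
Proof.
move=> os; apply: L2_sum => p ps; apply: L2Z; apply: B_L2; exact: inT os ps.
Qed.

Lemma lincomb_mean s : in_time s -> \int[P]_w lincomb s w = 0.
Proof.
move=> os.
have -> : \int[P]_w lincomb s w = dot P (lincomb s) (fun=> 1).
  by apply: eq_Rintegral => w _; rewrite mulr1.
rewrite dot_suml; last exact: L2_cst; last first.
  by move=> p ps; apply: L2Z; apply: B_L2; exact: inT os ps.
rewrite big1_seq// => p /andP[_ ps].
have pT := inT os ps.
rewrite dotZl; [|exact: B_L2|exact: L2_cst].
rewrite /dot; under eq_Rintegral do rewrite mulr1.
by rewrite B_mean ?mulr0.
Qed.

Lemma lincomb_cf s a th : in_time s ->
  \int[P]_w cos (a * lincomb s w + th) =
  cos th * expR (- (a ^+ 2 * dot P (lincomb s) (lincomb s) / 2)).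
Proof.
move=> os; rewrite gaussian_cf//.
- exact: lincomb_gaussian.
- by case: (lincomb_L2 os).
- exact: lincomb_mean.
Qed.

(** The first Wiener chaos of B: the closure in L^2 of the linear combinations of
    the coordinates of B at times of [0, T]. *)
Definition chaos (Y : Omega -> R) := L2 P Y /\
  exists s : nat -> seq (R * (R * 'I_d)), (forall n, in_time (s n)) /\
    dot P (fun w => Y w - lincomb (s n) w) (fun w => Y w - lincomb (s n) w) @[n --> \oo] --> 0.

Lemma chaos_L2 Y : chaos Y -> L2 P Y. Proof. by case. Qed.

Lemma lincomb_chaos s : in_time s -> chaos (lincomb s).
Proof.
move=> os; split; first exact: lincomb_L2.
exists (fun=> s); split => //.
rewrite (_ : (fun n : nat => _) = cst 0); first exact: cvg_cst.
apply/funext => n; rewrite /dot; under eq_Rintegral do rewrite subrr mul0r.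
exact: Rintegral_prob_cst.
Qed.

Lemma chaosZ c Y : chaos Y -> chaos (fun w => c * Y w).
Proof.
move=> [Y2 [s [os sY]]]; split; first exact: L2Z.
exists (fun n => map (fun p => (c * p.1, p.2)) (s n)).
have E n w : lincomb (map (fun p => (c * p.1, p.2)) (s n)) w = c * lincomb (s n) w.
  by rewrite /lincomb big_map mulr_sumr; apply: eq_bigr => p _; rewrite mulrA.
split; first by move=> n; rewrite /in_time all_map; exact: os.
have F n : dot P (fun w => c * Y w - lincomb (map (fun p => (c * p.1, p.2)) (s n)) w)
    (fun w => c * Y w - lincomb (map (fun p => (c * p.1, p.2)) (s n)) w) =
    c ^+ 2 * dot P (fun w => Y w - lincomb (s n) w) (fun w => Y w - lincomb (s n) w).
  have h : L2 P (fun w => Y w - lincomb (s n) w) by apply: L2B => //; exact: lincomb_L2.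
  rewrite /dot -RintegralZl//; last exact: L2_mul.
  by apply: eq_Rintegral => w _; rewrite E; ring.
apply: (cvg_ext F (mulr0 (c ^+ 2))); apply: cvgM => //; exact: cvg_cst.
Qed.

Lemma chaosD X Y : chaos X -> chaos Y -> chaos (fun w => X w + Y w).
Proof.
move=> [X2 [s [os sX]]] [Y2 [t [ot tY]]]; split; first exact: L2D.
exists (fun n => s n ++ t n).
have E n w : lincomb (s n ++ t n) w = lincomb (s n) w + lincomb (t n) w.
  by rewrite /lincomb big_cat.
split; first by move=> n; rewrite /in_time all_cat; apply/andP; split; [exact: os|exact: ot].
have a2 n : L2 P (fun w => X w - lincomb (s n) w) by apply: L2B => //; exact: lincomb_L2.
have b2 n : L2 P (fun w => Y w - lincomb (t n) w) by apply: L2B => //; exact: lincomb_L2.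
apply: (@squeeze_cvgr _ _ _ _ (fun=> 0) (fun n =>
  2 * dot P (fun w => X w - lincomb (s n) w) (fun w => X w - lincomb (s n) w) +
  2 * dot P (fun w => Y w - lincomb (t n) w) (fun w => Y w - lincomb (t n) w))).
- near=> n; rewrite dot_ge0/= /dot -!RintegralZl//; try exact: L2_mul.
  rewrite -RintegralD//; try (by apply: RintegrableZ => //; exact: L2_mul).
  apply: le_Rintegral => //.
  + have ost : in_time (s n ++ t n).
      by rewrite /in_time all_cat; apply/andP; split; [exact: os|exact: ot].
    by apply: L2_mul; (apply: L2B; [exact: L2D|exact: lincomb_L2]).
  + by apply: RintegrableD => //; (apply: RintegrableZ => //; exact: L2_mul).
  move=> w _; rewrite E.
  move: (X w) (Y w) (lincomb (s n) w) (lincomb (t n) w) => x y u v.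
  rewrite -!expr2 -subr_ge0.
  have -> : 2 * (x - u) ^+ 2 + 2 * (y - v) ^+ 2 - (x + y - (u + v)) ^+ 2 = ((x - u) - (y - v)) ^+ 2 by ring.
  exact: sqr_ge0.
- exact: cvg_cst.
- apply: (@cvg_ext _ _ _ _ (2 * 0 + 2 * 0) (fun=> erefl)); first by ring.
  by apply: cvgD; (apply: cvgM => //; exact: cvg_cst).
Unshelve. all: by end_near. Qed.

Lemma chaosB X Y : chaos X -> chaos Y -> chaos (fun w => X w - Y w).
Proof.
move=> cX cY; have := chaosD cX (chaosZ (-1) cY).
by congr chaos; apply/funext => w; rewrite mulN1r.
Qed.

Lemma chaos_sum (I : Type) (s : seq I) (F : I -> Omega -> R) :
  (forall i, chaos (F i)) -> chaos (fun w => \sum_(i <- s) F i w).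
Proof.
move=> h; elim: s => [|i s IH].
  have -> : (fun w => \sum_(i <- [::]) F i w) = lincomb [::].
    by apply/funext => w; rewrite /lincomb !big_nil.
  exact: lincomb_chaos.
by under eq_fun do rewrite big_cons; exact: chaosD.
Qed.

(** Characteristic functions are continuous in L^2, hence stay Gaussian in the limit. *)
Lemma chaos_cf Y a th : chaos Y ->
  \int[P]_w cos (a * Y w + th) = cos th * expR (- (a ^+ 2 * dot P Y Y / 2)).
Proof.
move=> [Y2 [s [os sY]]].
have l2 n := lincomb_L2 (os n).
have := cos_cvg (a := a) (th := th) l2 Y2 sY.
move=> c0.
have {}c0 := cvg_ext (fun n => esym (lincomb_cf a th (os n))) erefl c0.
move: c0 => c1; apply/esym; apply: (cvg_unique _ _ c1) => //.
apply: cvgM; first exact: cvg_cst.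
apply: (cvg_comp (fun n => - (a ^+ 2 * dot P (lincomb (s n)) (lincomb (s n)) / 2)) (@expR R)); last exact: continuous_expR.
apply: cvgN; apply: cvgM; last exact: cvg_cst.
apply: cvgM; first exact: cvg_cst.
exact: dot_sq_cvg.
Qed.

(** D is orthogonal to its own approximations, hence to itself. *)
Lemma chaos_orthogonal_zero D : chaos D ->
  (forall t i, 0 <= t <= T -> dot P D (fun w => B t w ord0 i) = 0) ->
  {ae P, forall w, D w = 0}.
Proof.
move=> [D2 [s [os sD]]] h; apply: dot0_ae => //.
have l2 n := lincomb_L2 (os n).
have := dot_cvg l2 D2 D2 sD.
have E n : dot P (lincomb (s n)) D = 0.
  rewrite dot_suml//; last first.
    by move=> p ps; apply: L2Z; apply: B_L2; exact: inT (os n) ps.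
  rewrite big1_seq// => p /andP[_ ps]; have pT := inT (os n) ps.
  rewrite dotZl//; last exact: B_L2.
  by rewrite dotC h ?mulr0.
move=> c1; apply: (cvg_unique _ c1) => //; apply: (cvg_ext E erefl); exact: cvg_cst.
Qed.

(** The product of cosines is a sum of cosines of X + Y and X - Y, which have the
    same variance when X and Y are orthogonal. *)
Lemma chaos_cos_indep X Y th th' : chaos X -> chaos Y -> dot P X Y = 0 ->
  \int[P]_w (cos (X w + th) * cos (Y w + th')) =
  \int[P]_w cos (X w + th) * \int[P]_w cos (Y w + th').
Proof.
move=> cX cY XY0.
have X2 := chaos_L2 cX; have Y2 := chaos_L2 cY.
have cf1 Z t : chaos Z -> \int[P]_w cos (Z w + t) = cos t * expR (- (dot P Z Z / 2)).
  by move=> /(@chaos_cf Z 1 t); rewrite expr1n mul1r => <-; apply: eq_Rintegral => w _; rewrite mul1r.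
have ic Z t : chaos Z -> P.-integrable setT (EFin \o (fun w => cos (Z w + t))).
  move=> [[mZ _] _]; apply: (@integrable_bounded _ _ _ _ _ 1) => [|w]; last exact: abs_cos_le1.
  apply: measurableT_comp; first exact: measurable_cosT.
  exact: measurable_funD.
transitivity (\int[P]_w (2^-1 * (cos ((X w + Y w) + (th + th')) + cos ((X w - Y w) + (th - th'))))).
  apply: eq_Rintegral => w _.
  have -> : (X w + Y w) + (th + th') = (X w + th) + (Y w + th') by ring.
  have -> : (X w - Y w) + (th - th') = (X w + th) - (Y w + th') by ring.
  by move: (X w + th) (Y w + th') => u v; rewrite cosD cosB; field.
rewrite RintegralZl//; last by apply: RintegrableD => //; apply: ic; [exact: chaosD|exact: chaosB].
rewrite RintegralD//; [|by apply: ic; exact: chaosD|by apply: ic; exact: chaosB].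
rewrite !cf1//; [|exact: chaosB|exact: chaosD].
have -> : dot P (fun w => X w + Y w) (fun w => X w + Y w) = dot P X X + dot P Y Y.
  rewrite dotDl//; last exact: L2D.
  by rewrite (dotC _ X) (dotC _ Y) !dotDl// (dotC _ Y X) XY0; ring.
have -> : dot P (fun w => X w - Y w) (fun w => X w - Y w) = dot P X X + dot P Y Y.
  rewrite dotBl//; last exact: L2B.
  by rewrite (dotC _ X) (dotC _ Y) !dotBl// (dotC _ Y X) XY0; ring.
set e1 := dot P X X; set e2 := dot P Y Y.
have -> : - ((e1 + e2) / 2) = - (e1 / 2) + - (e2 / 2) by field.
by rewrite cosD cosB expRD; field.
Qed.

End first_chaos.

Lemma covRC {R : realType} (H s t : R) : covR H s t = covR H t s.
Proof. by rewrite /covR distrC [s `^ _ + _]addrC. Qed.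

(** * The second difference of |u|^q *)

Section odd_power.
Context {R : realType}.
Implicit Types x y p q : R.

(** The odd extension of x^p; it is 1/(p+1) times the derivative of |x|^(p+1). *)
Definition oddpow p x : R := Num.sg x * `|x| `^ p.

Lemma oddpow_pos p x : 0 <= x -> 0 < p -> oddpow p x = x `^ p.
Proof.
rewrite le_eqVlt => /predU1P[<-|x0] p0.
  by rewrite /oddpow sgr0 mul0r powR0// gt_eqF.
by rewrite /oddpow gtr0_sg// mul1r gtr0_norm.
Qed.

Lemma norm_oddpow p x : `|oddpow p x| <= `|x| `^ p.
Proof.
rewrite /oddpow normrM (ger0_norm (powR_ge0 _ _)) ler_piMl ?powR_ge0//.
by rewrite normr_sg lern1 leq_b1.
Qed.

Lemma norm_powR_small p (e : R) : 0 < p -> 0 < e -> \forall x \near (0 : R), `|x| `^ p < e.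
Proof.
move=> p0 e0; have d0 : 0 < e `^ p^-1 by rewrite powR_gt0.
exists (e `^ p^-1) => //= x; rewrite /ball_/= sub0r normrN.
move=> /(gt0_ltr_powR p0); rewrite !nnegrE => /(_ (normr_ge0 _) (ltW d0)).
by rewrite -powRrM mulVf ?gt_eqF// powRr1// ltW.
Qed.

Lemma continuous_oddpow p : 0 < p -> continuous (oddpow p).
Proof.
move=> p0 x; have [->|x0] := eqVneq x 0.
  rewrite /continuous_at {2}/oddpow sgr0 mul0r; apply/cvgr0Pnorm_lt => e e0.
  by apply: filterS (norm_powR_small p0 e0) => y; apply: le_lt_trans; exact: norm_oddpow.
have c1 : (fun y => `|y| `^ p) @ x --> `|x| `^ p.
  have nx : 0 < `|x| by rewrite normr_gt0.
  apply: (@continuous_comp _ _ _ (@Num.norm _ R) (fun y : R => y `^ p)); first exact: norm_continuous.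
  apply: differentiable_continuous; apply/derivable1_diffP.
  by have [] := @is_derive1_powR R p `|x| nx.
have c2 : Num.sg y @[y --> x] --> Num.sg x; last exact: (cvgM c2 c1).
apply: cvg_near_cst; near=> y.
have : `|x - y| < `|x| by near: y; apply: cvgr_dist_lt; rewrite ?normr_gt0//; exact: cvg_id.
have /orP[x1|x1] : (x < 0) || (0 < x) by rewrite -neq_lt (x0).
  rewrite (ltr0_norm x1) (ltr0_sg x1) => h; rewrite ltr0_sg//.
  by move: h; rewrite ltr_norml => /andP[]; lra.
rewrite (gtr0_sg x1) (gtr0_norm x1) => h; rewrite gtr0_sg//.
by move: h; rewrite ltr_norml => /andP[]; lra.
Unshelve. all: by end_near. Qed.

Lemma is_derive_abs_powR q x : 1 < q ->
  is_derive x 1 (fun y : R => `|y| `^ q) (q * oddpow (q - 1) x).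
Proof.
move=> q1; have q10 : 0 < q - 1 by rewrite subr_gt0.
case: (ltgtP x 0) => x0.
- have nx : 0 < - x by rewrite oppr_gt0.
  apply: (@near_eq_is_derive _ _ _ (fun y : R => (- y) `^ q)).
    near=> y; rewrite ltr0_norm//; near: y; exact: lt_nbhsl.
  have h := is_derive1_powR q nx.
  have h2 : is_derive x 1 (fun y : R => - y) (-1) by apply: is_derive_eq.
  apply: (is_derive_eq (is_derive1_comp h h2)).
  by rewrite /oddpow ltr0_sg// ltr0_norm// /GRing.scale/=; ring.
- apply: (@near_eq_is_derive _ _ _ (fun y : R => y `^ q)).
    near=> y; rewrite gtr0_norm//; near: y; exact: lt_nbhsr.
  apply: (is_derive_eq (is_derive1_powR q x0)).
  by rewrite /oddpow gtr0_sg// gtr0_norm// mul1r.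
- rewrite x0; apply/is_derive1_caratheodory; exists (oddpow (q - 1)); split.
  + move=> z; rewrite subr0 normr0 powR0 ?gt_eqF ?(lt_trans ltr01)// subr0.
    rewrite /oddpow mulrAC -normrEsg mulrC.
    have [->|z0] := eqVneq z 0.
      by rewrite normr0 mulr0 powR0// gt_eqF// (lt_trans ltr01).
    have nz : 0 < `|z| by rewrite normr_gt0.
    by rewrite powRB ?implybT ?gt_eqF// powRr1 ?ltW// divfK ?gt_eqF.
  + exact: continuous_oddpow.
  + by rewrite /oddpow sgr0 mul0r mulr0.
Unshelve. all: by end_near. Qed.

Lemma powR_antitone (s a b : R) : s <= 0 -> 0 < a -> a <= b -> b `^ s <= a `^ s.
Proof.
move=> s0 a0 ab; have b0 := lt_le_trans a0 ab.
rewrite -(opprK s) powRN [leRHS]powRN lef_pV2 ?posrE ?powR_gt0//.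
by apply: ge0_ler_powR; rewrite ?nnegrE ?oppr_ge0//; exact: ltW.
Qed.

End odd_power.

Lemma oddpowN {R : realType} (p x : R) : oddpow p (- x) = - oddpow p x.
Proof. by rewrite /oddpow sgrN normrN mulNr. Qed.

Section segment_integral.
Context {R : realType}.
Local Notation mu := (@lebesgue_measure R).
Implicit Types (a b c : R) (f : R -> R).

Lemma continuous_integrable_seg f a b : continuous f -> mu.-integrable `[a, b] (EFin \o f).
Proof.
move=> cf; apply: continuous_compact_integrable; first exact: segment_compact.
exact: continuous_subspaceT.
Qed.

Lemma integrable_subseg f a b a' b' : a <= a' -> b' <= b ->
  mu.-integrable `[a, b] (EFin \o f) -> mu.-integrable `[a', b'] (EFin \o f).
Proof.
move=> aa bb; apply: integrableS => //.
by apply: subset_itv; rewrite bnd_simp.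
Qed.

Lemma Rintegral_seg_split f a b c : a <= c -> c <= b -> mu.-integrable `[a, b] (EFin \o f) ->
  \int[mu]_(r in `[a, b]) f r = \int[mu]_(r in `[a, c]) f r + \int[mu]_(r in `[c, b]) f r.
Proof.
move=> ac cb fi.
have := @Rintegral_itvB R f (BLeft a) (BRight b) c fi.
rewrite !bnd_simp => /(_ ac cb) /eqP.
rewrite subr_eq addrC => /eqP ->; congr (_ + _).
apply: Rintegral_itv_obnd_cbnd.
apply: integrableS fi => //; apply: subset_itv; rewrite ?bnd_simp//.
Qed.

Lemma Rintegral_seg_le_cst f a b (C : R) : a <= b -> mu.-integrable `[a, b] (EFin \o f) ->
  (forall r, a <= r <= b -> f r <= C) -> \int[mu]_(r in `[a, b]) f r <= C * (b - a).
Proof.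
move=> ab fi fC.
have ci : mu.-integrable `[a, b] (EFin \o (fun=> C)).
  by apply: continuous_integrable_seg => x; exact: cvg_cst.
rewrite (@le_trans _ _ (\int[mu]_(r in `[a, b]) C))//.
  by apply: le_Rintegral => // x /=; rewrite in_itv/=; exact: fC.
rewrite Rintegral_cst//= lebesgue_measure_itv/= lte_fin.
case: ifPn => //=; rewrite -leNgt => ba.
by have -> : a = b by [apply/eqP; rewrite eq_le ab ba]; rewrite subrr mulr0.
Qed.

Lemma Rintegral_seg_ge0_mono f a b a' b' : a <= a' -> b' <= b ->
  mu.-integrable `[a, b] (EFin \o f) -> (forall r, 0 <= f r) ->
  \int[mu]_(r in `[a', b']) f r <= \int[mu]_(r in `[a, b]) f r.
Proof.
move=> aa bb fi f0; have fi' := integrable_subseg aa bb fi.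
rewrite /Rintegral fine_le//; [exact: integrable_fin_num|exact: integrable_fin_num|].
apply: ge0_subset_integral => //.
- by case/integrableP: fi.
- by move=> x _; rewrite lee_fin.
- by apply: subset_itv; rewrite bnd_simp.
Qed.

End segment_integral.

Section second_difference_kernel.
Context {R : realType} (q T : R).
Hypotheses (q1 : 1 < q) (q2 : q < 2) (T0 : 0 < T).
Local Notation mu := (@lebesgue_measure R).
Implicit Types e r u : R.

Let p0 : 0 < q - 1. Proof. by rewrite subr_gt0. Qed.
Let q0 : 0 < q. Proof. by rewrite (lt_trans ltr01). Qed.

Let q20 : q - 2 <= 0. Proof. by rewrite subr_le0 ltW. Qed.

(** Second backward difference, with step e, of u |-> |u|^q at u. *)
Definition secdiff e u : R := `|u| `^ q - 2 * `|u - e| `^ q + `|u - 2 * e| `^ q.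

(** Second difference in u, at T, T - e and T - 2e, of the derivative in r of the
    covariance of fractional Brownian motion at times r and u; its primitive is,
    up to sign, half a second difference of |u|^q. *)
Definition seckernel e r : R :=
  q / 2 * (oddpow (q - 1) (T - r) - 2 * oddpow (q - 1) (T - e - r) + oddpow (q - 1) (T - 2 * e - r)).

Lemma continuous_seckernel e : continuous (seckernel e).
Proof.
have c a : continuous (fun r => oddpow (q - 1) (a - r)).
  move=> r; apply: (@continuous_comp _ _ _ (fun r => a - r) (oddpow (q - 1))).
    by apply: cvgB; [exact: cvg_cst|exact: cvg_id].
  exact: continuous_oddpow.
move=> r; apply: cvgM; first exact: cvg_cst.
apply: cvgD; last exact: c.
apply: cvgB; first exact: c.
by apply: cvgM; [exact: cvg_cst|exact: c].
Qed.

Lemma is_derive_secdiff e r : is_derive r 1 (fun r => - (2^-1 * secdiff e (T - r))) (seckernel e r).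
Proof.
have d a : is_derive r 1 (fun r => `|a - r| `^ q) (- (q * oddpow (q - 1) (a - r))).
  have h : is_derive r 1 (fun r : R => a - r) (-1).
    by apply: (is_derive_eq (is_deriveB (is_derive_cst a _ _) (is_derive_id _ _))); rewrite sub0r.
  have h2 := is_derive_abs_powR (a - r) q1.
  by apply: (is_derive_eq (@is_derive1_comp R (fun y : R => `|y| `^ q) (fun r : R => a - r) r _ _ h2 h)); rewrite mulrN1.
have E : (fun r => - (2^-1 * secdiff e (T - r))) =
   (fun r => - (2^-1 * (`|T - r| `^ q - 2 * `|T - e - r| `^ q + `|T - 2 * e - r| `^ q))).
  by apply/funext => x; rewrite /secdiff ![T - x - _]addrAC.
rewrite E /seckernel.
have d1 := d T; have d2 := d (T - e); have d3 := d (T - 2 * e).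
by apply: is_derive_eq; rewrite /GRing.scale/=; field.
Qed.

Lemma Rintegral_seckernel e a b : a <= b ->
  \int[mu]_(r in `[a, b]) seckernel e r = 2^-1 * (secdiff e (T - a) - secdiff e (T - b)).
Proof.
move=> ab; rewrite (FTC_Rintegral (is_derive_secdiff e) (@continuous_seckernel e) ab).
by ring.
Qed.

Lemma oddpow_mvt (a b : R) : 0 <= a -> a < b -> exists2 c, a < c < b &
  oddpow (q - 1) b - oddpow (q - 1) a = (q - 1) * c `^ (q - 2) * (b - a).
Proof.
move=> a0 ab.
have h (x : R) : x \in `]a, b[%R -> is_derive x 1 (oddpow (q - 1)) ((q - 1) * x `^ (q - 2)).
  rewrite in_itv/= => /andP[ax _]; have x0 := le_lt_trans a0 ax.
  apply: (@near_eq_is_derive _ _ _ (fun y : R => y `^ (q - 1))).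
    near=> y; rewrite oddpow_pos// ltW//; near: y; exact: lt_nbhsr.
  by apply: (is_derive_eq (is_derive1_powR (q - 1) x0)); congr (_ * _ `^ _); ring.
have [c cab E] := MVT ab h (continuous_subspaceT (continuous_oddpow p0)).
by exists c => //; rewrite -in_itv.
Unshelve. all: by end_near. Qed.

Lemma oddpow_homo (a b : R) : 0 <= a -> a <= b -> oddpow (q - 1) a <= oddpow (q - 1) b.
Proof.
move=> a0 ab; rewrite !oddpow_pos//; last exact: le_trans ab.
by apply: ge0_ler_powR => //; rewrite ?nnegrE; [exact: ltW|exact: le_trans ab].
Qed.

(** Increments of x^(q-1) decrease, as q - 1 < 1. *)
Lemma seckernel_le0 e r : 0 < e -> r <= T - 2 * e -> seckernel e r <= 0.
Proof.
move=> e0 rT; rewrite /seckernel; apply: mulr_ge0_le0; first by rewrite divr_ge0// ltW.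
have [c1 /andP[c11 c12] E1] := @oddpow_mvt (T - 2 * e - r) (T - e - r) ltac:(lra) ltac:(lra).
have [c2 /andP[c21 c22] E2] := @oddpow_mvt (T - e - r) (T - r) ltac:(lra) ltac:(lra).
have c10 : 0 < c1 by lra.
have : c2 `^ (q - 2) <= c1 `^ (q - 2) by apply: (powR_antitone q20) => //; lra.
move: E1 E2; have -> : T - e - r - (T - 2 * e - r) = e by ring.
have -> : T - r - (T - e - r) = e by ring.
move=> E1 E2 h.
have : (q - 1) * c2 `^ (q - 2) * e <= (q - 1) * c1 `^ (q - 2) * e.
  by rewrite ler_pM2r// ler_pM2l.
lra.
Qed.

(** The mean value theorem on each of the two steps. *)
Lemma secdiff_mvt e u : 0 < e -> 2 * e <= u -> exists x1 x2 : R,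
  [/\ u - 2 * e <= x1, x1 <= x2, x2 <= u &
   secdiff e u = q * e * (oddpow (q - 1) x2 - oddpow (q - 1) x1)].
Proof.
move=> e0 eu.
have ca : continuous (fun y : R => `|y| `^ q).
  apply: is_derive_continuous => x; exact: is_derive_abs_powR.
have [c1] := MVT (ltac:(lra) : u - 2 * e < u - e)
  (fun x _ => is_derive_abs_powR x q1) (continuous_subspaceT ca).
rewrite in_itv/= => /andP[c11 c12] E1.
have [c2] := MVT (ltac:(lra) : u - e < u)
  (fun x _ => is_derive_abs_powR x q1) (continuous_subspaceT ca).
rewrite in_itv/= => /andP[c21 c22] E2.
exists c1, c2; split; [lra|lra|lra|].
rewrite /secdiff; move: E1 E2.
have -> : u - e - (u - 2 * e) = e by ring.
have -> : u - (u - e) = e by ring.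
move=> E1 E2.
have -> : q * e * (oddpow (q - 1) c2 - oddpow (q - 1) c1) =
   q * oddpow (q - 1) c2 * e - q * oddpow (q - 1) c1 * e by ring.
by rewrite -E1 -E2; ring.
Qed.

Lemma secdiff_ge0 e u : 0 < e -> 2 * e <= u -> 0 <= secdiff e u.
Proof.
move=> e0 eu; have [x1 [x2 [h1 h2 h3 ->]]] := secdiff_mvt e0 eu.
rewrite !mulr_ge0// ?(ltW q0) ?(ltW e0)// subr_ge0 oddpow_homo//; lra.
Qed.

(** Away from 0 a second difference is of order e^2, as the second derivative of
    |u|^q is bounded on [u / 2, u]. *)
Lemma secdiff_le e u : 0 < e -> 4 * e <= u ->
  secdiff e u <= 2 * q * (q - 1) * (u / 2) `^ (q - 2) * e ^+ 2.
Proof.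
move=> e0 eu; have [x1 [x2 [h1 + h3 ->]]] := @secdiff_mvt e u e0 ltac:(lra).
have u20 : 0 < u / 2 by lra.
have k0 : 0 <= (q - 1) * (u / 2) `^ (q - 2) by rewrite mulr_ge0 ?powR_ge0// ltW.
rewrite le_eqVlt => /predU1P[->|h2].
  by rewrite subrr mulr0 mulr_ge0 ?sqr_ge0// -mulrA mulr_ge0// mulr_ge0// ltW.
have [c /andP[c1 c2] ->] := @oddpow_mvt x1 x2 ltac:(lra) h2.
have -> : 2 * q * (q - 1) * (u / 2) `^ (q - 2) * e ^+ 2 =
  q * e * ((q - 1) * (u / 2) `^ (q - 2) * (2 * e)) by ring.
rewrite ler_pM2l ?mulr_gt0//; apply: ler_pM.
- by rewrite mulr_ge0 ?powR_ge0// ltW.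
- by lra.
- rewrite ler_pM2l//; apply: (powR_antitone q20) => //; lra.
- by lra.
Qed.

(** At the singularity the second difference is of order e^q, much larger than the
    e^2 of [secdiff_le]. *)
Lemma secdiff0 e : 0 < e -> secdiff e 0 = (2 `^ q - 2) * e `^ q.
Proof.
move=> e0; rewrite /secdiff !sub0r !normrN normr0 powR0 ?gt_eqF// gtr0_norm//.
by rewrite gtr0_norm ?mulr_gt0// powRM ?ltW//; ring.
Qed.

Lemma secdiff2 e : 0 < e -> secdiff e (2 * e) = (2 `^ q - 2) * e `^ q.
Proof.
move=> e0; rewrite /secdiff subrr normr0 powR0 ?gt_eqF//.
have -> : 2 * e - e = e by ring.
rewrite gtr0_norm ?mulr_gt0// gtr0_norm// powRM ?ltW//; ring.
Qed.

Lemma seckernel_bound e r : 0 < e -> T - 2 * e <= r <= T ->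
  `|seckernel e r| <= 2 * q * (2 * e) `^ (q - 1).
Proof.
move=> e0 /andP[r1 r2]; rewrite /seckernel normrM (@ger0_norm _ (q / 2)); last by rewrite divr_ge0// ltW.
have b x : - (2 * e) <= x -> x <= 2 * e -> `|oddpow (q - 1) x| <= (2 * e) `^ (q - 1).
  move=> x1 x2; apply: (le_trans (norm_oddpow _ _)).
  by apply: ge0_ler_powR; rewrite ?nnegrE ?(ltW p0)//; [lra|rewrite ler_norml x1].
have b1 := b (T - r) ltac:(lra) ltac:(lra).
have b2 := b (T - e - r) ltac:(lra) ltac:(lra).
have b3 := b (T - 2 * e - r) ltac:(lra) ltac:(lra).
have -> : 2 * q * (2 * e) `^ (q - 1) = q / 2 * (4 * (2 * e) `^ (q - 1)) by field.
rewrite ler_pM2l ?divr_gt0// (le_trans (ler_normD _ _))//.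
have := ler_normB (oddpow (q - 1) (T - r)) (2 * oddpow (q - 1) (T - e - r)).
have -> : `|2 * oddpow (q - 1) (T - e - r)| = 2 * `|oddpow (q - 1) (T - e - r)|.
  by rewrite (normrM 2) normr_nat.
lra.
Qed.

Let absk e := fun r => `|seckernel e r|.

Let iabs e a b : mu.-integrable `[a, b] (EFin \o absk e).
Proof.
apply: continuous_integrable_seg => x.
apply: (@continuous_comp _ _ _ (seckernel e) (@Num.norm _ R)); first exact: continuous_seckernel.
exact: norm_continuous.
Qed.

(** Before T - 2e the kernel has constant sign, so its mass is read off the primitive. *)
Let int_abs e t : 0 < e -> 0 <= t -> t <= T - 2 * e ->
  \int[mu]_(r in `[0, t]) absk e r = 2^-1 * (secdiff e (T - t) - secdiff e T).
Proof.
move=> e0 t0 tT.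
have -> : \int[mu]_(r in `[0, t]) absk e r = \int[mu]_(r in `[0, t]) (- 1 * seckernel e r).
  apply: eq_Rintegral => r; rewrite inE/= in_itv/= => /andP[_ rt].
  by rewrite /absk ler0_norm ?mulN1r//; apply: seckernel_le0 => //; exact: le_trans tT.
rewrite RintegralZl//; last by apply: continuous_integrable_seg; exact: continuous_seckernel.
by rewrite Rintegral_seckernel// subr0; ring.
Qed.

(** On the scale e^q the kernel has bounded mass, loses all mass before T - eta, and
    acts near T like the point mass - a0 at T. *)
Lemma seckernel_peak : exists C1 a0 : R, [/\ 0 < C1, 0 < a0 &
  forall eta rho : R, 0 < eta -> eta <= T -> 0 < rho -> exists e : R,
  [/\ 0 < e, 2 * e <= T,
     \int[mu]_(r in `[0, T]) `|seckernel e r| <= C1 * e `^ q,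
     \int[mu]_(r in `[0, T - eta]) `|seckernel e r| <= rho * e `^ q &
     `| \int[mu]_(r in `[T - eta, T]) seckernel e r + a0 * e `^ q | <= rho * e `^ q ]].
Proof.
have g2 : 2 < 2 `^ q :> R.
  have : (1 : R) `^ (q - 1) < 2 `^ (q - 1).
    by apply: gt0_ltr_powR; rewrite ?nnegrE// ltr1n.
  rewrite powR1 => h; rewrite -[q](subrK 1) powRD ?pnatr_eq0 ?implybT// powRr1//; lra.
exists (2^-1 * (2 `^ q - 2) + 4 * q * 2 `^ (q - 1)), (2^-1 * (2 `^ q - 2)); split.
- rewrite ltr_pwDr//; first by rewrite !mulr_gt0// powR_gt0.
  by rewrite mulr_ge0// subr_ge0 ltW.
- by rewrite mulr_gt0// subr_gt0.
move=> eta rho eta0 etaT rho0.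
(* k e^2 bounds half the second difference at eta; e1 makes it at most rho e^q. *)
pose k := q * (q - 1) * (eta / 2) `^ (q - 2).
have k0 : 0 < k by rewrite !mulr_gt0// powR_gt0// divr_gt0.
pose e1 := (rho / k) `^ (2 - q)^-1.
have e10 : 0 < e1 by rewrite powR_gt0// divr_gt0.
pose e := Num.min (eta / 4) e1.
have e0 : 0 < e by rewrite lt_min e10 divr_gt0.
have e4 : 4 * e <= eta by rewrite mulrC -ler_pdivlMr// ge_min lexx.
have ee : k * e ^+ 2 <= rho * e `^ q.
  have -> : e ^+ 2 = e `^ (2 - q) * e `^ q.
    rewrite -powRD ?(gt_eqF e0) ?implybT//.
    by rewrite subrK powR_mulrn ?ltW.
  rewrite mulrA ler_pM2r ?powR_gt0// mulrC -ler_pdivlMr//.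
  have -> : rho / k = e1 `^ (2 - q).
    by rewrite /e1 -powRrM mulVf ?gt_eqF ?subr_gt0// powRr1// divr_ge0// ltW.
  apply: ge0_ler_powR; rewrite ?nnegrE ?subr_ge0 ?(ltW e0) ?(ltW e10) ?(ltW q2)//.
  by rewrite /e ge_min lexx orbT.
have De : secdiff e eta <= 2 * (rho * e `^ q).
  by rewrite (le_trans (secdiff_le e0 e4))// (le_trans _ (ler_wpM2l _ ee))// /k; lra.
have D0 : 0 <= secdiff e eta by apply: secdiff_ge0 => //; lra.
have DT : 0 <= secdiff e T by apply: secdiff_ge0 => //; lra.
exists e; split => //.
- lra.
- rewrite (@Rintegral_seg_split _ (absk e) 0 T (T - 2 * e))//; [|lra|lra].
  rewrite int_abs//; [|lra].
  have -> : T - (T - 2 * e) = 2 * e by ring.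
  have := @Rintegral_seg_le_cst _ (absk e) (T - 2 * e) T (2 * q * (2 * e) `^ (q - 1)) ltac:(lra) (iabs _ _ _)
    (fun r => @seckernel_bound e r e0).
  have -> : T - (T - 2 * e) = 2 * e by ring.
  rewrite secdiff2//.
  have -> : 2 * q * (2 * e) `^ (q - 1) * (2 * e) = 4 * q * 2 `^ (q - 1) * e `^ q.
    rewrite powRM ?ltW//.
    have -> : e `^ q = e `^ (q - 1) * e.
      by rewrite -[X in _ * X](powRr1 (ltW e0)) -powRD ?subrK// gt_eqF// implybT.
    by ring.
  lra.
- rewrite int_abs//; [|lra|lra].
  have -> : T - (T - eta) = eta by ring.
  lra.
- rewrite Rintegral_seckernel; last lra.
  have -> : T - (T - eta) = eta by ring.
  rewrite subrr secdiff0//.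
  have -> : 2^-1 * (secdiff e eta - (2 `^ q - 2) * e `^ q) + 2^-1 * (2 `^ q - 2) * e `^ q = 2^-1 * secdiff e eta by ring.
  rewrite ger0_norm ?mulr_ge0//; lra.
Qed.

End second_difference_kernel.

(** * Wiener integrals in the first chaos *)

(** The integral of a nonnegative function is a supremum over the simple functions
    below it, hence monotone without measurability; this spares the measurability
    of inner integrals. *)
Lemma ge0_le_integral_nomeas {d} {X : measurableType d} {R : realType}
    (m : {measure set X -> \bar R}) (f g : X -> \bar R) (D : set X) :
  (forall x, D x -> (0 <= f x)%E) -> (forall x, D x -> (f x <= g x)%E) ->
  (\int[m]_(x in D) f x <= \int[m]_(x in D) g x)%E.
Proof.
move=> f0 fg; rewrite !ge0_integralE//; last by move=> x Dx; rewrite (le_trans (f0 _ Dx))// fg.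
apply: le_ereal_sup => _ [h /= hf <-]; exists h => //= x.
by rewrite (le_trans (hf x))// lee_restrict.
Qed.

Section energy_norm.
Context {R : realType} (H T : R).
Hypotheses (H1 : 1 / 2 < H) (H2 : H < 1) (T0 : 0 < T).
Local Notation mu := (@lebesgue_measure R).
Implicit Types (t : R) (g : R -> R).

Let q1 : 1 < 2 * H. Proof. move: H1 H2; lra. Qed.
Let p0 : 0 < 2 * H - 1. Proof. move: H1 H2; lra. Qed.

(** The weight H (2H - 1) |r - s|^(2H-2) is at least this constant on [0, T]^2,
    since 2H - 2 <= 0. *)
Definition energy_cst : R := H * (2 * H - 1) * T `^ (2 * H - 2).

Lemma energy_cst_gt0 : 0 < energy_cst.
Proof. by rewrite /energy_cst !mulr_gt0 ?powR_gt0//; move: H1 H2; lra. Qed.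

Lemma L1_le_energy t g : t <= T -> mu.-integrable `[0, t] (EFin \o g) ->
  ((energy_cst * (\int[mu]_(r in `[0, t]) `|g r|) ^+ 2)%:E <= absH_norm2 H t g)%E.
Proof.
move=> tT ig; rewrite /absH_norm2.
have ing : mu.-integrable `[0, t] (EFin \o (fun r => `|g r|)) by exact: integrable_norm.
have mg : measurable_fun (`[0%R, t] : set R) (fun r => `|g r|).
  by apply/measurable_EFinP; case/integrableP: ing.
set I := \int[mu]_(r in `[0, t]) `|g r|.
have IE (c : R) : (\int[mu]_(s in `[0%R, t]) (c * `|g s|)%:E = (c * I)%:E)%E.
  rewrite /I -RintegralZl// /Rintegral fineK//; apply: integrable_fin_num => //.
  exact: RintegrableZ.
have c0 : 0 <= H * (2 * H - 1) by rewrite mulr_ge0//; move: H1 H2; lra.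
rewrite /energy_cst -mulrA EFinM lee_wpmul2l// ?lee_fin//.
have I0 : 0 <= I by apply: Rintegral_ge0 => r _.
have -> : T `^ (2 * H - 2) * I ^+ 2 = (T `^ (2 * H - 2) * I) * I by ring.
rewrite -IE; apply: ge0_le_integral_nomeas => [r _|r].
  by rewrite lee_fin !mulr_ge0// powR_ge0.
rewrite /= in_itv/= => /andP[r0 rt].
have -> : ((T `^ (2 * H - 2) * I * `|g r|)%:E =
    \int[mu]_(s in `[0%R, t]) (T `^ (2 * H - 2) * `|g r| * `|g s|)%:E)%E.
  by rewrite IE; congr EFin; ring.
(* With the convention that 0 to a negative power is 0, the lower bound fails on
   the diagonal, which is a null set. *)
rewrite (@ae_eq_integral _ _ _ mu `[0%R, t] (fun s => ((T `^ (2 * H - 2) * `|g r| * `|g s|) * \1_(~` [set r]) s)%:E)).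
- apply: ge0_le_integral_nomeas => [s _|s].
    by rewrite lee_fin !mulr_ge0// powR_ge0.
  rewrite /= in_itv/= => /andP[s0 st]; rewrite lee_fin indicE.
  have [->|sr] := eqVneq s r.
    rewrite memNset ?mulr0 ?mulr_ge0 ?powR_ge0//=; exact/not_notP.
  rewrite mem_set ?mulr1/=; last exact/eqP.
  rewrite -mulrA [leRHS]mulrC ler_wpM2r ?mulr_ge0//.
  apply: powR_antitone; first by move: H2; lra.
    by rewrite normr_gt0 subr_eq0 eq_sym.
  rewrite ler_norml; apply/andP; split; lra.
- exact: measurable_itv.
- by apply/measurable_EFinP; apply: measurable_funM.
- apply/measurable_EFinP; apply: measurable_funM; first exact: measurable_funM.
  apply: measurable_funTS; apply: measurable_indic; exact: measurableC.
- exists [set r]; split => //; first exact: lebesgue_measure_set1.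
  move=> s; apply: contraPP => sr /=; rewrite not_implyE/= => -[_]; apply.
  by rewrite indicE mem_set ?mulr1.
Qed.

Lemma energy_cvg_L1 t (g : nat -> R -> R) : t <= T ->
  (forall n, mu.-integrable `[0, t] (EFin \o g n)) ->
  absH_norm2 H t (g n) @[n --> \oo] --> 0%E ->
  \int[mu]_(r in `[0, t]) `|g n r| @[n --> \oo] --> 0.
Proof.
move=> tT ig g0; apply/cvgr0Pnorm_lt => e e0.
have k0 : 0 < energy_cst * e ^+ 2 by rewrite mulr_gt0 ?energy_cst_gt0// exprn_gt0.
have : \forall n \near \oo, (absH_norm2 H t (g n) < (energy_cst * e ^+ 2)%:E)%E.
  apply: (g0 [set y | (y < (energy_cst * e ^+ 2)%:E)%E]).
  have := lt_nbhsl k0; apply: filterS => y; by rewrite /= lte_fin.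
apply: filterS => n hn.
have := le_lt_trans (L1_le_energy tT (ig n)) hn.
rewrite lte_fin ltr_pM2l ?energy_cst_gt0//.
have I0 : 0 <= \int[mu]_(r in `[0, t]) `|g n r| by apply: Rintegral_ge0 => r _.
by rewrite ger0_norm// ltr_pXn2r// nnegrE// ltW.
Qed.

(** The derivative in r of the covariance of B_r and B_u. *)
Definition covkernel (u r : R) : R :=
  H * (oddpow (2 * H - 1) r - oddpow (2 * H - 1) (r - u)).

Lemma continuous_covkernel u : continuous (covkernel u).
Proof.
move=> r; apply: cvgM; first exact: cvg_cst.
apply: cvgB; first exact: (continuous_oddpow p0).
apply: (@continuous_comp _ _ _ (fun r => r - u) (oddpow (2 * H - 1))).
  by apply: cvgB; [exact: cvg_id|exact: cvg_cst].
exact: continuous_oddpow.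
Qed.

Lemma is_derive_cov (u r : R) : is_derive r 1
  (fun r => 2^-1 * (`|r| `^ (2 * H) + u `^ (2 * H) - `|r - u| `^ (2 * H))) (covkernel u r).
Proof.
have h1 := is_derive_abs_powR r q1.
have h2 := is_derive_abs_powR (r - u) q1.
have h : is_derive r 1 (fun r : R => r - u) 1.
  by apply: (is_derive_eq (is_deriveB (is_derive_id _ _) (is_derive_cst u _ _))); rewrite subr0.
have h3 := @is_derive1_comp R (fun y : R => `|y| `^ (2 * H)) (fun r : R => r - u) r _ _ h2 h.
have h4 : is_derive r 1 (fun r : R => `|r| `^ (2 * H) + u `^ (2 * H)) (2 * H * oddpow (2 * H - 1) r).
  by apply: (is_derive_eq (is_deriveD h1 (is_derive_cst (u `^ (2 * H)) _ _))); rewrite addr0.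
have h5 : is_derive r 1 (fun r : R => `|r - u| `^ (2 * H)) (2 * H * oddpow (2 * H - 1) (r - u) * 1) := h3.
apply: (is_derive_eq (is_deriveM (is_derive_cst (2^-1 : R) r 1) (is_deriveB h4 h5))).
by rewrite /covkernel /GRing.scale/=; field.
Qed.

Lemma Rintegral_covkernel u v w : 0 <= w -> w <= v ->
  \int[mu]_(r in `[w, v]) covkernel u r = covR H v u - covR H w u.
Proof.
move=> w0 wv; rewrite (FTC_Rintegral (is_derive_cov u) (@continuous_covkernel u) wv) /covR.
by rewrite !(@ger0_norm _ w)// (@ger0_norm _ v)// (le_trans w0).
Qed.

Lemma covkernel_bound u r : 0 <= u <= T -> 0 <= r <= T ->
  `|covkernel u r| <= H * (2 * T `^ (2 * H - 1)).
Proof.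
move=> /andP[u0 uT] /andP[r0 rT]; rewrite /covkernel normrM ger0_norm; last by move: H1; lra.
rewrite ler_pM2l; last by move: H1; lra.
rewrite (le_trans (ler_normB _ _))//.
have -> : 2 * T `^ (2 * H - 1) = T `^ (2 * H - 1) + T `^ (2 * H - 1) by ring.
have b x : - T <= x -> x <= T -> `|oddpow (2 * H - 1) x| <= T `^ (2 * H - 1).
  move=> x1 x2; apply: (le_trans (norm_oddpow _ _)).
  by apply: ge0_ler_powR; rewrite ?nnegrE ?(ltW p0) ?(ltW T0)// ler_norml x1.
by apply: lerD; apply: b; lra.
Qed.

Lemma step_fun_integrable (s : seq (R * (R * R))) (D : set R) : measurable D ->
  mu.-integrable D (EFin \o step_fun s).
Proof.
move=> mD; apply: integrableS (_ : mu.-integrable setT _) => //.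
rewrite (_ : EFin \o step_fun s = (fun r => \sum_(p <- s) (p.1 * \1_(`]p.2.1, p.2.2]) r)%:E)%E); last first.
  by apply/funext => r; rewrite /= /step_fun -sumEFin.
apply: integrable_sum => // p _; apply: RintegrableZ => //.
exact: integrable_indic_itv.
Qed.

Lemma integrableM_bounded (f k : R -> R) (a b M : R) : measurable_fun `[a, b] k ->
  (forall r, a <= r <= b -> `|k r| <= M) -> mu.-integrable `[a, b] (EFin \o f) ->
  mu.-integrable `[a, b] (EFin \o (fun r => f r * k r)).
Proof.
move=> mk kM fi.
have mf : measurable_fun (`[a, b] : set R) f by apply/measurable_EFinP; case/integrableP: fi.
apply: (@le_Rintegrable _ _ R mu `[a, b] _ _ (fun r => M * `|f r|)) => //.
- exact: measurable_funM.
- by move=> r; rewrite /= in_itv/= => rab; rewrite normrM mulrC ler_wpM2r// kM.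
- by apply: RintegrableZ => //; exact: integrable_norm.
Qed.

Lemma Rintegral_step_fun t u (s : seq (R * (R * R))) : t <= T -> 0 <= u <= T -> step_in t s ->
  \int[mu]_(r in `[0, t]) (step_fun s r * covkernel u r) =
  \sum_(p <- s) p.1 * (covR H p.2.2 u - covR H p.2.1 u).
Proof.
move=> tT uT; have mk (a b : R) : measurable_fun (`[a, b] : set R) (covkernel u).
  by apply: measurable_funTS; apply: continuous_measurable_fun; exact: continuous_covkernel.
have kb (r : R) : 0 <= r <= t -> `|covkernel u r| <= H * (2 * T `^ (2 * H - 1)).
  by move=> /andP[r0 rt]; apply: covkernel_bound => //; rewrite r0 (le_trans rt).
elim: s => [_|p s IH /andP[/and3P[p1 p2 p3] ss]].
  rewrite big_nil; under eq_Rintegral do rewrite /step_fun big_nil mul0r.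
  by rewrite Rintegral_cst// mul0r.
rewrite big_cons -IH//.
have i1 : mu.-integrable `[0, t] (EFin \o (fun r => \1_(`]p.2.1, p.2.2]) r)).
  by apply: integrableS (integrable_indic_itv _ _ _ _).
have i2 := integrableM_bounded (mk _ _) kb i1.
have i3 := integrableM_bounded (mk _ _) kb (step_fun_integrable s (measurable_itv `[0, t])).
transitivity (\int[mu]_(r in `[0, t]) (p.1 * (\1_(`]p.2.1, p.2.2]) r * covkernel u r) + step_fun s r * covkernel u r)).
  by apply: eq_Rintegral => r _; rewrite /step_fun big_cons; ring.
rewrite RintegralD//; last exact: RintegrableZ.
rewrite RintegralZl//; congr (_ * _ + _).
rewrite -Rintegral_covkernel//.
transitivity (\int[mu]_(r in `[0, t] `&` `]p.2.1, p.2.2]) covkernel u r).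
  rewrite Rintegral_mkcondr; apply: eq_Rintegral => r _.
  by rewrite patch_indic /= mulrC.
have -> : `[0, t] `&` `]p.2.1, p.2.2] = `]p.2.1, p.2.2]%classic.
  apply/seteqP; split => r /=; rewrite !in_itv/=; first by case.
  by move=> /andP[r1 r2]; rewrite r1 r2; split => //; rewrite (le_trans p1 (ltW r1)) (le_trans r2).
apply: Rintegral_itv_obnd_cbnd.
apply: (integrableS _ _ _ (continuous_integrable_seg p.2.1 p.2.2 (@continuous_covkernel u))) => //.
by apply: subset_itv; rewrite bnd_simp.
Qed.

End energy_norm.

Section wiener_chaos.
Context {dO} {Omega : measurableType dO} {R : realType} (P : probability Omega R).
Variables (d : nat) (H T : R) (B : R -> Omega -> 'rV[R]_d).
Hypotheses (H1 : 1 / 2 < H) (H2 : H < 1) (T0 : 0 < T) (fB : fBm P H T B).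
Local Notation mu := (@lebesgue_measure R).

Definition step_lincomb (j : 'I_d) (s : seq (R * (R * R))) : seq (R * (R * 'I_d)) :=
  flatten [seq [:: (p.1, (p.2.2, j)); (- p.1, (p.2.1, j))] | p <- s].

Lemma step_lincombE j s w :
  step_integral (fun r w => B r w ord0 j) s w = lincomb B (step_lincomb j s) w.
Proof.
rewrite /step_integral /lincomb /step_lincomb big_flatten big_map.
by apply: eq_bigr => p _; rewrite big_cons big_seq1/=; ring.
Qed.

Lemma step_lincomb_in j t s : t <= T -> step_in t s -> in_time T (step_lincomb j s).
Proof.
move=> tT; elim: s => //= p s IH /andP[/and3P[p1 p2 p3] ss].
by rewrite IH// andbT !(le_trans _ tT) ?p1 ?(le_trans p1 p2) ?(le_trans p2 p3).
Qed.

Lemma dot_step j t s u i : t <= T -> 0 <= u <= T -> step_in t s ->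
  dot P (lincomb B (step_lincomb j s)) (fun w => B u w ord0 i) =
  (\int[mu]_(r in `[0, t]) (step_fun s r * covkernel H u r)) * (j == i)%:R.
Proof.
move=> tT uT ss; rewrite (Rintegral_step_fun H1 H2 T0)//.
have /allP it := step_lincomb_in j tT ss.
rewrite /lincomb dot_suml; last exact: (B_L2 fB); last first.
  by move=> p ps; apply: L2Z; apply: (B_L2 fB); exact: it.
rewrite big_seq (eq_bigr (fun p => p.1 * (covR H p.2.1 u * (p.2.2 == i)%:R))); last first.
  move=> p ps; rewrite dotZl; [|by apply: (B_L2 fB); exact: it|exact: (B_L2 fB)].
  by rewrite (B_dot fB)//; exact: it.
rewrite -big_seq big_flatten big_map mulr_suml.
by apply: eq_bigr => p _; rewrite big_cons big_seq1/=; ring.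
Qed.

Lemma L2_of_sub (X Y : Omega -> R) : measurable_fun setT Y -> L2 P X ->
  ('E_P[fun w => ((Y w - X w) ^+ 2)%R] < +oo)%E -> L2 P Y.
Proof.
move=> mY X2 h; have -> : Y = (fun w => (Y w - X w) + X w).
  by apply/funext => w; rewrite subrK.
have [mX _] := X2.
apply: L2D => //; split; first exact: measurable_funB.
apply/integrableP; split.
  by apply/measurable_EFinP; apply: measurable_funX; exact: measurable_funB.
rewrite unlock in h; congr (_ < _)%E: h.
by apply: eq_integral => w _; rewrite /= ger0_norm ?sqr_ge0.
Qed.

(** Both claims hold for step functions and pass to the limit: the integrals converge
    in L^2 by definition, and the integrands in L^1 because the energy norm controls
    the L^1 norm ([energy_cvg_L1]) while the kernel is bounded. *)
Lemma wiener_chaos t j (phi : R -> R) (Y : Omega -> R) : t <= T ->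
  mu.-integrable `[0, t] (EFin \o phi) ->
  wiener_integral P H (fun r w => B r w ord0 j) t phi Y ->
  chaos P T B Y /\ forall u i, 0 <= u <= T ->
    dot P Y (fun w => B u w ord0 i) =
    (\int[mu]_(r in `[0, t]) (phi r * covkernel H u r)) * (j == i)%:R.
Proof.
move=> tT iphi [mY [s [sin sH sE]]].
have lt n : in_time T (step_lincomb j (s n)) := step_lincomb_in j tT (sin n).
have E n : ('E_P[fun w => ((Y w - step_integral (fun r w => B r w ord0 j) (s n) w) ^+ 2)%R] =
    'E_P[fun w => ((Y w - lincomb B (step_lincomb j (s n)) w) ^+ 2)%R])%E.
  by congr expectation; apply/funext => w; rewrite step_lincombE.
have {}sE : ('E_P[fun w => ((Y w - lincomb B (step_lincomb j (s n)) w) ^+ 2)%R])%E @[n --> \oo] --> 0%E.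
  by move: sE; rewrite (funext E).
have [N _ hN] : \forall n \near \oo,
    ('E_P[fun w => ((Y w - lincomb B (step_lincomb j (s n)) w) ^+ 2)%R] < +oo)%E.
  apply: (sE [set y | (y < +oo)%E]).
  by exists 1 => //= y _; rewrite ltry.
have l2 n := lincomb_L2 fB (lt n).
have Y2 : L2 P Y by apply: (L2_of_sub mY (l2 N)); apply: hN => /=.
have D0 : dot P (fun w => Y w - lincomb B (step_lincomb j (s n)) w)
    (fun w => Y w - lincomb B (step_lincomb j (s n)) w) @[n --> \oo] --> 0.
  have F n : dot P (fun w => Y w - lincomb B (step_lincomb j (s n)) w)
      (fun w => Y w - lincomb B (step_lincomb j (s n)) w) =
      fine ('E_P[fun w => ((Y w - lincomb B (step_lincomb j (s n)) w) ^+ 2)%R])%E.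
    by rewrite unlock.
  by apply: (cvg_ext F erefl); exact: fine_cvg sE.
have cY : chaos P T B Y by split => //; exists (fun n => step_lincomb j (s n)).
split => // u i uT.
have c1 := dot_cvg l2 Y2 (B_L2 fB i uT) D0.
apply/esym; apply: (cvg_unique _ _ c1) => //.
apply: (cvg_ext (fun n => dot_step j i tT uT (sin n)) erefl).
apply: cvgM; last exact: cvg_cst.
pose Ck := H * (2 * T `^ (2 * H - 1)).
have kb (r : R) : 0 <= r <= t -> `|covkernel H u r| <= Ck.
  by move=> /andP[r0 rt]; apply: covkernel_bound => //; rewrite r0 (le_trans rt).
have mk : measurable_fun (`[0, t] : set R) (covkernel H u).
  by apply: measurable_funTS; apply: continuous_measurable_fun; exact: continuous_covkernel.
have is_ n := step_fun_integrable (s n) (measurable_itv `[0, t]).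
have id_ n : mu.-integrable `[0, t] (EFin \o (phi \- step_fun (s n))) by exact: RintegrableB.
have L1 := energy_cvg_L1 H1 H2 T0 tT id_ sH.
have i1 := integrableM_bounded mk kb iphi.
have i2 n := integrableM_bounded mk kb (is_ n).
apply/subr_cvg0; apply: norm_cvg0.
apply: (@squeeze_cvgr _ _ _ _ (fun=> 0) (fun n => Ck * \int[mu]_(r in `[0, t]) `|(phi \- step_fun (s n)) r|)).
- apply: nearW => n; rewrite normr_ge0/= distrC -RintegralB//.
  have i3 : mu.-integrable `[0, t] (EFin \o (fun r => phi r * covkernel H u r - step_fun (s n) r * covkernel H u r)).
    exact: RintegrableB.
  rewrite (le_trans (le_normr_Rintegral _ i3))//.
  have i4 : mu.-integrable `[0, t] (EFin \o (fun r => `|phi r - step_fun (s n) r|)).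
    exact: (integrable_norm (id_ n)).
  rewrite -RintegralZl//.
  apply: le_Rintegral => //; first exact: (integrable_norm i3).
    by apply: RintegrableZ.
  move=> r; rewrite /= in_itv/= => rt.
  by rewrite -mulrBl normrM mulrC ler_wpM2r// kb.
- exact: cvg_cst.
- apply: (cvg_ext (fun=> erefl) (mulr0 Ck)); apply: cvgM; last exact: L1.
  exact: cvg_cst.
Qed.

End wiener_chaos.

(** * Concentration of the response at the final time *)

Section max_norm.
Context {R : realType}.

Lemma norm_coord_le {m n} (A : 'M[R]_(m, n)) i j : `|A i j| <= `|A|.
Proof. by rewrite [leRHS]/Num.norm/= mx_normrE; apply: (le_bigmax _ (fun ij => `|A ij.1 ij.2|) (i, j)). Qed.

Lemma norm_mx_le {m n} (A : 'M[R]_(m, n)) (c : R) : 0 <= c ->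
  (forall i j, `|A i j| <= c) -> `|A| <= c.
Proof. by move=> c0 h; rewrite [leLHS]/Num.norm/= mx_normrE; apply: bigmax_le => // -[i j] _. Qed.

Lemma norm_mulmx_le {m n} (v : 'rV[R]_m) (A : 'M[R]_(m, n)) (c : R) : 0 <= c ->
  (forall i j, `|A i j| <= c) -> `|v *m A| <= m%:R * c * `|v|.
Proof.
move=> c0 h; apply: norm_mx_le => [|i j]; first by rewrite !mulr_ge0.
rewrite mxE (le_trans (ler_norm_sum _ _ _))//.
have hk k : true -> `|v i k * A k j| <= c * `|v|.
  by move=> _; rewrite normrM mulrC ler_pM// norm_coord_le.
rewrite (le_trans (ler_sum _ hk))//.
by rewrite sumr_const card_ord -mulrA mulr_natl.
Qed.

End max_norm.

Section discrete_sums.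
Context {R : realType}.

Lemma sum_geq (n a : nat) : (\sum_(k < n) (a <= k) = n - a)%N.
Proof.
elim: n => [|n IH]; first by rewrite big_ord0 sub0n.
rewrite big_ord_recr /= IH; case: leqP => h; first by rewrite addn1 subSn.
by rewrite addn0 (eqP (ltnW h : n - a == 0)%N) (eqP (h : n.+1 - a == 0)%N).
Qed.

(** At most n eta / T of the points k T / n, k < n, lie beyond T - eta; the sum stops
    before T, so no point is counted in excess. *)
Lemma riemann_sum_concentrated (A : R -> R) (T eta a C : R) (n : nat) : 0 < T -> 0 < eta ->
  0 <= a -> 0 <= C -> (0 < n)%N ->
  (forall t, 0 <= t <= T - eta -> A t <= a) -> (forall t, 0 <= t <= T -> A t <= C) ->
  T / n%:R * \sum_(k < n) A (k%:R * T / n%:R) <= T * a + eta * C.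
Proof.
move=> T0 eta0 a0 C0 n0 Aa AC.
have nR : 0 < n%:R :> R by rewrite ltr0n.
pose m := Num.truncn (n%:R * eta / T).
have step (k : 'I_n) : A (k%:R * T / n%:R) <= a + C * (n - m <= k)%N%:R.
  have kn : k%:R < n%:R :> R by rewrite ltr_nat.
  have t0 : 0 <= k%:R * T / n%:R by rewrite !mulr_ge0// ltW.
  have tT : k%:R * T / n%:R <= T.
    by rewrite ler_pdivrMr// mulrC ler_wpM2l// ltW.
  have [h|h] := leqP (n - m) k.
    by rewrite mulr1 (le_trans (AC _ _)) ?t0// lerDr.
  rewrite mulr0 addr0; apply: Aa; rewrite t0/= leNgt; apply/negP => h2.
  have : (n - k <= m)%N.
    rewrite /m truncn_ge_nat ?divr_ge0 ?mulr_ge0// ?(ltW eta0) ?(ltW T0)//.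
    rewrite natrB ?(ltnW (ltn_ord k))// ler_pdivlMr//.
    move: h2; rewrite ltr_pdivlMr// => h2.
    by rewrite mulrBl lerBlDr -lerBlDl; nra.
  by rewrite leqNgt => /negP; apply; rewrite ltn_subRL addnC -ltn_subRL.
rewrite (le_trans (ler_wpM2l _ (ler_sum _ (fun k _ => step k))))// ?divr_ge0 ?(ltW T0)//.
rewrite big_split/= sumr_const card_ord -mulr_sumr -natr_sum sum_geq.
have mle : (n - (n - m))%N%:R <= n%:R * eta / T.
  rewrite (@le_trans _ _ m%:R)//.
    by rewrite ler_nat leq_subLR addnC -leq_subLR.
  by rewrite /m -truncn_ge_nat// divr_ge0 ?mulr_ge0// ltW.
rewrite mulrDr lerD//.
  by rewrite -[a *+ n]mulr_natl mulrA divfK ?gt_eqF.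
rewrite mulrCA [leRHS]mulrC ler_wpM2l//.
rewrite (le_trans (ler_wpM2l _ mle)) ?divr_ge0 ?(ltW T0)//.
have -> : T / n%:R * (n%:R * eta / T) = eta by field; rewrite !gt_eqF.
by [].
Qed.

End discrete_sums.

Section peak.
Context {R : realType} (d : nat) (q T : R) (sigma : R -> 'M[R]_d) (M : R).
Hypotheses (q1 : 1 < q) (q2 : q < 2) (T0 : 0 < T).
Local Notation mu := (@lebesgue_measure R).
Hypothesis sM : forall t i j, 0 <= t <= T -> `|sigma t i j| <= M.
Hypothesis sI : forall i j, mu.-integrable `[0, T] (EFin \o (fun r => sigma r i j)).
Hypothesis sC : forall w : R, 0 < w -> exists2 eta, 0 < eta &
  forall r i j, 0 <= r -> T - eta <= r -> r <= T -> `|sigma r i j - sigma T i j| <= w.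
Hypothesis sU : sigma T \in unitmx.

(** The entry (j, i) is the covariance of the j-th coordinate of the noise and the
    i-th coordinate of int_0^t sigma dB, so that row vectors of noise values act
    on the left. *)
Definition response (e t : R) : 'M[R]_d :=
  \matrix_(j, i) \int[mu]_(r in `[0, t]) (sigma r i j * seckernel q T e r).

Let M0 (i : 'I_d) : 0 <= M.
Proof. by apply: le_trans (@sM T i i _); rewrite ?normr_ge0 ?lexx ?ltW. Qed.

Let ck e : continuous (seckernel q T e). Proof. exact: continuous_seckernel. Qed.

Let mk e (a b : R) : measurable_fun (`[a, b] : set R) (seckernel q T e).
Proof. by apply: measurable_funTS; apply: continuous_measurable_fun; exact: ck. Qed.

Let ik e (a b : R) : mu.-integrable `[a, b] (EFin \o (seckernel q T e)).
Proof. exact: continuous_integrable_seg (@ck e). Qed.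

Let iak e (a b : R) : mu.-integrable `[a, b] (EFin \o (fun r => `|seckernel q T e r|)).
Proof. exact: integrable_norm (ik e a b). Qed.

Let weighted (f : R -> R) (c e a b : R) : 0 <= a -> b <= T ->
  measurable_fun `[a, b] f -> (forall r, a <= r <= b -> `|f r| <= c) ->
  mu.-integrable `[a, b] (EFin \o (fun r => f r * seckernel q T e r)) /\
  `|\int[mu]_(r in `[a, b]) (f r * seckernel q T e r)| <= c * \int[mu]_(r in `[a, b]) `|seckernel q T e r|.
Proof.
move=> a0 bT mf fc.
have i1 : mu.-integrable `[a, b] (EFin \o (fun r => f r * seckernel q T e r)).
  have := integrableM_bounded mf fc (ik e a b).
  by congr (_.-integrable _ _); apply/funext => r /=; rewrite mulrC.
split => //; rewrite (le_trans (le_normr_Rintegral _ i1))//.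
rewrite -RintegralZl//; apply: le_Rintegral => //.
- exact: (integrable_norm i1).
- exact: RintegrableZ.
- by move=> r; rewrite /= in_itv/= => /fc h; rewrite normrM ler_wpM2r.
Qed.

Let msig i j (a b : R) : 0 <= a -> b <= T -> measurable_fun (`[a, b] : set R) (fun r => sigma r i j).
Proof.
move=> a0 bT; apply/measurable_EFinP.
by case/integrableP: (integrable_subseg a0 bT (sI i j)).
Qed.

Lemma unitmx_lower (A : 'M[R]_d) : A \in unitmx -> exists2 m, 0 < m &
  forall v : 'rV[R]_d, `|v| <= m * `|v *m A^T|.
Proof.
move=> Au; exists (d%:R * `|invmx A^T| + 1); first by rewrite ltr_wpDl// mulr_ge0.
move=> v; rewrite -{1}(mulmxK (_ : A^T \in unitmx) v) ?unitmx_tr//.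
rewrite (le_trans (norm_mulmx_le _ (normr_ge0 _) (norm_coord_le _)))//.
by rewrite ler_wpM2r// lerDl.
Qed.

(** By [seckernel_peak], response e T is close to - a0 e^q sigma(T)^T, which is
    invertible, whereas response e t is small compared with e^q for t <= T - eta and
    of order e^q on the remaining set of times, whose length eta is small. *)
Lemma response_dominates (L : R) : 0 <= L -> exists e c : R, [/\ 0 < e, 2 * e <= T, 0 < c &
  forall (n : nat) (v : 'rV[R]_d), (0 < n)%N ->
  c * `|v| <= `|v *m response e T| -
    L * (T / n%:R * \sum_(k < n) `|v *m response e (k%:R * T / n%:R)|)].
Proof.
move=> L0.
have [C1 [a0 [C10 a00 hk]]] := @seckernel_peak R q T q1 q2.
have [m m0 hm] := unitmx_lower sU.
have [N N0 MN] : exists2 N : R, 0 <= N & M <= N by exists `|M|; rewrite ?ler_norm.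
have C10' := ltW C10; have T0' := ltW T0.
pose D : R := d%:R; have D0 : 0 <= D by rewrite ler0n.
have [s s0 sE] : exists2 s : R, 0 < s & s = a0 / (2 * m).
  by exists (a0 / (2 * m)) => //; rewrite divr_gt0// mulr_gt0.
(* The main term will be 2 s e^q |v|.  The oscillation w of sigma near T, the length
   eta and the mass rho before T - eta are chosen in turn so that each error costs
   at most (s / 4) e^q |v|. *)
pose w := s / (4 * (D * C1 + 1)).
have w0 : 0 < w by rewrite divr_gt0// mulr_gt0// ltr_wpDl// mulr_ge0// ltW.
have [eta1 eta10 heta1] := sC w0.
pose K2 := L * D * N * C1; have K20 : 0 <= K2 by rewrite !mulr_ge0.
pose eta := Num.min eta1 (Num.min T (s / (4 * (K2 + 1)))).
have eta0 : 0 < eta by rewrite !lt_min eta10 T0/= divr_gt0// mulr_gt0// ltr_wpDl.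
have etaT : eta <= T by rewrite !ge_min lexx orbT.
have etae : eta <= eta1 by rewrite !ge_min lexx.
have eta3 : eta <= s / (4 * (K2 + 1)) by rewrite !ge_min lexx !orbT.
pose K3 := 2 * D * N + L * D * N * T.
have K30 : 0 <= K3 by rewrite addr_ge0// !mulr_ge0.
pose rho := s / (4 * (K3 + 1)).
have rho0 : 0 < rho by rewrite divr_gt0// mulr_gt0// ltr_wpDl.
have small x K : 0 <= K -> x <= s / (4 * (K + 1)) -> K * x <= s / 4.
  move=> K0 hx; rewrite (le_trans (ler_wpM2l K0 hx))//.
  have K1 : 0 < K + 1 by rewrite ltr_wpDl.
  have -> : K * (s / (4 * (K + 1))) = s / 4 * (K / (K + 1)) by field; rewrite gt_eqF.
  rewrite ler_piMr//; first by lra.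
  by rewrite ler_pdivrMr// mul1r lerDl.
have b1 : D * C1 * w <= s / 4 by apply: small => //; rewrite mulr_ge0//.
have b2 : K2 * eta <= s / 4 by exact: small.
have b3 : K3 * rho <= s / 4 by exact: small.
clearbody w eta rho.
have [e [e0 eT A1 A2 A3]] := hk eta rho eta0 etaT rho0.
have E0 : 0 < e `^ q by rewrite powR_gt0.
move: A1 A2 A3 E0; move: (e `^ q) => E A1 A2 A3 E0.
exists e, (s / 4 * E); split => //; first by rewrite mulr_gt0// divr_gt0.
move=> n v n0.
pose A t := \int[mu]_(r in `[0, t]) `|seckernel q T e r|.
have A0 t : 0 <= A t by apply: Rintegral_ge0.
have respA t : 0 <= t <= T -> `|v *m response e t| <= D * (N * A t) * `|v|.
  move=> /andP[t0 tT]; apply: norm_mulmx_le => [|i j]; first by rewrite mulr_ge0.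
  rewrite mxE.
  have [_ h] := @weighted (fun r => sigma r j i) N e 0 t (lexx _) tT (msig _ _ (lexx _) tT)
    (fun r h => le_trans (@sM r j i ltac:(lra)) MN).
  exact: h.
have Rsum : T / n%:R * \sum_(k < n) `|v *m response e (k%:R * T / n%:R)| <=
    D * N * `|v| * (T * (rho * E) + eta * (C1 * E)).
  have nR : 0 < n%:R :> R by rewrite ltr0n.
  have : T / n%:R * \sum_(k < n) `|v *m response e (k%:R * T / n%:R)| <=
      T / n%:R * \sum_(k < n) (D * N * `|v| * A (k%:R * T / n%:R)).
    rewrite ler_wpM2l ?divr_ge0 ?(ltW T0)//; apply: ler_sum => k _.
    have kn : k%:R <= n%:R :> R by rewrite ler_nat ltnW.
    rewrite (le_trans (respA _ _)).
    - by [].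
    - by rewrite !mulr_ge0 ?invr_ge0 ?(ltW T0)//= ler_pdivrMr// mulrC ler_wpM2l// ltW.
    - by rewrite le_eqVlt; apply/orP; left; apply/eqP; ring.
  move=> /le_trans; apply; rewrite -mulr_sumr mulrCA ler_wpM2l ?mulr_ge0//.
  apply: riemann_sum_concentrated => //.
  - by rewrite mulr_ge0// ltW.
  - by rewrite mulr_ge0// ltW.
  - move=> t /andP[t0 tT]; apply: le_trans A2.
    by apply: Rintegral_seg_ge0_mono => //; exact: lexx.
  - move=> t /andP[t0 tT]; apply: le_trans A1.
    by apply: Rintegral_seg_ge0_mono => //; exact: lexx.
have peakT : `|v *m response e T + a0 * E *: (v *m (sigma T)^T)| <=
    D * ((2 * N * rho + w * C1) * E) * `|v|.
  rewrite scalemxAr -mulmxDr; apply: norm_mulmx_le => [|j i].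
    by rewrite mulr_ge0 ?(ltW E0)// addr_ge0// !mulr_ge0// ltW.
  rewrite !mxE.
  have TT : 0 <= T - eta by rewrite subr_ge0.
  have Te : T - eta <= T by rewrite gerBl ltW.
  have [i1 h1] := @weighted (fun r => sigma r i j) N e 0 T (lexx _) (lexx _) (msig _ _ (lexx _) (lexx _))
    (fun r h => le_trans (@sM r i j h) MN).
  rewrite (Rintegral_seg_split TT Te i1).
  have hs r : 0 <= r <= T - eta -> `|sigma r i j| <= N.
    by move=> /andP[r1 r2]; apply: le_trans MN; apply: sM; rewrite r1 (le_trans r2).
  have [_ h2] := @weighted (fun r => sigma r i j) N e 0 (T - eta) (lexx _) Te (msig _ _ (lexx _) Te)
    hs.
  have hw r : T - eta <= r <= T -> `|sigma r i j - sigma T i j| <= w.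
    move=> /andP[r1 r2]; apply: heta1 => //; first exact: le_trans r1.
    by apply: le_trans r1; rewrite lerD2l lerN2.
  have [i3 h3] := @weighted (fun r => sigma r i j - sigma T i j) w e (T - eta) T TT (lexx _)
    (measurable_funB (msig i j TT (lexx T)) (measurable_cst _)) hw.
  have -> : \int[mu]_(r in `[T - eta, T]) (sigma r i j * seckernel q T e r) =
     \int[mu]_(r in `[T - eta, T]) ((sigma r i j - sigma T i j) * seckernel q T e r) +
     sigma T i j * \int[mu]_(r in `[T - eta, T]) seckernel q T e r.
    rewrite -RintegralZl// -RintegralD//; last exact: RintegrableZ.
    by apply: eq_Rintegral => r _; ring.
  have hT : \int[mu]_(r in `[T - eta, T]) `|seckernel q T e r| <= C1 * E.
    by apply: le_trans A1; apply: Rintegral_seg_ge0_mono => //.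
  have h4 : `|sigma T i j * (\int[mu]_(r in `[T - eta, T]) seckernel q T e r + a0 * E)| <= N * (rho * E).
    by rewrite normrM ler_pM// (le_trans (@sM T i j _))// lexx ltW.
  set x1 := \int[mu]_(r in `[0, T - eta]) _ in h2 *.
  set x2 := \int[mu]_(r in `[T - eta, T]) ((_ - _) * _) in h3 *.
  set x3 := \int[mu]_(r in `[T - eta, T]) _ in h4 *.
  have -> : x1 + (x2 + sigma T i j * x3) + a0 * E * sigma T i j = x1 + x2 + sigma T i j * (x3 + a0 * E) by ring.
  rewrite (le_trans (ler_normD _ _))//.
  have h5 := ler_normD x1 x2.
  have h6 : `|x1| <= N * (rho * E) by apply: (le_trans h2); rewrite ler_wpM2l.
  have h7 : `|x2| <= w * (C1 * E) by apply: (le_trans h3); rewrite ler_wpM2l// ltW.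
  lra.
have lowT : a0 * E * `|v| / m <= `|a0 * E *: (v *m (sigma T)^T)|.
  rewrite normrZ gtr0_norm ?mulr_gt0// ler_pdivrMr//.
  rewrite -[leRHS]mulrA ler_wpM2l ?mulr_ge0 ?(ltW a00) ?(ltW E0)//.
  by rewrite mulrC; exact: hm.
have tri : `|a0 * E *: (v *m (sigma T)^T)| <= `|v *m response e T| + `|v *m response e T + a0 * E *: (v *m (sigma T)^T)|.
  rewrite -[X in `|X| <= _](addKr (v *m response e T)).
  by rewrite (le_trans (ler_normD _ _))// normrN.
have LR : L * (T / n%:R * \sum_(k < n) `|v *m response e (k%:R * T / n%:R)|) <=
   L * (D * N * `|v| * (T * (rho * E) + eta * (C1 * E))) by rewrite ler_wpM2l.
have eq1 : a0 * E * `|v| / m = 2 * s * (E * `|v|) by rewrite sE; field; rewrite gt_eqF.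
have EV : 0 <= E * `|v| by rewrite mulr_ge0// ltW.
have c1 : D * C1 * w * (E * `|v|) <= s / 4 * (E * `|v|) by rewrite ler_wpM2r.
have c2 : K2 * eta * (E * `|v|) <= s / 4 * (E * `|v|) by rewrite ler_wpM2r.
have c3 : K3 * rho * (E * `|v|) <= s / 4 * (E * `|v|) by rewrite ler_wpM2r.
have c4 : 0 <= s * (E * `|v|) by rewrite mulr_ge0// ltW.
rewrite /K2 /K3 in c2 c3.
lra.
Qed.

End peak.

(** * The Euler scheme driven by a path *)

Section euler.
Context {R : realType} {d : nat}.
Variables (b : 'rV[R]_d -> 'rV[R]_d) (K : R).
Hypotheses (K0 : 0 <= K) (bK : forall x y, `|b x - b y| <= K * `|x - y|).
Implicit Types (x y : 'rV[R]_d) (z u : nat -> 'rV[R]_d) (delta : R) (n : nat).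

(** The drift is accumulated apart from the starting point and the driving path z, so
    that a change of z enters the scheme additively. *)
Fixpoint euler_drift delta x z n : 'rV[R]_d :=
  if n is m.+1 then
    euler_drift delta x z m + delta *: b (x + euler_drift delta x z m + z m)
  else 0.

Definition euler delta x z n := x + euler_drift delta x z n + z n.

Lemma euler_drift_perturb delta x z u n : 0 <= delta ->
  `|euler_drift delta x (fun k => z k + u k) n - euler_drift delta x z n| <=
  (1 + K * delta) ^+ n * (K * delta * \sum_(k < n) `|u k|).
Proof.
move=> d0; have Kd : 0 <= K * delta by rewrite mulr_ge0.
elim: n => [|n IH]; first by rewrite /= subrr normr0 big_ord0 mulr0 mulr0.
rewrite /= opprD addrACA -scalerBr (le_trans (ler_normD _ _))//.
set S := euler_drift _ _ _ n in IH *; set S' := euler_drift _ _ _ n in IH *.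
have hb : `|delta *: (b (x + S + (z n + u n)) - b (x + S' + z n))| <= K * delta * (`|S - S'| + `|u n|).
  rewrite normrZ ger0_norm// (mulrC K) -mulrA ler_wpM2l//.
  apply: (le_trans (bK _ _)); rewrite ler_wpM2l//.
  have -> : x + S + (z n + u n) - (x + S' + z n) = (S - S') + u n.
    by rewrite !opprD !addrA; apply/rowP => i; rewrite !mxE; ring.
  exact: ler_normD.
rewrite (le_trans (lerD (lexx _) hb))// big_ord_recr/= exprS.
set E := (1 + _) ^+ n in IH *; set s := \sum_(k < n) _ in IH *.
have E1 : 1 <= E by apply: exprn_ege1; rewrite lerDl.
have u0 := normr_ge0 (u n).
have : K * delta * `|u n| <= (1 + K * delta) * E * (K * delta * `|u n|).
  rewrite -[leLHS]mul1r ler_wpM2r ?mulr_ge0//.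
  by rewrite mulr_ege1// lerDl.
have : (1 + K * delta) * `|S - S'| <= (1 + K * delta) * (E * (K * delta * s)).
  by rewrite ler_wpM2l// addr_ge0.
lra.
Qed.

Lemma exp_bound (a : R) n : 0 <= a -> (1 + a) ^+ n <= expR (n%:R * a).
Proof.
move=> a0; rewrite mulr_natl -[a *+ n]mulr_natl expRM_natl.
by apply: lerXn2r; rewrite ?nnegrE ?expR_ge0 ?addr_ge0// expR_ge1Dx.
Qed.

(** The endpoint perturbation is seen in full, up to the drift differences, which a
    discrete Gronwall inequality bounds by the time average of |u|. *)
Lemma euler_perturb (T : R) x z u n : 0 <= T -> (0 < n)%N ->
  `|u n| - K * expR (K * T) * (T / n%:R * \sum_(k < n) `|u k|) <=
  `|euler (T / n%:R) x (fun k => z k + u k) n - euler (T / n%:R) x z n|.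
Proof.
move=> T0 n0; have nR : 0 < n%:R :> R by rewrite ltr0n.
have d0 : 0 <= T / n%:R by rewrite divr_ge0.
have h := euler_drift_perturb x z u n d0.
rewrite /euler.
set S := euler_drift _ _ _ n in h *; set S' := euler_drift _ _ _ n in h *.
have -> : x + S + (z n + u n) - (x + S' + z n) = u n + (S - S').
  by apply/rowP => i; rewrite !mxE; ring.
have t : `|u n| <= `|u n + (S - S')| + `|S - S'|.
  by rewrite -[X in `|X| <= _](addrK (S - S')) (le_trans (ler_normB _ _)).
rewrite lerBlDr (le_trans t)// lerD2l (le_trans h)//.
have -> : K * expR (K * T) * (T / n%:R * \sum_(k < n) `|u k|) =
  expR (K * T) * (K * (T / n%:R) * \sum_(k < n) `|u k|) by ring.
rewrite ler_wpM2r ?mulr_ge0 ?sumr_ge0//.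
rewrite (le_trans (exp_bound _ _)) ?mulr_ge0//.
by rewrite (_ : n%:R * (K * (T / n%:R)) = K * T)//; field; rewrite gt_eqF.
Qed.

Lemma euler_start delta x y z n : 0 <= delta ->
  `|euler delta x z n - euler delta y z n| <= (1 + K * delta) ^+ n * `|x - y|.
Proof.
move=> d0; have Kd : 0 <= K * delta by rewrite mulr_ge0.
rewrite /euler opprD addrACA subrr addr0.
elim: n => [|n IH]; first by rewrite /= !addr0 expr0 mul1r.
rewrite /= !addrA opprD addrACA -scalerBr (le_trans (ler_normD _ _))//.
set S := euler_drift _ _ _ n in IH *; set S' := euler_drift _ _ _ n in IH *.
have hb : `|delta *: (b (x + S + z n) - b (y + S' + z n))| <= K * delta * `|x + S - (y + S')|.
  rewrite normrZ ger0_norm// (mulrC K) -mulrA ler_wpM2l//.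
  apply: (le_trans (bK _ _)); rewrite ler_wpM2l//.
  by rewrite (_ : x + S + z n - _ = x + S - (y + S'))//; apply/rowP => i; rewrite !mxE; ring.
rewrite (le_trans (lerD (lexx _) hb))// exprS -mulrA.
have : (1 + K * delta) * `|x + S - (y + S')| <= (1 + K * delta) * ((1 + K * delta) ^+ n * `|x - y|).
  by rewrite ler_wpM2l// addr_ge0.
lra.
Qed.

Lemma path_unif_continuous (T : R) (X : R -> 'rV[R]_d) :
  {within `[0, T], continuous X} -> forall e : R, 0 < e ->
  exists2 r : R, 0 < r & forall s t, 0 <= s <= T -> 0 <= t <= T -> `|s - t| < r -> `|X s - X t| < e.
Proof.
move=> cX e e0.
have /compact_near_coveringP nc := @segment_compact R 0 T.
have [] := nc R (nbhs (0 : R)^'+) (fun r s => 0 <= s <= T -> forall t, 0 <= t <= T -> `|s - t| < r -> `|X s - X t| < e) _.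
  move=> s; rewrite /= in_itv/= => sT.
  have /(_ s) := (subspace_continuousP _ _).1 cX.
  rewrite /= in_itv/= => /(_ sT) /cvgrPdist_lt /(_ (e / 2)).
  rewrite divr_gt0// => /(_ isT); rewrite /prop_near1/= nbhs_nearE near_withinE => -[/= r r0 hr].
  have hX t : 0 <= t <= T -> `|s - t| < r -> `|X s - X t| < e / 2.
    by move=> tT st; apply: hr => //=; rewrite in_itv.
  exists (ball s (r / 2), [set r' | r' < r / 2]); first split => /=.
  - by apply: nbhsx_ballx; rewrite divr_gt0.
  - by apply: nbhs_right_lt; rewrite divr_gt0.
  move=> [t r'] [/= st r'r] tT t' t'T tt'.
  rewrite (splitr e) -[X t - X t'](subrKA (X s)) (le_lt_trans (ler_normD _ _))// ltrD//.
    rewrite distrC; apply: hX => //; rewrite (lt_le_trans st)// ler_pdivrMr// ler_peMr ?(ltW r0)//.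
    by rewrite ler1n.
  apply: hX => //; rewrite -(subrKA t) (le_lt_trans (ler_normD _ _))//.
  rewrite (splitr r) ltrD//; first exact: (lt_trans tt' r'r).
move=> r /= r0 hr; exists (r / 2); first by rewrite divr_gt0.
move=> s t sT; apply: (hr (r / 2)) => //=; rewrite ?in_itv ?divr_gt0//.
by rewrite sub0r normrN gtr0_norm ?divr_gt0// ltr_pdivrMr// ltr_pMr// ltr1n.
Qed.

Lemma lipschitz_continuous : continuous b.
Proof.
move=> x A /nbhs_ballP[e /= e0 eA]; apply/nbhs_ballP.
have K1 : 0 < K + 1 by rewrite ltr_wpDl.
exists (e / (K + 1)) => /=; first by rewrite divr_gt0.
move=> y; rewrite mx_norm_ball /ball_/= => hy; apply: eA.
rewrite mx_norm_ball /ball_/= (le_lt_trans (bK _ _))//.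
rewrite (@le_lt_trans _ _ ((K + 1) * `|x - y|))//; first by rewrite ler_wpM2r// lerDl.
by rewrite mulrC -ltr_pdivlMr.
Qed.

(** Discrete Gronwall inequality for the difference of the two accumulated drifts; on
    each step b(X) varies little by uniform continuity of the path. *)
Lemma euler_cvg (T : R) x (X z : R -> 'rV[R]_d) : 0 < T ->
  {within `[0, T], continuous X} ->
  (forall t, 0 <= t <= T -> X t =
     x + \row_i (\int[lebesgue_measure]_(s in `[0, t]) b (X s) ord0 i) + z t) ->
  forall e : R, 0 < e -> exists n0, forall n, (n0 <= n)%N -> (0 < n)%N ->
    `|X T - euler (T / n%:R) x (fun k => z (k%:R * T / n%:R)) n| <= e.
Proof.
move=> T0 cX XE e e0.
have C0 : 0 < expR (K * T) * (K * T) + 1 by rewrite ltr_wpDl// mulr_ge0 ?expR_ge0// mulr_ge0// ltW.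
pose w := e / (expR (K * T) * (K * T) + 1).
have w0 : 0 < w by rewrite divr_gt0.
have Cw : expR (K * T) * (K * T) * w <= e.
  rewrite /w mulrCA ger_pMr// ler_pdivrMr// mul1r lerDl//.
clearbody w.
have [r r0 hr] := path_unif_continuous cX w0.
exists (Num.truncn (T / r)).+1 => n hn n0.
have nR : 0 < n%:R :> R by rewrite ltr0n.
have dr : T / n%:R < r.
  rewrite ltr_pdivrMr// mulrC -ltr_pdivrMr//.
  by apply: (lt_le_trans (truncnS_gt _)); rewrite ler_nat.
set delta := T / n%:R in dr *; have d0 : 0 < delta by rewrite divr_gt0.
pose t k : R := k%:R * T / n%:R.
have tS k : t k.+1 = t k + delta by rewrite /t /delta -natr1 mulrDl mul1r mulrDl.
have t0 k : 0 <= t k by rewrite /t !mulr_ge0// ?invr_ge0 ltW.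
have tT k : (k <= n)%N -> t k <= T.
  by move=> kn; rewrite /t ler_pdivrMr// mulrC ler_wpM2l ?ler_nat// ltW.
pose f i s := b (X s) ord0 i.
have fi i : (@lebesgue_measure R).-integrable `[0, T] (EFin \o f i).
  apply: continuous_compact_integrable; first exact: segment_compact.
  apply/subspace_continuousP => s sT.
  have := (subspace_continuousP _ _).1 cX s sT => h.
  apply: (cvg_comp X (fun y => b y ord0 i) h).
  apply: (@continuous_comp _ _ _ b (fun y : 'rV[R]_d => y ord0 i)); first exact: lipschitz_continuous.
  exact: continuous_coord.
pose I (u : R) : 'rV[R]_d := \row_i (\int[lebesgue_measure]_(s in `[0, u]) f i s).
pose S k := euler_drift delta x (fun k => z (t k)) k.
have XD k : (k <= n)%N -> X (t k) - (x + S k + z (t k)) = I (t k) - S k.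
  move=> kn; rewrite (XE (t k)) ?t0 ?tT//.
  by apply/rowP => i; rewrite !mxE; ring.
have main k : (k <= n)%N -> `|I (t k) - S k| <= (1 + K * delta) ^+ k * (k%:R * (K * delta * w)).
  elim: k => [_|k IH kn].
    rewrite mul0r mulr0 /S /= subr0; apply: norm_mx_le => // i j.
    by rewrite mxE /t mul0r mul0r set_itv1 Rintegral_set1 normr0.
  have {}IH := IH (ltnW kn).
  have kT : t k.+1 <= T by exact: tT.
  have tk : t k <= t k.+1 by rewrite tS lerDl ltW.
  set D := I (t k) - S k in IH *.
  have -> : I (t k.+1) - S k.+1 = D + \row_i (\int[lebesgue_measure]_(s in `[t k, t k.+1]) (f i s - b (x + S k + z (t k)) ord0 i)).
    have -> : S k.+1 = S k + delta *: b (x + S k + z (t k)) by [].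
    apply/rowP => i; rewrite /D !mxE.
    have j1 : (@lebesgue_measure R).-integrable `[0, t k.+1] (EFin \o f i).
      exact: integrable_subseg (fi i).
    have j2 : (@lebesgue_measure R).-integrable `[t k, t k.+1] (EFin \o f i).
      exact: integrable_subseg (fi i).
    rewrite (Rintegral_seg_split (t0 k) tk j1).
    rewrite RintegralB//; last by apply: continuous_integrable_seg => y; exact: cvg_cst.
    rewrite Rintegral_cst//= lebesgue_measure_itv/= lte_fin tS ltrDl d0/=.
    have -> : t k + delta - t k = delta by ring.
    by ring.
  rewrite (le_trans (ler_normD _ _))//.
  have hb : `|\row_i (\int[lebesgue_measure]_(s in `[t k, t k.+1]) (f i s - b (x + S k + z (t k)) ord0 i))| <=
      K * delta * (w + `|D|).
    apply: norm_mx_le => [|i0 i]; first by rewrite !mulr_ge0 ?addr_ge0// ltW.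
    rewrite mxE.
    have j2 : (@lebesgue_measure R).-integrable `[t k, t k.+1] (EFin \o (fun s => f i s - b (x + S k + z (t k)) ord0 i)).
      apply: RintegrableB => //; first exact: integrable_subseg (fi i).
      by apply: continuous_integrable_seg => y; exact: cvg_cst.
    rewrite (le_trans (le_normr_Rintegral _ j2))//.
    have hc := @Rintegral_seg_le_cst _ (fun s => `|f i s - b (x + S k + z (t k)) ord0 i|) (t k) (t k.+1) (K * (w + `|D|)) tk.
    rewrite (le_trans (hc _ _))//.
    - exact: (integrable_norm j2).
    - move=> s /andP[s1 s2]; have := norm_coord_le (b (X s) - b (x + S k + z (t k))) ord0 i.
      rewrite !mxE => /le_trans; apply; apply: (le_trans (bK _ _)); rewrite ler_wpM2l//.
      rewrite -(subrKA (X (t k))) (le_trans (ler_normD _ _))// lerD//; last by rewrite XD// ltnW.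
      apply: ltW; apply: hr.
      + by rewrite (le_trans (t0 k))// (le_trans s2).
      + by rewrite t0 (le_trans tk).
      + rewrite ger0_norm ?subr_ge0// (le_lt_trans _ dr)// lerBlDl -tS//.
    - by rewrite tS [t k + delta]addrC addrK mulrAC.
  rewrite (le_trans (lerD (lexx _) hb))// exprS -natr1.
  set E := (1 + _) ^+ k in IH *.
  have Kd : 0 <= K * delta by rewrite mulr_ge0// ltW.
  have E1 : 1 <= E by apply: exprn_ege1; rewrite lerDl.
  have Kw : K * delta * w <= (1 + K * delta) * E * (K * delta * w).
    rewrite -[leLHS]mul1r ler_wpM2r//; first exact: mulr_ge0 Kd (ltW w0).
    by rewrite mulr_ege1// lerDl.
  have : (1 + K * delta) * `|D| <= (1 + K * delta) * (E * (k%:R * (K * delta * w))).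
    by rewrite ler_wpM2l// addr_ge0.
  lra.
have tn : t n = T by rewrite /t mulrAC mulrV ?unitfE ?gt_eqF// mul1r.
have := main n (leqnn n); rewrite -XD// tn /euler -/(t n) => h.
rewrite tn; apply: (le_trans h).
rewrite (le_trans _ Cw)//.
have -> : n%:R * (K * delta * w) = K * T * w by rewrite /delta; field; rewrite gt_eqF.
rewrite mulrA ler_wpM2r ?(ltW w0)// ler_wpM2r ?mulr_ge0 ?(ltW T0)//.
have eb := exp_bound n (mulr_ge0 K0 (ltW d0)).
rewrite (le_trans eb)//.
by rewrite (_ : n%:R * (K * delta) = K * T)// /delta; field; rewrite gt_eqF.
Qed.

Lemma euler_measurable {dO} {Omega : measurableType dO} delta x (Z : nat -> Omega -> 'rV[R]_d) :
  (forall k i, measurable_fun setT (fun w => Z k w ord0 i)) ->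
  forall n i, measurable_fun setT (fun w => euler delta x (fun k => Z k w) n ord0 i).
Proof.
move=> mZ.
have mD n : forall i, measurable_fun setT (fun w => euler_drift delta x (fun k => Z k w) n ord0 i).
  elim: n => [|n IH] i; first by rewrite /=; under eq_fun do rewrite mxE; exact: measurable_cst.
  under eq_fun do rewrite !mxE; apply: measurable_funD; first exact: IH.
  apply: measurable_funM => //.
  pose g (y : 'rV[R]_d) := b y ord0 i.
  have mg : measurable_fun setT (g : borel_rV R d -> R).
    apply: continuous_borel_rV => y.
    apply: (@continuous_comp _ _ _ b (fun y : 'rV[R]_d => y ord0 i)); first exact: lipschitz_continuous.
    exact: continuous_coord.
  apply: (measurableT_comp mg); apply: measurable_rV => j.
  by under eq_fun do rewrite !mxE; apply: measurable_funD => //; exact: measurable_funD.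
move=> n i; under eq_fun do rewrite !mxE.
by apply: measurable_funD => //; exact: measurable_funD.
Qed.

End euler.

Lemma euler_ext {R : realType} {d : nat} (b : 'rV[R]_d -> 'rV[R]_d) delta x (z z' : nat -> 'rV[R]_d) n :
  (forall k, (k <= n)%N -> z k = z' k) -> euler b delta x z n = euler b delta x z' n.
Proof.
move=> h; rewrite /euler h//; congr (_ + _ + _).
elim: n h => //= n IH h; rewrite IH ?h// => k kn; apply: h; exact: leqW.
Qed.

(** * Consequences of the hypotheses on the coefficients *)

Section coefficients.
Context {R : realType} {d : nat}.

Lemma coord_le_enorm {m n} (A : 'M[R]_(m, n)) i j : `|A i j| <= enorm A.
Proof.
rewrite /enorm -sqrtr_sqr ler_sqrt; last first.
  by apply: sumr_ge0 => k _; apply: sumr_ge0 => l _; exact: sqr_ge0.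
rewrite (bigD1 i)//= (bigD1 j)//= -addrA lerDl addr_ge0//; apply: sumr_ge0 => k _.
  exact: sqr_ge0.
by apply: sumr_ge0 => l _; exact: sqr_ge0.
Qed.

(** Mean value theorem along the segment from y to x, coordinate by coordinate; the
    factor d comes from the max norm. *)
Lemma bounded_jacobian_lipschitz (b : 'rV[R]_d -> 'rV[R]_d) (K : R) : 0 <= K ->
  (forall x, differentiable b x) -> (forall x, enorm ('J b x) <= K) ->
  forall x y, `|b x - b y| <= d%:R * K * `|x - y|.
Proof.
move=> K0 db bK x y.
apply: norm_mx_le => [|i0 i]; first by rewrite !mulr_ge0.
rewrite (ord1 i0) {i0}.
pose l (t : R) : 'rV[R]_d := y + t *: (x - y).
pose g (t : R) := b (l t) ord0 i.
have dg (t : R) : is_derive t 1 g (((x - y) *m 'J b (l t)) ord0 i).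
  have E : (fun h : R => h^-1 *: ((g \o shift t) (h *: 1) - g t)) =
     (fun h : R => h^-1 *: (((fun z => b z ord0 i) \o shift (l t)) (h *: (x - y)) - b (l t) ord0 i)).
    apply/funext => h; rewrite /g /shift /l /=; congr (_ *: (b _ _ _ - _)).
    have -> : h *: (1 : R^o) = h by rewrite /GRing.scale/= mulr1.
    by rewrite scalerDl addrCA.
  have dv := diff_derivable (v := x - y) (db (l t)).
  have dvi := (derivable_mxP b (l t) (x - y)).1 dv ord0 i.
  split; first by rewrite /derivable E.
  by rewrite /derive E -deriveEjacobian// derive_mx// mxE.
have [c _] := MVT ltr01 (fun t _ => dg t) (continuous_subspaceT (is_derive_continuous dg)).
have -> : g 1 = b x ord0 i by rewrite /g /l scale1r addrC subrK.
have -> : g 0 = b y ord0 i by rewrite /g /l scale0r addr0.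
rewrite subr0 mulr1 => E; rewrite !mxE E.
apply: (le_trans (norm_coord_le _ _ _)).
apply: norm_mulmx_le => // k j; exact: (le_trans (coord_le_enorm _ _ _) (bK _)).
Qed.

(** sigma(r) - sigma(t) = sigma(r) (sigma(t)^-1 - sigma(r)^-1) sigma(t), where the
    outer factors are bounded. *)
Lemma holder_inverse_continuous (T M Kt alpha : R) (sigma : R -> 'M[R]_d) : 0 < alpha -> 0 <= Kt ->
  (forall t, 0 <= t <= T -> sigma t \in unitmx) ->
  (forall t, 0 <= t <= T -> enorm (sigma t) <= M) ->
  (forall s t, 0 <= s <= T -> 0 <= t <= T ->
     enorm (invmx (sigma t) - invmx (sigma s)) <= Kt * `|t - s| `^ alpha) ->
  forall t, 0 <= t <= T -> forall w : R, 0 < w -> exists2 eta, 0 < eta &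
    forall r i j, 0 <= r <= T -> `|r - t| < eta -> `|sigma r i j - sigma t i j| <= w.
Proof.
move=> a0 Kt0 sU sM sH t tT w w0.
have M0 : 0 <= M by apply: le_trans (sM t tT); exact: sqrtr_ge0.
pose C := d%:R * (d%:R * (M * Kt) * M) + 1.
have C0 : 0 < C by rewrite ltr_wpDl// !mulr_ge0.
exists ((w / C) `^ alpha^-1); first by rewrite powR_gt0// divr_gt0.
move=> r i j rT rt.
have ha : `|t - r| `^ alpha <= w / C.
  rewrite distrC (_ : w / C = ((w / C) `^ alpha^-1) `^ alpha); last first.
    by rewrite -powRrM mulVf ?gt_eqF// powRr1// divr_ge0// ltW.
  by apply: ge0_ler_powR; rewrite ?nnegrE ?powR_ge0// ltW.
have E : sigma r - sigma t = sigma r *m (invmx (sigma t) - invmx (sigma r)) *m sigma t.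
  by rewrite mulmxBr mulmxBl mulmxV ?sU// mul1mx -mulmxA mulVmx ?sU// mulmx1.
have -> : sigma r i j - sigma t i j = (sigma r - sigma t) i j by rewrite !mxE.
rewrite E mxE (le_trans (ler_norm_sum _ _ _))//.
have hc k : true -> `|(sigma r *m (invmx (sigma t) - invmx (sigma r))) i k * sigma t k j| <=
    d%:R * (M * (Kt * (w / C))) * M.
  move=> _; rewrite normrM ler_pM//; last by rewrite (le_trans (coord_le_enorm _ _ _))// sM.
  rewrite mxE (le_trans (ler_norm_sum _ _ _))//.
  have hd l : true -> `|sigma r i l * (invmx (sigma t) - invmx (sigma r)) l k| <= M * (Kt * (w / C)).
    move=> _; rewrite normrM ler_pM//; first by rewrite (le_trans (coord_le_enorm _ _ _))// sM.
    rewrite (le_trans (coord_le_enorm _ _ _))// (le_trans (sH _ _ rT tT))//.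
    by rewrite ler_wpM2l.
  by rewrite (le_trans (ler_sum _ hd))// sumr_const card_ord mulr_natl.
rewrite (le_trans (ler_sum _ hc))// sumr_const card_ord -[X in X <= _]mulr_natl.
have -> : d%:R * (d%:R * (M * (Kt * (w / C))) * M) = w * ((C - 1) / C) by rewrite /C; field; rewrite gt_eqF.
by rewrite ger_pMr// ler_pdivrMr// mul1r gerBl.
Qed.

End coefficients.

(** * Gaussian laws and independence in the first chaos *)

Section gaussian_intervals.
Context {dO} {Omega : measurableType dO} {R : realType} (P : probability Omega R).
Local Notation mu := (@lebesgue_measure R).

Lemma gaussian_density (Y : Omega -> R) : gaussian_rv P Y -> \int[P]_w Y w = 0 -> 0 < dot P Y Y ->
  exists m s : R, s != 0 /\ forall A : set R, measurable A -> P (Y @^-1` A) = normal_prob m s A.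
Proof.
move=> [mY [m [s h]]] Y0 Yv; exists m, s; move: h; case: eqVneq => // _ Ym.
have E (f : R -> R) : measurable_fun setT f -> \int[P]_w f (Y w) = f m.
  move=> mf; rewrite -[RHS](Rintegral_prob_cst P) /Rintegral; congr fine.
  apply: ae_eq_integral => //; first by apply/measurable_EFinP; exact: measurableT_comp.
  by apply: filterS Ym => w /= -> _.
have m0 : m = 0 by rewrite -Y0 (E id).
have : dot P Y Y = m * m by rewrite /dot (E (fun y => y * y))//; exact: measurable_funM.
by move: Yv => /[swap] ->; rewrite m0 mulr0 ltxx.
Qed.

Lemma gaussian_interval_le (Y : Omega -> R) : gaussian_rv P Y -> \int[P]_w Y w = 0 -> 0 < dot P Y Y ->
  exists2 p : R, 0 < p & forall a b : R, a <= b -> (P (Y @^-1` `[a, b]) <= (p * (b - a))%:E)%E.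
Proof.
move=> gY Y0 Yv; have [m [s [s0 E]]] := gaussian_density gY Y0 Yv.
exists (normal_peak s) => [|a b ab]; first exact: normal_peak_gt0.
rewrite E// /normal_prob.
have <- : (\int[mu]_(x in `[a, b]) (normal_peak s)%:E = (normal_peak s * (b - a))%:E)%E.
  rewrite integral_cst//= lebesgue_measure_itv/= lte_fin; case: ifPn => [_|]; first by rewrite -EFinB -EFinM.
  rewrite -leNgt => ba; have -> : a = b by apply/eqP; rewrite eq_le ab ba.
  by rewrite subrr mule0 mulr0.
apply: ge0_le_integral_nomeas => x _; first by rewrite lee_fin normal_pdf_ge0.
by rewrite lee_fin normal_pdf_ub.
Qed.

(** On a bounded box the density is bounded below by its value at the distance
    |M| + |m| from the mean. *)
Lemma gaussian_interval_ge (Y : Omega -> R) (M : R) : gaussian_rv P Y -> \int[P]_w Y w = 0 -> 0 < dot P Y Y ->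
  exists2 c : R, 0 < c & forall a b : R, - M <= a -> a <= b -> b <= M ->
    ((c * (b - a))%:E <= P (Y @^-1` `[a, b[))%E.
Proof.
move=> gY Y0 Yv; have [m [s [s0 E]]] := gaussian_density gY Y0 Yv.
have ss : 0 < s ^+ 2 *+ 2 by rewrite pmulrn_lgt0// exprn_even_gt0.
exists (normal_peak s * expR (- (`|M| + `|m|) ^+ 2 / (s ^+ 2 *+ 2))) => [|a b Ma ab bM].
  by rewrite mulr_gt0 ?normal_peak_gt0// expR_gt0.
rewrite E// /normal_prob; set c := normal_peak s * expR _.
have <- : (\int[mu]_(x in `[a, b[) c%:E = (c * (b - a))%:E)%E.
  rewrite integral_cst//= lebesgue_measure_itv/= lte_fin; case: ifPn => [_|]; first by rewrite -EFinB -EFinM.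
  rewrite -leNgt => ba; have -> : a = b by apply/eqP; rewrite eq_le ab ba.
  by rewrite subrr mule0 mulr0.
apply: ge0_le_integral_nomeas => x.
  by rewrite lee_fin mulr_ge0 ?normal_peak_ge0// expR_ge0.
rewrite /= in_itv/= => /andP[ax xb]; rewrite lee_fin normal_pdfE// /normal_fun.
rewrite ler_wpM2l ?normal_peak_ge0// ler_expR ler_pM2r ?invr_gt0// lerN2.
rewrite -[leLHS]real_normK ?num_real// lerXn2r ?nnegrE ?addr_ge0//.
rewrite (le_trans (ler_normB _ _))// lerD2r.
have := ler_norm M; rewrite ler_norml => hM; apply/andP; split; lra.
Qed.

End gaussian_intervals.

Section chaos_independence.
Context {dO} {Omega : measurableType dO} {R : realType} (P : probability Omega R).
Variables (d : nat) (H T : R) (B : R -> Omega -> 'rV[R]_d).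
Hypotheses (T0 : 0 < T) (fB : fBm P H T B).

Let prod_indic (K : finType) (X : K -> Omega -> R) (A : K -> set R) w :
  \prod_(i <- enum K) \1_(A i) (X i w) = \1_[set w | forall i, A i (X i w)] w :> R.
Proof.
rewrite [RHS]indicE; case: (pselect (forall i, A i (X i w))) => h.
  by rewrite mem_set// big1// => i _; rewrite indicE mem_set.
rewrite memNset//; have [i hi] : exists i, ~ A i (X i w) by apply/existsNP.
rewrite (perm_big _ (perm_to_rem (_ : i \in enum K))) ?mem_enum//= big_cons.
by rewrite indicE memNset// mul0r.
Qed.

Let Pindic (A : set Omega) : measurable A -> (\int[P]_w \1_A w)%R = fine (P A).
Proof. by move=> mA; rewrite /Rintegral integral_indic// setIT. Qed.

Let cos_indep (I J : eqType) (l1 : seq I) (l2 : seq J) (U : I -> Omega -> R) (V : J -> Omega -> R)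
  (a : I -> R) (c : J -> R) (th th' : R) :
  (forall i, chaos P T B (U i)) -> (forall j, chaos P T B (V j)) ->
  (forall i j, i \in l1 -> j \in l2 -> dot P (U i) (V j) = 0) ->
  \int[P]_w (cos (\sum_(i <- l1) a i * U i w + th) * cos (\sum_(j <- l2) c j * V j w + th')) =
  \int[P]_w cos (\sum_(i <- l1) a i * U i w + th) *
  \int[P]_w cos (\sum_(j <- l2) c j * V j w + th').
Proof.
move=> cU cV UV.
have c1 : chaos P T B (fun w => \sum_(i <- l1) a i * U i w).
  by apply: (chaos_sum fB) => i; exact: (chaosZ fB).
have c2 : chaos P T B (fun w => \sum_(j <- l2) c j * V j w).
  by apply: (chaos_sum fB) => i; exact: (chaosZ fB).
apply: (chaos_cos_indep fB) => //.
rewrite dot_suml; last exact: chaos_L2 c2; last first.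
  by move=> i _; apply: L2Z; exact: chaos_L2 (cU i).
rewrite big1_seq// => i /andP[_ il].
rewrite dotZl; [|exact: chaos_L2 (cU i)|exact: chaos_L2 c2].
rewrite dotC dot_suml; last exact: chaos_L2 (cU i); last first.
  by move=> j _; apply: L2Z; exact: chaos_L2 (cV j).
rewrite big1_seq ?mulr0// => j /andP[_ jl].
rewrite dotZl; [|exact: chaos_L2 (cV j)|exact: chaos_L2 (cU i)].
by rewrite dotC UV// mulr0.
Qed.

(** Linear combinations of U and V are orthogonal elements of the chaos, so the
    characteristic function factors ([chaos_cos_indep]) and [fourier_independence]
    applies. *)
Lemma chaos_independence (I J : finType) (U : I -> Omega -> R) (V : J -> Omega -> R)
  (A : I -> set R) (C : J -> set R) :
  (forall i, chaos P T B (U i)) -> (forall j, chaos P T B (V j)) ->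
  (forall i j, dot P (U i) (V j) = 0) ->
  (forall i, measurable (A i)) -> (forall j, measurable (C j)) ->
  P ([set w | forall i, A i (U i w)] `&` [set w | forall j, C j (V j w)]) =
  (P [set w | forall i, A i (U i w)] * P [set w | forall j, C j (V j w)])%E.
Proof.
move=> cU cV UV mA mC.
have mU i : measurable_fun setT (U i) by case: (chaos_L2 (cU i)).
have mV i : measurable_fun setT (V i) by case: (chaos_L2 (cV i)).
have := @fourier_independence _ _ _ P I J (enum I) (enum J) U V A C mU mA (enum_uniq _) mV mC (enum_uniq _)
  (fun a c th th' => cos_indep a c th th' cU cV (fun i j _ _ => UV i j)).
under eq_Rintegral do rewrite !prod_indic.
under [X in _ = X * _]eq_Rintegral do rewrite prod_indic.
under [X in _ = _ * X]eq_Rintegral do rewrite prod_indic.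
have m1 := measurable_coordwise mU mA; have m2 := measurable_coordwise mV mC.
rewrite !Pindic// => E.
have -> : P ([set w | forall i, A i (U i w)] `&` [set w | forall j, C j (V j w)]) =
   (fine (P ([set w | forall i, A i (U i w)] `&` [set w | forall j, C j (V j w)])))%:E.
  by rewrite fineK// fin_num_measure//; exact: measurableI.
rewrite -Pindic; last exact: measurableI.
transitivity ((fine (P [set w | forall i, A i (U i w)]) * fine (P [set w | forall j, C j (V j w)]))%:E).
  congr EFin; rewrite -E; apply: eq_Rintegral => w _.
  by rewrite indicI.
by rewrite EFinM !fineK// fin_num_measure.
Qed.

(** Peel off one variable at a time, the others forming the second family. *)
Lemma chaos_independence_prod (J : finType) (V : J -> Omega -> R) (C : J -> set R) :
  (forall j, chaos P T B (V j)) -> (forall i j, i != j -> dot P (V i) (V j) = 0) ->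
  (forall j, measurable (C j)) ->
  P [set w | forall j, C j (V j w)] = (\prod_(j : J) fine (P (V j @^-1` C j)))%:E.
Proof.
move=> cV VV mC.
have mV i : measurable_fun setT (V i) by case: (chaos_L2 (cV i)).
have mVC j : measurable (V j @^-1` C j).
  by rewrite -[X in measurable X]setTI; exact: mV.
have main (l : seq J) : uniq l -> \int[P]_w (\prod_(j <- l) \1_(C j) (V j w)) =
    \prod_(j <- l) fine (P (V j @^-1` C j)).
  elim: l => [_|i l IH /andP[il ul]].
    by under eq_Rintegral do rewrite big_nil; rewrite big_nil Rintegral_prob_cst.
  rewrite big_cons -IH//.
  have VVl i' j : i' \in [:: i] -> j \in l -> dot P (V i') (V j) = 0.
    by rewrite inE => /eqP -> jl; apply: VV; apply: contraNneq il => ->.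
  have := @fourier_independence _ _ _ P J J [:: i] l V V C C mV mC erefl mV mC ul
    (fun a c th th' => cos_indep a c th th' cV cV VVl).
  under eq_Rintegral do rewrite big_seq1.
  under [X in _ = X * _]eq_Rintegral do rewrite big_seq1.
  move=> E; rewrite -Pindic// -[RHS]E.
  by apply: eq_Rintegral => w _; rewrite big_cons.
have m2 := measurable_coordwise mV mC.
have h := main (enum J) (enum_uniq _).
have -> : P [set w | forall j, C j (V j w)] = (fine (P [set w | forall j, C j (V j w)]))%:E.
  by rewrite fineK// fin_num_measure.
rewrite -Pindic//; transitivity ((\prod_(j <- enum J) fine (P (V j @^-1` C j)))%:E).
  by rewrite -h; congr EFin; apply: eq_Rintegral => w _; rewrite prod_indic.
by rewrite big_enum.
Qed.

End chaos_independence.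

(** * Regularity of laws on R^d *)

Section real_probability.
Context {dO} {Omega : measurableType dO} {R : realType} (P : probability Omega R).
Implicit Types A C : set Omega.

(** Real values let bounds be combined by ordered field arithmetic. *)
Definition pr A : R := fine (P A).

Lemma prE A : measurable A -> P A = (pr A)%:E.
Proof. by move=> mA; rewrite /pr fineK// fin_num_measure. Qed.

Lemma pr_ge0 A : 0 <= pr A. Proof. by rewrite /pr fine_ge0. Qed.

Lemma pr_mono A C : measurable A -> measurable C -> A `<=` C -> pr A <= pr C.
Proof. by move=> mA mC AC; rewrite -lee_fin -!prE// le_measure// inE. Qed.

Lemma pr_setU A C : measurable A -> measurable C -> pr (A `|` C) <= pr A + pr C.
Proof.
by move=> mA mC; rewrite -lee_fin EFinD -!prE//; [exact: measureU2|exact: measurableU].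
Qed.

Lemma pr_cover A C1 C2 : measurable A -> measurable C1 -> measurable C2 ->
  A `<=` C1 `|` C2 -> pr A <= pr C1 + pr C2.
Proof.
move=> mA m1 m2 h; rewrite (le_trans _ (pr_setU m1 m2))// pr_mono//.
exact: measurableU.
Qed.

Lemma pr_bigsetU (I : Type) (s : seq I) (A : I -> set Omega) : (forall i, measurable (A i)) ->
  measurable (\big[setU/set0]_(i <- s) A i) /\
  pr (\big[setU/set0]_(i <- s) A i) <= \sum_(i <- s) pr (A i).
Proof.
move=> mA; elim: s => [|i s [IH1 IH2]]; first by rewrite !big_nil /pr measure0.
rewrite !big_cons; split; first exact: measurableU.
by rewrite (le_trans (pr_setU (mA i) IH1))// lerD2l.
Qed.

Lemma pr_sum_disjoint (I : eqType) (s : seq I) (A : I -> set Omega) C : uniq s ->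
  (forall i, measurable (A i)) -> (forall i j w, A i w -> A j w -> i = j) -> measurable C ->
  (forall i, i \in s -> A i `<=` C) -> \sum_(i <- s) pr (A i) <= pr C.
Proof.
move=> + mA dA; elim: s C => [C _ _ _|i s IH C /andP[il us] mC AC].
  by rewrite big_nil pr_ge0.
rewrite big_cons.
have AiC : A i `<=` C by apply: AC; rewrite mem_head.
have -> : pr C = pr (A i) + pr (C `\` A i).
  apply: EFin_inj; rewrite EFinD -!prE//; last exact: measurableD.
  by rewrite (measureDI P mC (mA i)) (setIidr AiC) addeC.
rewrite lerD2l; apply: IH => //; first exact: measurableD.
move=> j js w Ajw; split; first by apply: (AC j) => //; rewrite inE js orbT.
by move=> Aiw; move: il; rewrite (dA _ _ _ Aiw Ajw) js.
Qed.

(** Fatou lemma for sets: C lies in the increasing union of the sets where all A j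
    with j >= k hold. *)
Lemma pr_eventually (A : nat -> set Omega) C (c : R) : measurable C -> (forall k, measurable (A k)) ->
  (forall w, C w -> exists k0, forall k, (k0 <= k)%N -> A k w) ->
  (forall k, pr (A k) <= c) -> pr C <= c.
Proof.
move=> mC mA CA Ac.
pose D k := \bigcap_(j in [set j | (k <= j)%N]) A j.
have mD k : measurable (D k) by apply: bigcap_measurable => [|j _ //]; exists k => /=.
have mDU : measurable (\bigcup_k D k) by exact: bigcupT_measurable.
have ndD : nondecreasing_seq D.
  move=> m n mn; apply/subsetPset => w Dw j /= nj; apply: Dw => /=; exact: leq_trans nj.
have cD := @nondecreasing_cvg_mu _ _ _ P D mD mDU ndD.
rewrite (le_trans (pr_mono mC mDU _))//.
  by move=> w /CA[k0 h]; exists k0 => // j /= jk; exact: h.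
rewrite -lee_fin -prE//.
rewrite -(cvg_lim _ cD)//; apply: lime_le; first exact: cvgP cD.
apply: nearW => k /=; rewrite prE// lee_fin (le_trans _ (Ac k))// pr_mono//.
by move=> w; apply => /=.
Qed.

Lemma pr_vanish (A : nat -> set Omega) : (forall k, measurable (A k)) ->
  (forall k l w, (k <= l)%N -> A l w -> A k w) ->
  (forall w, exists k, ~ A k w) -> forall e : R, 0 < e -> exists k, pr (A k) < e.
Proof.
move=> mA ndA A0 e e0.
have E0 : \bigcap_k A k = set0.
  by rewrite -subset0 => w h; have [k] := A0 w; apply; exact: h.
have mI : measurable (\bigcap_k A k) by rewrite E0.
have niA : nonincreasing_seq A.
  by move=> m n mn; apply/subsetPset => w; exact: ndA.
have f0 : (P (A 0%N) < +oo)%E by rewrite prE// ltry.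
have := @nonincreasing_cvg_mu _ _ _ P A f0 mA mI niA; rewrite E0 measure0 => cA.
have [N _ hN] : \forall n \near \oo, (P (A n) < e%:E)%E.
  apply: (cA [set y | (y < e%:E)%E]).
  have := lt_nbhsl e0; apply: filterS => y; by rewrite /= lte_fin.
by exists N; have := hN N (leqnn N); rewrite /= prE// lte_fin.
Qed.

Lemma pr_ae A C : measurable A -> measurable C -> {ae P, forall w, A w -> C w} -> pr A <= pr C.
Proof.
move=> mA mC [N [mN N0 hN]].
rewrite (le_trans (pr_cover mA mC mN _))//.
  move=> w Aw; case: (pselect (C w)) => Cw; [by left|right].
  by apply: hN => /= h; exact/Cw/h.
by rewrite /pr N0 /= addr0.
Qed.

End real_probability.

Section law_regularity.
Context {dO} {Omega : measurableType dO} {R : realType} (P : probability Omega R) {d : nat}.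
Variable G : Omega -> 'rV[R]_d.
Hypothesis mG : measurable_fun setT (G : Omega -> borel_rV R d).
Implicit Types A O C : set 'rV[R]_d.

Lemma measurable_event A : measurable (A : set (borel_rV R d)) -> measurable (G @^-1` A).
Proof. by move=> mA; rewrite -[X in measurable X]setTI; exact: mG. Qed.

Lemma closed_measurable_rV C : closed C -> measurable (C : set (borel_rV R d)).
Proof.
move=> cC; rewrite -(setCK C); apply: measurableC; apply: open_measurable_rV.
exact: closed_openC.
Qed.

(** The points at distance at least 1/(k+1) from the complement of O. *)
Definition shrink O (k : nat) : set 'rV[R]_d :=
  [set y | forall z, ~ O z -> ~ ball z k.+1%:R^-1 y].

Lemma closed_shrink O k : closed (shrink O k).
Proof.
have -> : shrink O k = ~` (\bigcup_(z in ~` O) ball z k.+1%:R^-1).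
  apply/seteqP; split => y /= h; first by move=> [z Oz zy]; exact: (h z).
  by move=> z Oz zy; apply: h; exists z.
apply: open_closedC; apply: bigcup_open => z _.
by apply: ball_open; rewrite invr_gt0.
Qed.

Lemma shrink_mono O k l : (k <= l)%N -> shrink O k `<=` shrink O l.
Proof.
move=> kl y h z Oz zy; apply: (h z Oz); apply: le_ball zy.
by rewrite lef_pV2 ?posrE// ler_nat.
Qed.

Lemma shrink_sub O k : shrink O k `<=` O.
Proof.
move=> y h; apply: contrapT => Oy; apply: (h y Oy); apply: ballxx.
by rewrite invr_gt0.
Qed.

Lemma shrink_exhaust O y : open O -> O y -> exists k, shrink O k y.
Proof.
move=> oO Oy; have /nbhs_ballP[e /= e0 eO] : nbhs y O by exact: open_nbhs_nbhs.
have [k _ /(_ k (leqnn k)) ke] := near_infty_natSinv_lt (PosNum e0).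
exists k => z Oz zy; apply/Oz/eO; apply: ball_sym; apply: le_ball zy; exact: ltW.
Qed.

Lemma shrink_prob O (e : R) : open O -> 0 < e -> exists k, pr P (G @^-1` (O `\` shrink O k)) < e.
Proof.
move=> oO e0; apply: pr_vanish => // [k|k l w kl [Ow nw]|w].
- apply: measurable_event; apply: measurableD; first exact: open_measurable_rV.
  by apply: closed_measurable_rV; exact: closed_shrink.
- by split => // h; apply: nw; exact: (shrink_mono kl).
- case: (pselect (O (G w))) => Ow; last by exists 0%N => -[].
  by have [k hk] := shrink_exhaust oO Ow; exists k => -[].
Qed.

Definition regular_set A := forall e : R, 0 < e -> exists C O,
  [/\ closed C, open O, C `<=` A, A `<=` O & pr P (G @^-1` (O `\` C)) < e].

Lemma measurable_gap C O : closed C -> open O -> measurable (G @^-1` (O `\` C)).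
Proof.
move=> cC oO; apply: measurable_event; apply: measurableD; first exact: open_measurable_rV.
exact: closed_measurable_rV.
Qed.

Lemma regular_open O : open O -> regular_set O.
Proof.
move=> oO e e0; have [k hk] := shrink_prob oO e0.
by exists (shrink O k), O; split => //; [exact: closed_shrink|exact: shrink_sub].
Qed.

Lemma regular_setC A : regular_set A -> regular_set (~` A).
Proof.
move=> rA e e0; have [C [V [cC oV CA AV h]]] := rA e e0.
exists (~` V), (~` C); split.
- exact: open_closedC.
- exact: closed_openC.
- by apply: subsetC.
- by apply: subsetC.
- by rewrite setDE setCK setIC -setDE.
Qed.

(** The open sets may all be kept, with geometrically small errors; only finitely many
    closed sets are kept, by continuity of the measure. *)
Lemma regular_bigcup (A : nat -> set 'rV[R]_d) :
  (forall n, regular_set (A n)) -> regular_set (\bigcup_n A n).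
Proof.
move=> rA e e0.
have [C /choice [V hCO]] := choice (fun n => rA n (e / 4 / 2 ^+ n) (divr_gt0 (divr_gt0 e0 (ltr0n R 4)) (exprn_gt0 n (ltr0n R 2)))).
have cC n : closed (C n) by case: (hCO n).
have oV n : open (V n) by case: (hCO n).
pose Cn N := \big[setU/set0]_(k < N) C k.
have cCn N : closed (Cn N).
  rewrite /Cn; elim: N => [|N IH]; first by rewrite big_ord0; exact: closed0.
  by rewrite big_ord_recr; apply: closedU.
have CnP N y : Cn N y <-> exists2 k, (k < N)%N & C k y.
  rewrite /Cn; elim: N => [|N IH]; first by rewrite big_ord0; split => // -[].
  rewrite big_ord_recr/=; split => [[/IH[k kN h]|h]|[k]].
  - by exists k => //; exact: ltnW.
  - by exists N.
  - by rewrite ltnS leq_eqVlt => /predU1P[->|kN] h; [right|left; apply/IH; exists k].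
pose D k := G @^-1` (V k `\` C k).
have mD k : measurable (D k) by exact: measurable_gap.
have mDU : measurable (\bigcup_k D k) by exact: bigcupT_measurable.
have b1 : pr P (\bigcup_k D k) <= e / 2.
  pose E N := \big[setU/set0]_(k <- iota 0 N) D k.
  have EP N w : E N w <-> exists2 k, (k < N)%N & D k w.
    rewrite /E; elim: N => [|N IH]; first by rewrite big_nil; split => // -[].
    rewrite -addn1 iotaD big_cat big_seq1/=; split => [[/IH[k kN h]|h]|[k]].
    - by exists k => //; rewrite addn1; exact: ltnW.
    - by exists N => //; rewrite addn1.
    - by rewrite addn1 ltnS leq_eqVlt => /predU1P[->|kN] h; [right|left; apply/IH; exists k].
  apply: (@pr_eventually _ _ _ P E) => //.
  - by move=> N; have [] := pr_bigsetU P (iota 0 N) mD.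
  - move=> w [k _ Dw]; exists k.+1 => l kl; apply/EP; by exists k.
  - move=> N; have [_ h] := pr_bigsetU P (iota 0 N) mD; rewrite (le_trans h)//.
    rewrite (@le_trans _ _ (\sum_(k <- iota 0 N) e / 4 / 2 ^+ k))//.
      by apply: ler_sum => k _; apply: ltW; case: (hCO k).
    have -> : \sum_(k <- iota 0 N) e / 4 / 2 ^+ k = e / 2 * (1 - (2 ^+ N)^-1).
      elim: N {h} => [|N IH]; first by rewrite big_nil expr0 invr1 subrr mulr0.
      rewrite -addn1 iotaD big_cat big_seq1/= IH addn1 exprS add0n.
      by field; rewrite expf_neq0.
    by rewrite ger_pMr ?divr_gt0// gerBl invr_ge0 exprn_ge0.
have [N hN] : exists N, pr P (G @^-1` ((\bigcup_n C n) `\` Cn N)) < e / 2.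
  apply: pr_vanish; last by rewrite divr_gt0.
  - move=> N; apply: measurable_event; apply: measurableD.
      by apply: bigcupT_measurable => k; exact: closed_measurable_rV.
    exact: closed_measurable_rV.
  - move=> k l w kl [Cw nw]; split => // /CnP[j jk h]; apply: nw; apply/CnP; exists j => //.
    exact: leq_trans kl.
  - move=> w; case: (pselect ((\bigcup_n C n) (G w))) => [[k _ Ck]|h]; last by exists 0%N => -[].
    by exists k.+1 => -[_]; apply; apply/CnP; exists k.
exists (Cn N), (\bigcup_n V n); split => //.
- by apply: bigcup_open => n _; exact: oV.
- by move=> y /CnP[k _ h]; exists k => //; case: (hCO k) => _ _ + _ _; apply.
- by move=> y [k _ h]; exists k => //; case: (hCO k) => _ _ _ + _; apply.
rewrite (splitr e); apply: (@le_lt_trans _ _ (pr P (\bigcup_k D k) + pr P (G @^-1` ((\bigcup_n C n) `\` Cn N)))).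
  apply: pr_cover => //.
  - by apply: measurable_gap => //; apply: bigcup_open.
  - apply: measurable_event; apply: measurableD.
      by apply: bigcupT_measurable => k; exact: closed_measurable_rV.
    exact: closed_measurable_rV.
  move=> w [[k _ Vk] nC]; case: (pselect (C k (G w))) => Ck; last by left; exists k.
  by right; split => //; exists k.
by rewrite ler_ltD.
Qed.

Lemma regular_borel A : measurable (A : set (borel_rV R d)) -> regular_set A.
Proof.
apply: smallest_sub => //; last by move=> O oO; exact: regular_open.
split.
- exact: regular_open open0.
- by move=> B rB; rewrite setTD; exact: regular_setC.
- exact: regular_bigcup.
Qed.

End law_regularity.

(** * Domination of laws by covering with cells *)

Section cell_domination.
Context {dO} {Omega : measurableType dO} {R : realType} (P : probability Omega R) {d : nat}.
Variables (G : Omega -> 'rV[R]_d) (Cst c : R) (L : nat).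
Hypothesis mG : forall i, measurable_fun setT (fun w => G w ord0 i).
Hypotheses (Cst0 : 0 <= Cst) (c0 : 0 < c).
Hypothesis lower : forall (a : 'rV[R]_d) (r : R), 0 < r ->
  (forall i, - L%:R <= a ord0 i /\ a ord0 i + r <= L%:R) ->
  c * r ^+ d <= pr P [set w | forall i, a ord0 i <= G w ord0 i < a ord0 i + r].

(** The law of U has a density at most Cst / 2^d, expressed by the mass of cubes. *)
Definition spread (U : Omega -> 'rV[R]_d) := forall (y : 'rV[R]_d) (r : R), 0 < r ->
  pr P [set w | forall i, `|U w ord0 i - y ord0 i| <= r] <= Cst * r ^+ d.

Definition open_box : set 'rV[R]_d := [set y | `|y| < L%:R].

Lemma open_box_open : open open_box.
Proof.
apply: (@open_comp _ _ (fun y : 'rV[R]_d => `|y|) [set t | t < L%:R]); last exact: open_lt.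
by move=> y _; exact: norm_continuous.
Qed.

Lemma open_box_coord y i : open_box y -> - L%:R < y ord0 i /\ y ord0 i < L%:R.
Proof.
by move=> yL; have := le_lt_trans (norm_coord_le y ord0 i) yL; rewrite ltr_norml => /andP.
Qed.

Section fixed_mesh.
Variable k : nat.
Let r : R := k.+1%:R^-1.
Let N := (2 * L * k.+1)%N.

(** The box [-L, L[^d is tiled by N^d half-open cells of side r = 1/(k+1), with
    N = 2 L (k+1), indexed by their lower corners. *)
Definition corner (m : {ffun 'I_d -> 'I_N}) : 'rV[R]_d := \row_i ((m i)%:R * r - L%:R).

Definition cell (m : {ffun 'I_d -> 'I_N}) : set 'rV[R]_d :=
  [set y | forall i, corner m ord0 i <= y ord0 i < corner m ord0 i + r].

Let r0 : 0 < r. Proof. by rewrite invr_gt0. Qed.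

Lemma cell_disjoint m m' y : cell m y -> cell m' y -> m = m'.
Proof.
move=> h h'; apply/ffunP => i; apply: val_inj.
have := h i; have := h' i; rewrite !mxE => /andP[a1 a2] /andP[b1 b2].
have k1 : 0 < k.+1%:R :> R by [].
have t (n : nat) : n%:R * r - L%:R <= y ord0 i -> y ord0 i < n%:R * r - L%:R + r ->
    Num.truncn ((y ord0 i + L%:R) * k.+1%:R) = n.
  move=> n1 n2; apply: truncn_def; rewrite -[n.+1%:R]natr1.
  rewrite -ler_pdivrMr// -ltr_pdivlMr// -/r; apply/andP; split; first by rewrite -lerBlDr.
  by rewrite mulrDl mul1r -ltrBrDr; move: n2; rewrite addrAC ltrBrDr.
exact: etrans (esym (t _ b1 b2)) (t _ a1 a2).
Qed.

Lemma cell_cover y : open_box y -> exists m, cell m y.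
Proof.
move=> yL.
have b i : 0 <= (y ord0 i + L%:R) * k.+1%:R.
  by rewrite mulr_ge0// -lerBlDr sub0r ltW//; case: (open_box_coord i yL).
have h i : (Num.truncn ((y ord0 i + L%:R) * k.+1%:R) < N)%N.
  rewrite truncn_lt_nat// /N natrM ltr_pM2r// mul2n -addnn natrD ltrD2r.
  by case: (open_box_coord i yL).
exists [ffun i => Ordinal (h i)] => i; rewrite !mxE ffunE /=.
have /andP[] := truncn_itv (b i); set n := Num.truncn _.
rewrite -ler_pdivrMr// -[n.+1%:R]natr1 -ltr_pdivlMr// -/r mulrDl mul1r => n1 n2.
by apply/andP; split; [rewrite lerBlDr|rewrite addrAC ltrBrDr].
Qed.

Lemma measurable_cell (V : Omega -> 'rV[R]_d) m :
  (forall i, measurable_fun setT (fun w => V w ord0 i)) -> measurable (V @^-1` cell m).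
Proof.
move=> mV; have -> : V @^-1` cell m =
    [set w | forall i, `[corner m ord0 i, corner m ord0 i + r[%classic (V w ord0 i)].
  by apply/seteqP; split=> w /= h i; have := h i; rewrite /= in_itv.
by apply: (@measurable_coordwise _ _ _ _ (fun i w => V w ord0 i)
  (fun i => `[corner m ord0 i, corner m ord0 i + r[%classic)).
Qed.

(** A cell lies in the closed cube of half-side r around its corner, and both bounds
    are multiples of r^d. *)
Lemma spread_cell (U : Omega -> 'rV[R]_d) m : (forall i, measurable_fun setT (fun w => U w ord0 i)) -> spread U ->
  pr P (U @^-1` cell m) <= Cst / c * pr P (G @^-1` cell m).
Proof.
move=> mU sU.
have mball := measurable_cube (corner m) r mU.
have h1 : pr P (U @^-1` cell m) <= Cst * r ^+ d.
  apply: (le_trans _ (sU (corner m) r r0)); apply: pr_mono => //; first exact: measurable_cell.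
  move=> w /= h i; have /andP[a1 a2] := h i.
  by rewrite ger0_norm ?subr_ge0// lerBlDl ltW.
have h2 : c * r ^+ d <= pr P (G @^-1` cell m).
  apply: lower => // i; rewrite mxE; split.
    by rewrite lerDr mulr_ge0// ltW.
  have mi : (m i).+1%:R <= N%:R :> R by rewrite ler_nat.
  rewrite addrAC -[X in _ + X - _]mul1r -mulrDl natr1 lerBlDr.
  rewrite (@le_trans _ _ (N%:R * r))//; first by rewrite ler_wpM2r// ltW.
  by rewrite /N /r natrM mulfK ?pnatr_eq0// mul2n -addnn natrD.
rewrite (le_trans h1)// -mulrA ler_wpM2l//.
by rewrite -ler_pdivrMl ?invr_gt0// invrK.
Qed.

End fixed_mesh.

(** The cells of mesh 1/(k+1) contained in O eventually contain any given point of O. *)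
Lemma cell_domination (U : Omega -> 'rV[R]_d) O : (forall i, measurable_fun setT (fun w => U w ord0 i)) -> spread U ->
  open O -> pr P (U @^-1` (O `&` open_box)) <= Cst / c * pr P (G @^-1` O).
Proof.
move=> mU sU oO.
have mUr := measurable_rV mU; have mGr := measurable_rV mG.
have mO : measurable (G @^-1` O) by apply: (measurable_event mGr); exact: open_measurable_rV.
pose l k := [seq m <- enum {ffun 'I_d -> 'I_(2 * L * k.+1)} | `[< cell m `<=` O >]].
apply: (@pr_eventually _ _ _ P (fun k => \big[setU/set0]_(m <- l k) (U @^-1` cell m))).
- apply: (measurable_event mUr); apply: measurableI; first exact: open_measurable_rV.
  by apply: open_measurable_rV; exact: open_box_open.
- by move=> k; have [] := pr_bigsetU P (l k) (fun m => measurable_cell m mU).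
- move=> w [Ow bw]; have /nbhs_ballP[e /= e0 eO] : nbhs (U w) O by exact: open_nbhs_nbhs.
  have [k0 _ hk0] := near_infty_natSinv_lt (PosNum e0).
  exists k0 => k kk; have [m hm] := @cell_cover k (U w) bw.
  have mO' : m \in l k.
    rewrite mem_filter mem_enum andbT; apply/asboolP => y hy; apply: eO.
    apply/ball_rVP => // i.
    have := hm i; have := hy i; have := hk0 k kk; rewrite /= => ke /andP[y1 y2] /andP[u1 u2].
    rewrite ltr_distl; move: y1 y2 u1 u2 ke.
    move: (corner m ord0 i) (y ord0 i) (U w ord0 i) k.+1%:R^-1 => a1 a2 a3 a4 *.
    apply/andP; split; lra.
  rewrite (perm_big _ (perm_to_rem mO')) big_cons; by left.
- move=> k; have [_ h] := pr_bigsetU P (l k) (fun m => measurable_cell m mU).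
  rewrite (le_trans h)// (le_trans (ler_sum _ (fun m _ => spread_cell m mU sU)))//.
  rewrite -mulr_sumr ler_wpM2l ?divr_ge0 ?(ltW c0)//.
  apply: pr_sum_disjoint => //.
  + exact: filter_uniq (enum_uniq _).
  + by move=> m; exact: measurable_cell.
  + by move=> m m' w; exact: cell_disjoint.
  + by move=> m; rewrite mem_filter => /andP[/asboolP mO' _] w; exact: mO'.
Qed.

(** If X is the limit of F n and lies in an open set, then F n eventually lies in it. *)
Lemma limit_domination (F : nat -> Omega -> 'rV[R]_d) (X : Omega -> 'rV[R]_d) O :
  (forall n i, measurable_fun setT (fun w => F n w ord0 i)) -> (forall n, spread (F n)) ->
  measurable_fun setT (X : Omega -> borel_rV R d) ->
  {ae P, forall w, forall e : R, 0 < e -> exists n0, forall n, (n0 <= n)%N -> `|X w - F n w| <= e} ->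
  open O -> pr P (X @^-1` (O `&` open_box)) <= Cst / c * pr P (G @^-1` O).
Proof.
move=> mF sF mX [N [mN N0 hN]] oO.
have oOb : open (O `&` open_box) by apply: openI => //; exact: open_box_open.
have mE (V : Omega -> 'rV[R]_d) : measurable_fun setT (V : Omega -> borel_rV R d) -> measurable (V @^-1` (O `&` open_box)).
  by move=> mV; apply: (measurable_event mV); exact: open_measurable_rV.
have mFr n := measurable_rV (mF n).
rewrite (@le_trans _ _ (pr P (X @^-1` (O `&` open_box) `\` N) + pr P N))//.
  apply: pr_cover => //; [exact: mE|by apply: measurableD => //; exact: mE|].
  by move=> w h; case: (pselect (N w)) => Nw; [right|left].
rewrite {2}/pr N0 addr0.
apply: (@pr_eventually _ _ _ P (fun n => F n @^-1` (O `&` open_box))).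
- by apply: measurableD => //; exact: mE.
- by move=> n; exact: mE.
- move=> w [Xw Nw]; have /nbhs_ballP[e /= e0 eO] : nbhs (X w) (O `&` open_box) by exact: open_nbhs_nbhs.
  have [n0 hn0] : exists n0, forall n, (n0 <= n)%N -> `|X w - F n w| <= e / 2.
    have := contra_notP (hN w) Nw; apply; by rewrite divr_gt0.
  exists n0 => n /hn0 h; apply: eO; rewrite mx_norm_ball /ball_/= (le_lt_trans h)//.
  by rewrite ltr_pdivrMr// ltr_pMr// ltr1n.
- by move=> n; exact: cell_domination.
Qed.

End cell_domination.

(** * From domination to continuity in the starting point *)

Section domination_strong_feller.
Context {dO} {Omega : measurableType dO} {R : realType} (P : probability Omega R) {d : nat}.
Variables (X : 'rV[R]_d -> Omega -> 'rV[R]_d) (G : Omega -> 'rV[R]_d) (Lc : R).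
Hypothesis mX : forall x, measurable_fun setT (X x : Omega -> borel_rV R d).
Hypothesis mG : measurable_fun setT (G : Omega -> borel_rV R d).
Hypothesis Lc0 : 0 <= Lc.
Hypothesis lip : forall x y, {ae P, forall w, `|X x w - X y w| <= Lc * `|x - y|}.
Hypothesis dom : forall L : nat, exists2 K : R, 0 <= K & forall x O, open O ->
  pr P (X x @^-1` (O `&` open_box L)) <= K * pr P (G @^-1` O).
Implicit Types (A : set 'rV[R]_d) (x : 'rV[R]_d).

Let mev x A : measurable (A : set (borel_rV R d)) -> measurable (X x @^-1` A).
Proof. exact: (measurable_event (mX x)). Qed.

Let mbox (L : nat) : measurable (open_box L : set (borel_rV R d)).
Proof. by apply: open_measurable_rV; exact: open_box_open. Qed.

Lemma box_tail x (e : R) : 0 < e -> exists L : nat, pr P (X x @^-1` (~` open_box L)) < e.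
Proof.
move=> e0; apply: pr_vanish => // [k|k l w kl h1 h2|w].
- by apply: mev; exact: measurableC.
- by apply: h1; rewrite /open_box/= (lt_le_trans h2)// ler_nat.
- by exists (Num.truncn `|X x w|).+1; apply; exact: truncnS_gt.
Qed.

(** Let C <= A <= V with V minus C small for the law of G.  If X x0 is in A and X x
    is not, then X x0 or X x lies in V minus C, which is unlikely by domination, or
    X x0 lies in V while the nearby point X x does not, so that X x0 is in V minus
    shrink V k.  This set does not depend on x and is small for the law of X x0. *)
Lemma event_stable A x0 (e : R) : measurable (A : set (borel_rV R d)) -> 0 < e ->
  exists2 rho : R, 0 < rho & forall x, `|x - x0| < rho ->
    pr P ((X x0 @^-1` A) `&` (X x @^-1` (~` A))) <= e.
Proof.
move=> mA e0; have e8 : 0 < e / 8 by rewrite divr_gt0.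
have [n hn] := box_tail x0 e8.
have [K K0 hK] := dom n.+1.
have K1 : 0 < K + 1 by rewrite ltr_wpDl.
have [C [V [cC oV CA AV hV]]] := regular_borel P mG mA (divr_gt0 e8 K1).
have [k hk] := shrink_prob P (mX x0) oV e8.
pose D := V `\` C.
have oD : open D by rewrite /D setDE; apply: openI => //; exact: closed_openC.
have mD : measurable (D : set (borel_rV R d)) by exact: open_measurable_rV.
have L1 : 0 < Lc + 1 by rewrite ltr_wpDl.
exists (k.+1%:R^-1 / (Lc + 1)) => [|x xx0]; first by rewrite divr_gt0// invr_gt0.
have close y : `|y - x0| < k.+1%:R^-1 / (Lc + 1) -> {ae P, forall w, `|X y w - X x0 w| < k.+1%:R^-1}.
  move=> yx; apply: filterS (lip y x0) => w h; rewrite (le_lt_trans h)//.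
  rewrite (@le_lt_trans _ _ ((Lc + 1) * `|y - x0|))//; first by rewrite ler_wpM2r// lerDl.
  by rewrite mulrC -ltr_pdivlMr.
(* The box is taken one unit larger, as X y is within 1 of X x0. *)
have gap y : `|y - x0| < k.+1%:R^-1 / (Lc + 1) -> pr P (X y @^-1` D) <= e / 4.
  move=> yx.
  have t1 : pr P (X y @^-1` (~` open_box n.+1)) <= e / 8.
    apply: le_trans (ltW hn); apply: pr_ae; [by apply: mev; exact: measurableC|by apply: mev; exact: measurableC|].
    apply: filterS (close y yx) => w h h1 h2; apply: h1; rewrite /open_box/=.
    rewrite -(subrK (X x0 w) (X y w)) (le_lt_trans (ler_normD _ _))//.
    rewrite -natr1 addrC ltr_leD// (le_trans (ltW h))// invf_le1//.
    by rewrite ler1n.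
  have t2 : pr P (X y @^-1` (D `&` open_box n.+1)) <= e / 8.
    rewrite (le_trans (hK y D oD))//.
    rewrite (le_trans (ler_wpM2l K0 (ltW hV)))// mulrCA ger_pMr// ler_pdivrMr// mul1r lerDl//.
  apply: (@le_trans _ _ (e / 8 + e / 8)); last by lra.
  apply: (le_trans _ (lerD t2 t1)); apply: pr_cover.
  - exact: mev.
  - by apply: mev; exact: measurableI.
  - by apply: mev; exact: measurableC.
  - move=> w Dw; case: (pselect (open_box n.+1 (X y w))) => h; [by left|by right].
have g1 := gap x xx0.
have g0 : pr P (X x0 @^-1` D) <= e / 4 by apply: gap; rewrite subrr normr0 divr_gt0// invr_gt0.
have msh : measurable (X x0 @^-1` (V `\` shrink V k)).
  by apply: measurable_gap => //; exact: closed_shrink.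
have mDD : measurable (X x0 @^-1` D `|` X x @^-1` D) by apply: measurableU; exact: mev.
apply: (@le_trans _ _ (pr P (X x0 @^-1` (V `\` shrink V k) `|` (X x0 @^-1` D `|` X x @^-1` D)))).
  apply: pr_ae.
  - by apply: measurableI; apply: mev => //; exact: measurableC.
  - exact: measurableU.
  apply: filterS (close x xx0) => w h [Aw nA].
  case: (pselect (C (X x0 w))) => Cw; last by right; left; split => //; exact: AV.
  case: (pselect (V (X x w))) => Vw.
    by right; right; split => // /CA.
  left; split; first exact: AV.
  by move=> /(_ _ Vw); apply; rewrite mx_norm_ball /ball_/=.
rewrite (le_trans (pr_setU P msh mDD))//.
have := pr_setU P (mev x0 mD) (mev x mD); lra.
Qed.

(** f is within eta of a step function on finitely many level sets, to each of which
    [event_stable] applies. *)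
Lemma integral_stable (f : 'rV[R]_d -> R) (M : R) x0 :
  measurable_fun setT (f : borel_rV R d -> R) -> (forall y, `|f y| <= M) ->
  forall e : R, 0 < e -> exists2 rho : R, 0 < rho & forall x, `|x - x0| < rho ->
    `|\int[P]_w f (X x w) - \int[P]_w f (X x0 w)| <= e.
Proof.
move=> mf fM e e0.
have M0 : 0 <= M by apply: le_trans (fM 0).
(* A j is the set where f lies in the j-th slice of height eta. *)
pose eta := e / 2; have eta0 : 0 < eta by rewrite divr_gt0.
pose N := (Num.truncn (2 * M / eta)).+1.
pose A (j : nat) : set 'rV[R]_d := f @^-1` `[- M + j%:R * eta, - M + j.+1%:R * eta[.
have mA j : measurable (A j : set (borel_rV R d)).
  by rewrite -[X in measurable X]setTI; exact: mf.
have C0 : 0 < 4 * M * N%:R + 1 by rewrite ltr_wpDl// !mulr_ge0.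
(* N events of probability at most e1, on each of which f changes by at most 2 M,
   contribute at most e / 2. *)
pose e1 := e / (4 * M * N%:R + 1); have e10 : 0 < e1 by rewrite divr_gt0.
pose E x j := (X x0 @^-1` A j) `&` (X x @^-1` (~` A j)).
have mE x j : measurable (E x j).
  by apply: measurableI; apply: mev => //; exact: measurableC.
have [rho rho0 hrho] : exists2 rho : R, 0 < rho & forall x, `|x - x0| < rho -> forall j, (j < N)%N -> pr P (E x j) <= e1.
  elim: N {C0 e1 e10} (e1) e10 => [|n IH] e1 e10; first by exists 1.
  have [r1 r10 h1] := IH e1 e10; have [r2 r20 h2] := event_stable x0 (mA n) e10.
  exists (Num.min r1 r2) => [|x]; first by rewrite lt_min r10.
  rewrite lt_min => /andP[x1 x2] j; rewrite ltnS leq_eqVlt => /predU1P[->|]; first exact: h2.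
  exact: h1.
exists rho => // x /hrho hx.
have [mU hU] := pr_bigsetU P (iota 0 N) (mE x).
set W := \big[setU/set0]_(j <- iota 0 N) E x j in mU hU.
have prW : 2 * M * pr P W <= e / 2.
  have : \sum_(j <- iota 0 N) pr P (E x j) <= N%:R * e1.
    rewrite (@le_trans _ _ (\sum_(j <- iota 0 N) e1))//.
      rewrite big_seq [leRHS]big_seq.
      by apply: ler_sum => j; rewrite mem_iota add0n => /hx.
    by rewrite big_const_seq count_predT size_iota iter_addr_0 mulr_natl.
  move=> /(le_trans hU) h; rewrite (le_trans (ler_wpM2l _ h)) ?mulr_ge0//.
  have -> : 2 * M * (N%:R * e1) = e / 2 * ((4 * M * N%:R) / (4 * M * N%:R + 1)).
    by rewrite /e1; field; rewrite gt_eqF.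
  by rewrite ger_pMr ?divr_gt0// ler_pdivrMr// mul1r lerDl.
have mfX y : measurable_fun setT (fun w => f (X y w)) by exact: measurableT_comp mf (mX y).
have ifX y : P.-integrable setT (EFin \o (fun w => f (X y w))).
  by apply: (@integrable_bounded _ _ _ _ _ M).
have iW : P.-integrable setT (EFin \o (fun w => \1_W w : R)).
  by apply: (@integrable_bounded _ _ _ _ _ 1) => [|w]; [exact: measurable_indic|rewrite indicE normr_nat; case: (_ \in _)].
have ic : P.-integrable setT (EFin \o (fun=> eta)) by exact: finite_measure_integrable_cst.
rewrite -RintegralB//.
have iB := RintegrableB measurableT (ifX x) (ifX x0).
rewrite (le_trans (le_normr_Rintegral _ iB))//.
have i2W := RintegrableZ measurableT (2 * M) iW.
apply: (@le_trans _ _ (\int[P]_w (eta + 2 * M * \1_W w))).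
  apply: le_Rintegral => //; [exact: integrable_norm|exact: RintegrableD|].
  move=> w _.
  have y0 : 0 <= (f (X x0 w) + M) / eta.
    by rewrite divr_ge0 ?(ltW eta0)// -lerBlDr sub0r; have := fM (X x0 w); rewrite ler_norml => /andP[].
  pose j := Num.truncn ((f (X x0 w) + M) / eta).
  have jN : (j < N)%N.
    rewrite /N ltnS; apply: le_truncn; rewrite ler_pM2r ?invr_gt0//.
    by have := fM (X x0 w); rewrite ler_norml => /andP[_]; lra.
  have Aj : A j (X x0 w).
    rewrite /A /= in_itv/=; have /andP[] := truncn_itv y0; rewrite -/j.
    rewrite ler_pdivlMr// ltr_pdivrMr// => j1 j2; apply/andP; split; lra.
  case: (pselect (A j (X x w))) => Ajx.
    have w0 : 0 <= 2 * M * \1_W w by rewrite mulr_ge0// mulr_ge0.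
    apply: (@le_trans _ _ eta); last by rewrite lerDl.
    move: Aj Ajx; rewrite /A /= !in_itv/= -natr1 mulrDl mul1r => /andP[a1 a2] /andP[a3 a4].
    rewrite ler_distl; apply/andP; split; lra.
  have Ww : W w.
    have jI : j \in iota 0 N by rewrite mem_iota.
    by rewrite /W (perm_big _ (perm_to_rem jI)) big_cons; left.
  rewrite indicE mem_set// mulr1 (le_trans (ler_normB _ _))//.
  have := fM (X x w); have := fM (X x0 w); lra.
rewrite RintegralD// RintegralZl// (Rintegral_prob_cst P).
have -> : \int[P]_w (\1_W w : R) = pr P W by rewrite /Rintegral integral_indic// setIT.
rewrite /eta; lra.
Qed.

End domination_strong_feller.

(** * The endpoint noise *)

Section noise.
Context {dO} {Omega : measurableType dO} {R : realType} (P : probability Omega R).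
Variables (d : nat) (H T : R) (B : R -> Omega -> 'rV[R]_d).
Hypotheses (H1 : 1 / 2 < H) (H2 : H < 1) (T0 : 0 < T) (fB : fBm P H T B).
Local Notation mu := (@lebesgue_measure R).

Definition noise_comb (e : R) (j : 'I_d) : seq (R * (R * 'I_d)) :=
  [:: (1, (T, j)); (-2, (T - e, j)); (1, (T - 2 * e, j))].

Definition noise e j := lincomb B (noise_comb e j).

(** The factor 4 - 2^(2H) is positive because H < 1. *)
Definition noise_var e : R := (4 - 2 `^ (2 * H)) * e `^ (2 * H).

Section fixed_step.
Variable e : R.
Hypotheses (e0 : 0 < e) (eT : 2 * e <= T).

Let t1 : 0 <= T <= T. Proof. by rewrite ltW//=. Qed.
Let t2 : 0 <= T - e <= T.
Proof. by apply/andP; split; move: e0 eT; lra. Qed.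
Let t3 : 0 <= T - 2 * e <= T.
Proof. by apply/andP; split; move: e0 eT; lra. Qed.

Lemma noise_in_time j : in_time T (noise_comb e j).
Proof. by rewrite /in_time /= t1 t2 t3. Qed.

Lemma noise_chaos j : chaos P T B (noise e j).
Proof. exact: (lincomb_chaos fB (noise_in_time j)). Qed.

Lemma dot_noise Y j : L2 P Y -> dot P Y (noise e j) =
  dot P Y (fun w => B T w ord0 j) - 2 * dot P Y (fun w => B (T - e) w ord0 j) +
  dot P Y (fun w => B (T - 2 * e) w ord0 j).
Proof.
move=> Y2; rewrite dotC /noise /lincomb dot_suml//; last first.
  move=> p; rewrite !inE => /or3P[] /eqP -> /=; apply: L2Z; exact: (B_L2 fB).
rewrite !big_cons big_nil/= !dotZl//; try exact: (B_L2 fB).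
by rewrite !(dotC P _ Y); ring.
Qed.

Lemma noise_dot i j : dot P (noise e i) (noise e j) = noise_var e * (i == j)%:R.
Proof.
have n2 k := lincomb_L2 fB (noise_in_time k).
rewrite dot_noise; last exact: n2.
have D t (tT : 0 <= t <= T) : dot P (noise e i) (fun w => B t w ord0 j) =
    (covR H T t - 2 * covR H (T - e) t + covR H (T - 2 * e) t) * (i == j)%:R.
  rewrite dotC dot_noise; last exact: (B_L2 fB).
  by rewrite !(B_dot fB)// [j == i]eq_sym !(covRC H t); ring.
rewrite !D// /noise_var /covR.
have -> : T - T = 0 by ring.
have -> : T - e - T = - e by ring.
have -> : T - 2 * e - T = - (2 * e) by ring.
have -> : T - (T - e) = e by ring.
have -> : T - e - (T - e) = 0 by ring.
have -> : T - 2 * e - (T - e) = - e by ring.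
have -> : T - (T - 2 * e) = 2 * e by ring.
have -> : T - e - (T - 2 * e) = e by ring.
have -> : T - 2 * e - (T - 2 * e) = 0 by ring.
rewrite !normrN normr0 powR0; last by rewrite mulf_neq0// gt_eqF//; move: H1; lra.
rewrite (gtr0_norm e0) gtr0_norm ?mulr_gt0// powRM// ?ltW//.
by field.
Qed.

Lemma noise_var_gt0 : 0 < noise_var e.
Proof.
rewrite mulr_gt0 ?powR_gt0// subr_gt0.
have -> : (4 : R) = 2 `^ 2 by rewrite (powR_mulrn 2)// -natrX.
rewrite (_ : 2 `^ 2 = 2 `^ (2 * H) * 2 `^ (2 - 2 * H) :> R); last first.
  by rewrite -powRD ?pnatr_eq0 ?implybT//; congr (_ `^ _); ring.
rewrite ltr_pMr ?powR_gt0//.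
have : (1 : R) `^ (2 - 2 * H) < 2 `^ (2 - 2 * H); last by rewrite powR1.
by apply: gt0_ltr_powR; rewrite ?nnegrE ?ltr1n//; move: H2; lra.
Qed.

(** The noise is a second difference of B at T; so is, by linearity, the kernel that
    represents the covariance. *)
Lemma wiener_noise t i j (phi : R -> R) (Y : Omega -> R) : t <= T ->
  mu.-integrable `[0, t] (EFin \o phi) ->
  wiener_integral P H (fun r w => B r w ord0 j) t phi Y ->
  dot P Y (noise e i) =
  (\int[mu]_(r in `[0, t]) (phi r * seckernel (2 * H) T e r)) * (j == i)%:R.
Proof.
move=> tT iphi hY; have [cY hB] := wiener_chaos H1 H2 T0 fB tT iphi hY.
rewrite dot_noise; last exact: chaos_L2 cY.
rewrite !hB//.
have ip u : 0 <= u <= T -> mu.-integrable `[0, t] (EFin \o (fun r => phi r * covkernel H u r)).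
  move=> uT; apply: (@integrableM_bounded _ phi (covkernel H u) 0 t (H * (2 * T `^ (2 * H - 1)))) => //.
    by apply: measurable_funTS; apply: continuous_measurable_fun; exact: continuous_covkernel.
  by move=> r /andP[r0 rt]; apply: covkernel_bound => //; rewrite r0 (le_trans rt).
have -> : \int[mu]_(r in `[0, t]) (phi r * seckernel (2 * H) T e r) =
    \int[mu]_(r in `[0, t]) (phi r * covkernel H T r) -
    2 * \int[mu]_(r in `[0, t]) (phi r * covkernel H (T - e) r) +
    \int[mu]_(r in `[0, t]) (phi r * covkernel H (T - 2 * e) r).
  have i1 := ip _ t1; have i3 := ip _ t3.
  have i2 : mu.-integrable `[0, t] (EFin \o (fun r => 2 * (phi r * covkernel H (T - e) r))).
    by apply: RintegrableZ => //; exact: ip.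
  have i12 : mu.-integrable `[0, t] (EFin \o (fun r => phi r * covkernel H T r - 2 * (phi r * covkernel H (T - e) r))).
    exact: RintegrableB.
  rewrite -RintegralZl//; last exact: ip.
  rewrite -RintegralB// -RintegralD//.
  apply: eq_Rintegral => r _; rewrite /seckernel /covkernel.
  have -> : r - T = - (T - r) by ring.
  have -> : r - (T - e) = - (T - e - r) by ring.
  have -> : r - (T - 2 * e) = - (T - 2 * e - r) by ring.
  rewrite !oddpowN.
  move: (oddpow _ r) (oddpow _ (T - r)) (oddpow _ (T - e - r)) (oddpow _ (T - 2 * e - r)) (phi r) => a1 a2 a3 a4 a5.
  by field.
move: (\int[mu]_(r in `[0, t]) (phi r * covkernel H T r))
  (\int[mu]_(r in `[0, t]) (phi r * covkernel H (T - e) r))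
  (\int[mu]_(r in `[0, t]) (phi r * covkernel H (T - 2 * e) r)) => I1 I2 I3.
by ring.
Qed.

End fixed_step.
End noise.

(** * The driving integral *)

Section driving_process.
Context {dO} {Omega : measurableType dO} {R : realType} (P : probability Omega R).
Variables (d : nat) (H T : R) (B : R -> Omega -> 'rV[R]_d) (sigma : R -> 'M[R]_d).
Hypotheses (H1 : 1 / 2 < H) (H2 : H < 1) (T0 : 0 < T) (fB : fBm P H T B).
Local Notation mu := (@lebesgue_measure R).
Hypothesis sI : forall i j, mu.-integrable `[0, T] (EFin \o (fun r => sigma r i j)).

Let sIt t i j : t <= T -> mu.-integrable `[0, t] (EFin \o (fun r => sigma r i j)).
Proof. by move=> tT; apply: integrable_subseg (sI i j). Qed.

(** The sum over j of the scalar integrals is required exactly and not almost surely,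
    which makes Z measurable. *)
Definition wiener_coord (t : R) (i : 'I_d) (Z : Omega -> R) := exists Y : 'I_d -> Omega -> R,
  (forall j, wiener_integral P H (fun r w => B r w ord0 j) t (fun r => sigma r i j) (Y j)) /\
  Z = (fun w => \sum_(j < d) Y j w).

Lemma wiener_coord_chaos t i Z : 0 <= t <= T -> wiener_coord t i Z -> chaos P T B Z /\
  forall u k, 0 <= u <= T -> dot P Z (fun w => B u w ord0 k) =
    \int[mu]_(r in `[0, t]) (sigma r i k * covkernel H u r).
Proof.
move=> /andP[t0 tT] [Y [hY ->]].
have hc j := wiener_chaos H1 H2 T0 fB tT (sIt i j tT) (hY j).
split; first by apply: (chaos_sum fB) => j; have [] := hc j.
move=> u k uT; rewrite dot_suml; last exact: (B_L2 fB); last first.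
  by move=> j _; have [/chaos_L2] := hc j.
rewrite (bigD1_seq k) ?mem_index_enum ?index_enum_uniq//= big1.
  by rewrite addr0; have [_ ->//] := hc k; rewrite eqxx mulr1.
by move=> j jk; have [_ ->//] := hc j; rewrite (negPf jk) mulr0.
Qed.

Lemma wiener_coord_noise e t i j Z : 0 < e -> 2 * e <= T -> 0 <= t <= T -> wiener_coord t i Z ->
  dot P Z (noise T B e j) = response (2 * H) T sigma e t j i.
Proof.
move=> e0 eT /andP[t0 tT] [Y [hY ->]].
have hc k := wiener_chaos H1 H2 T0 fB tT (sIt i k tT) (hY k).
have n2 := chaos_L2 (noise_chaos T0 fB e0 eT j).
rewrite dot_suml//; last by move=> k _; have [/chaos_L2] := hc k.
rewrite mxE (bigD1_seq j) ?mem_index_enum ?index_enum_uniq//= big1.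
  by rewrite addr0 (wiener_noise H1 H2 T0 fB e0 eT _ tT (sIt i j tT) (hY j)) eqxx mulr1.
move=> k kj; rewrite (wiener_noise H1 H2 T0 fB e0 eT _ tT (sIt i k tT) (hY k)).
by rewrite (negPf kj) mulr0.
Qed.

(** Two versions have the same covariances with B, so their difference is an element
    of the chaos orthogonal to B. *)
Lemma wiener_coord_unique t i Z Z' : 0 <= t <= T -> wiener_coord t i Z -> wiener_coord t i Z' ->
  {ae P, forall w, Z w = Z' w}.
Proof.
move=> tT hZ hZ'; have [cZ dZ] := wiener_coord_chaos tT hZ; have [cZ' dZ'] := wiener_coord_chaos tT hZ'.
have : {ae P, forall w, Z w - Z' w = 0}.
  apply: (chaos_orthogonal_zero fB); first exact: (chaosB fB).
  move=> u k uT; rewrite dotBl; [|exact: chaos_L2 cZ|exact: chaos_L2 cZ'|exact: (B_L2 fB)].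
  by rewrite dZ// dZ'// subrr.
by apply: filterS => w /eqP; rewrite subr_eq0 => /eqP.
Qed.

(** A single measurable version Zh serves all the solutions, each of which comes with
    an integral of its own. *)
Lemma driving_version (Z0 : R -> Omega -> 'rV[R]_d) : wiener_integral_process P H T B sigma Z0 ->
  exists Zh : R -> Omega -> 'rV[R]_d,
    [/\ forall t i, 0 <= t <= T -> wiener_coord t i (fun w => Zh t w ord0 i),
        forall t i, measurable_fun setT (fun w => Zh t w ord0 i) &
        forall Z, wiener_integral_process P H T B sigma Z -> forall t i, 0 <= t <= T ->
          {ae P, forall w, Z t w ord0 i = Zh t w ord0 i}].
Proof.
move=> [_ h0].
have ex (p : R * 'I_d) : exists V : Omega -> R, measurable_fun setT V /\
    (0 <= p.1 <= T -> wiener_coord p.1 p.2 V).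
  case: (boolP (0 <= p.1 <= T)) => pT; last by exists (fun=> 0); split => //; exact: measurable_cst.
  have [Y [hY _]] := h0 p.1 p.2 pT.
  have hc : wiener_coord p.1 p.2 (fun w => \sum_(j < d) Y j w) by exists Y.
  exists (fun w => \sum_(j < d) Y j w); split => //.
  by have [/chaos_L2[]] := wiener_coord_chaos pT hc.
have [V hV] := choice ex.
exists (fun t w => \row_i V (t, i) w).
have E t i : (fun w => (\row_i0 V (t, i0) w) ord0 i) = V (t, i) by apply/funext => w; rewrite mxE.
split.
- by move=> t i tT; rewrite E; exact: (hV (t, i)).2.
- by move=> t i; rewrite E; exact: (hV (t, i)).1.
move=> Z [_ hZ] t i tT; have [Y [hY aeY]] := hZ t i tT.
have hc : wiener_coord t i (fun w => \sum_(j < d) Y j w) by exists Y.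
have := wiener_coord_unique tT hc ((hV (t, i)).2 tT).
by move: aeY; apply: filterS2 => w -> ->; rewrite mxE.
Qed.

End driving_process.

(** * Uniform density bound for the Euler scheme *)

Section euler_spread.
Context {dO} {Omega : measurableType dO} {R : realType} (P : probability Omega R).
Variables (d : nat) (H T : R) (B : R -> Omega -> 'rV[R]_d) (sigma : R -> 'M[R]_d).
Hypotheses (H1 : 1 / 2 < H) (H2 : H < 1) (T0 : 0 < T) (fB : fBm P H T B).
Local Notation mu := (@lebesgue_measure R).
Hypothesis sI : forall i j, mu.-integrable `[0, T] (EFin \o (fun r => sigma r i j)).
Variable Zh : R -> Omega -> 'rV[R]_d.
Hypothesis hZ : forall t i, 0 <= t <= T -> wiener_coord P H B sigma t i (fun w => Zh t w ord0 i).
Hypothesis mZ : forall t i, measurable_fun setT (fun w => Zh t w ord0 i).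
Variables (b : 'rV[R]_d -> 'rV[R]_d) (K : R).
Hypotheses (K0 : 0 <= K) (bK : forall x y, `|b x - b y| <= K * `|x - y|).

(** Meshes are indexed so that the grid n has n + 1 steps and is never empty. *)
Definition grid (n k : nat) : R := k%:R * T / n.+1%:R.

Definition euler_value (n : nat) x w := euler b (T / n.+1%:R) x (fun k => Zh (grid n k) w) n.+1.

Lemma grid_in n k : (k <= n.+1)%N -> 0 <= grid n k <= T.
Proof.
move=> kn; rewrite /grid !mulr_ge0 ?invr_ge0 ?ler0n ?(ltW T0)//=.
by rewrite ler_pdivrMr// mulrC ler_wpM2l ?ler_nat// ltW.
Qed.

Lemma grid_last n : grid n n.+1 = T.
Proof. by rewrite /grid mulrAC mulfV ?pnatr_eq0// mul1r. Qed.

Lemma euler_value_measurable n x i : measurable_fun setT (fun w => euler_value n x w ord0 i).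
Proof. by apply: (euler_measurable K0 bK) => k j; exact: mZ. Qed.

Section response_step.
Variables (e c : R).
Hypotheses (e0 : 0 < e) (eT : 2 * e <= T) (c0 : 0 < c).
Hypothesis hc : forall (n : nat) (v : 'rV[R]_d), (0 < n)%N ->
  c * `|v| <= `|v *m response (2 * H) T sigma e T| -
    K * expR (K * T) * (T / n%:R * \sum_(k < n) `|v *m response (2 * H) T sigma e (k%:R * T / n%:R)|).

Let v0 := noise_var H e.
Let v00 : 0 < v0. Proof. exact: noise_var_gt0. Qed.
Let G := noise T B e.
Let cG j : chaos P T B (G j). Proof. exact: (noise_chaos T0 fB). Qed.
Let h (t : R) : 'M[R]_d := v0^-1 *: response (2 * H) T sigma e t.

Lemma noise_measurable j : measurable_fun setT (G j).
Proof. by have [] := chaos_L2 (cG j). Qed.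

Lemma noise_gaussian j : [/\ gaussian_rv P (G j), \int[P]_w G j w = 0 & 0 < dot P (G j) (G j)].
Proof.
have it := noise_in_time T0 e0 eT j; split.
- exact: (lincomb_gaussian fB).
- exact: (lincomb_mean fB).
- by rewrite (noise_dot H1 T0 fB e0 eT) eqxx mulr1.
Qed.

Lemma noise_box (C : 'I_d -> set R) : (forall j, measurable (C j)) ->
  P [set w | forall j, C j (G j w)] = (\prod_(j < d) fine (P (G j @^-1` C j)))%:E.
Proof.
move=> mC; apply: (chaos_independence_prod fB) => // i j ij.
by rewrite (noise_dot H1 T0 fB e0 eT) (negPf ij) mulr0.
Qed.

Section fixed_grid.
Variables (n : nat) (x : 'rV[R]_d).

Let U (ki : 'I_n.+2 * 'I_d) (w : Omega) : R :=
  Zh (grid n ki.1) w ord0 ki.2 - \sum_(j < d) h (grid n ki.1) j ki.2 * G j w.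

Let cU ki : chaos P T B (U ki).
Proof.
have kT : 0 <= grid n ki.1 <= T by apply: grid_in; rewrite -ltnS.
have [cz _] := wiener_coord_chaos H1 H2 T0 fB sI kT (hZ ki.2 kT).
apply: (chaosB fB) => //; apply: (chaos_sum fB) => j; exact: (chaosZ fB).
Qed.

Let mU ki : measurable_fun setT (U ki). Proof. by have [] := chaos_L2 (cU ki). Qed.

Let UG ki l : dot P (U ki) (G l) = 0.
Proof.
have kT : 0 <= grid n ki.1 <= T by apply: grid_in; rewrite -ltnS.
have [cz _] := wiener_coord_chaos H1 H2 T0 fB sI kT (hZ ki.2 kT).
have gl := chaos_L2 (cG l).
rewrite dotBl//; [|exact: chaos_L2 cz|by apply: L2_sum => j _; apply: L2Z; exact: chaos_L2 (cG j)].
rewrite (wiener_coord_noise H1 H2 T0 fB sI l e0 eT kT (hZ ki.2 kT)).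
rewrite dot_suml//; last by move=> j _; apply: L2Z; exact: chaos_L2 (cG j).
rewrite (bigD1_seq l) ?mem_index_enum ?index_enum_uniq//= big1 => [|j jl].
  rewrite addr0 dotZl//; rewrite (noise_dot H1 T0 fB e0 eT) eqxx mulr1 -/v0.
  have -> : h (grid n ki.1) l ki.2 = v0^-1 * response (2 * H) T sigma e (grid n ki.1) l ki.2.
    by rewrite [LHS]mxE.
  by rewrite mulrAC mulVf ?gt_eqF// mul1r subrr.
rewrite dotZl//; last exact: chaos_L2 (cG j).
by rewrite (noise_dot H1 T0 fB e0 eT) (negPf jl) mulr0 mulr0.
Qed.

Let Zof (v : ('I_n.+2 * 'I_d) + 'I_d -> R) (k : nat) : 'rV[R]_d :=
  \row_i (v (inl (inord k, i)) + \sum_(j < d) h (grid n k) j i * v (inr j)).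

Let Phi (v : ('I_n.+2 * 'I_d) + 'I_d -> R) : 'rV[R]_d := euler b (T / n.+1%:R) x (Zof v) n.+1.

Let PhiE w : Phi (glue (U ^~ w) (G ^~ w)) = euler_value n x w.
Proof.
apply: euler_ext => k kn; apply/rowP => i; rewrite !mxE /= /U /=.
by rewrite inordK// subrK.
Qed.

Let mPhi i : measurable_fun setT (fun v : boxT R (('I_n.+2 * 'I_d) + 'I_d)%type => Phi v ord0 i).
Proof.
apply: (@euler_measurable _ _ b K K0 bK _ (boxT R (('I_n.+2 * 'I_d) + 'I_d)%type) _ _ (fun k v => Zof v k)) => k l.
rewrite (_ : (fun v => _) = (fun v : boxT R (('I_n.+2 * 'I_d) + 'I_d)%type =>
    v (inl (inord k, l)) + \sum_(j < d) h (grid n k) j l * v (inr j))); last first.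
  by apply/funext => v; rewrite mxE.
apply: measurable_funD; first exact: measurable_box_coord.
apply: measurable_sum => j; apply: measurable_funM => //; exact: measurable_box_coord.
Qed.

(** With U frozen, two values of G that send the scheme to the same cube of half-side r
    differ by at most 2 r v0 / c.  So G lies in a cube of side 4 r v0 / c, whose
    probability is bounded by the Gaussian densities, and [disintegration_le]
    integrates this over U. *)
Lemma euler_density (p : 'I_d -> R) : (forall j, 0 < p j) ->
  (forall j (a a' : R), a <= a' -> (P (G j @^-1` `[a, a']) <= (p j * (a' - a))%:E)%E) ->
  forall (y : 'rV[R]_d) (r : R), 0 < r ->
  pr P [set w | forall i, `|euler_value n x w ord0 i - y ord0 i| <= r] <=
  (\prod_(j < d) (p j * (4 * v0 / c))) * r ^+ d.
Proof.
move=> p0 hp y r r0.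
pose S : set (boxT R (('I_n.+2 * 'I_d) + 'I_d)%type) :=
  [set v | forall i, `|Phi v ord0 i - y ord0 i| <= r].
have mS : measurable S := measurable_cube y r mPhi.
(* The radius of the set of values of G compatible with the cube. *)
pose D := 2 * r * v0 / c.
have D0 : 0 <= D by rewrite divr_ge0 ?(ltW c0)// mulr_ge0 ?(ltW v00)// mulr_ge0// ltW.
have indep (A : 'I_n.+2 * 'I_d -> set R) (C : 'I_d -> set R) :
    (forall i, measurable (A i)) -> (forall j, measurable (C j)) ->
    P ([set w | forall i, A i (U i w)] `&` [set w | forall j, C j (G j w)]) =
    (P [set w | forall i, A i (U i w)] * P [set w | forall j, C j (G j w)])%E.
  by move=> mA mC; apply: (chaos_independence fB).
have key := @disintegration_le _ _ _ P _ _ U G mU noise_measurable indep S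
  ((\prod_(j < d) (p j * (4 * v0 / c))) * r ^+ d)%:E mS.
have mSw w : measurable [set w' | S (glue (U ^~ w) (G ^~ w'))].
  have mg : measurable_fun setT (fun w' => glue (U ^~ w) (G ^~ w') : boxT R (('I_n.+2 * 'I_d) + 'I_d)%type).
    apply: measurable_to_box => -[ki|j] /=; first exact: measurable_cst.
    exact: noise_measurable.
  by rewrite -[X in measurable X]setTI; exact: mg.
have mev := measurable_cube y r (euler_value_measurable n x).
rewrite -lee_fin -prE//.
have -> : [set w | forall i, `|euler_value n x w ord0 i - y ord0 i| <= r] = [set w | S (glue (U ^~ w) (G ^~ w))].
  by apply/seteqP; split=> w /= hw i; have := hw i; rewrite PhiE.
apply: key => w.
(* Either no value of G is compatible, or one of them serves as a center. *)
have [[w1 Sw1]|none] := pselect (exists w1, S (glue (U ^~ w) (G ^~ w1))); last first.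
  rewrite (_ : [set w' | _] = set0); last by rewrite -subset0 => w' Sw'; apply: none; exists w'.
  rewrite measure0 lee_fin mulr_ge0 ?exprn_ge0 ?(ltW r0)// prodr_ge0// => j _.
  by rewrite mulr_ge0 ?(ltW (p0 j))// divr_ge0 ?(ltW c0)// mulr_ge0// ltW.
pose g1 : 'rV[R]_d := \row_j G j w1.
have sub : [set w' | S (glue (U ^~ w) (G ^~ w'))] `<=`
    [set w' | forall j, (`[g1 ord0 j - D, g1 ord0 j + D]%classic : set R) (G j w')].
  move=> w' Sw' j; rewrite /= in_itv/= -ler_distl.
  pose g' : 'rV[R]_d := \row_j G j w'.
  (* Moving G from g1 to g' moves the driving path by v times the response. *)
  pose v : 'rV[R]_d := v0^-1 *: (g' - g1).
  pose u k := v *m response (2 * H) T sigma e (grid n k).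
  have dist : `|euler b (T / n.+1%:R) x (fun k => Zof (glue (U ^~ w) (G ^~ w1)) k + u k) n.+1 -
      euler b (T / n.+1%:R) x (Zof (glue (U ^~ w) (G ^~ w1))) n.+1| <= 2 * r.
    have -> : euler b (T / n.+1%:R) x (fun k => Zof (glue (U ^~ w) (G ^~ w1)) k + u k) n.+1 =
        Phi (glue (U ^~ w) (G ^~ w')).
      apply: euler_ext => k _; apply/rowP => i; rewrite !mxE /= -addrA; congr (_ + _).
      rewrite -big_split/=; apply: eq_bigr => l _; rewrite !mxE.
      by ring.
    apply: norm_mx_le => [|i0 i]; first by rewrite mulr_ge0// ltW.
    have sub_coord (A C : 'rV[R]_d) : (A - C) ord0 i = A ord0 i - C ord0 i by rewrite !mxE.
    rewrite (ord1 i0) sub_coord -(subrKA (y ord0 i)) (le_trans (ler_normD _ _))//.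
    rewrite (_ : 2 * r = r + r); last by ring.
    apply: lerD; first exact: Sw'.
    by rewrite distrC; exact: Sw1.
  have pert := euler_perturb K0 bK x (Zof (glue (U ^~ w) (G ^~ w1))) u (ltW T0) (ltn0Sn n).
  have lo := hc v (ltn0Sn n).
  have un : u n.+1 = v *m response (2 * H) T sigma e T by rewrite /u grid_last.
  rewrite un in pert.
  have cv : c * `|v| <= 2 * r by exact: (le_trans lo (le_trans pert dist)).
  have nv : `|g' - g1| <= D.
    have -> : g' - g1 = v0 *: v by rewrite /v scalerA mulfV ?gt_eqF// scale1r.
    rewrite normrZ gtr0_norm// /D ler_pdivlMr//.
    rewrite (_ : v0 * `|v| * c = c * `|v| * v0); last by ring.
    by rewrite ler_wpM2r// ltW.
  have := le_trans (norm_coord_le (g' - g1) ord0 j) nv.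
  by rewrite !mxE.
have mC j : measurable (`[g1 ord0 j - D, g1 ord0 j + D]%classic : set R) by exact: measurable_itv.
rewrite (@le_trans _ _ (P [set w' | forall j, (`[g1 ord0 j - D, g1 ord0 j + D]%classic : set R) (G j w')]))//.
  apply: le_measure; rewrite ?inE//.
  exact: (measurable_coordwise noise_measurable mC).
rewrite (noise_box mC) lee_fin.
rewrite -[in r ^+ d](card_ord d) -prodr_const -big_split/=.
apply: ler_prod => j _; rewrite fine_ge0//=.
have mj : measurable (G j @^-1` `[g1 ord0 j - D, g1 ord0 j + D]).
  by rewrite -[X in measurable X]setTI; exact: noise_measurable.
have := hp j (g1 ord0 j - D) (g1 ord0 j + D); rewrite lerD2l => /(_ ltac:(lra)).
rewrite (prE P mj) lee_fin => /le_trans; apply.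
by rewrite le_eqVlt; apply/orP; left; apply/eqP; rewrite /D; ring.
Qed.

End fixed_grid.
End response_step.
End euler_spread.

(** * Solutions as limits of Euler schemes *)

Section solution.
Context {dO} {Omega : measurableType dO} {R : realType} (P : probability Omega R).
Variables (d : nat) (H T : R) (B : R -> Omega -> 'rV[R]_d) (sigma : R -> 'M[R]_d).
Variables (Zh : R -> Omega -> 'rV[R]_d) (b : 'rV[R]_d -> 'rV[R]_d) (K : R).
Hypotheses (T0 : 0 < T) (K0 : 0 <= K) (bK : forall x y, `|b x - b y| <= K * `|x - y|).
Hypothesis hZ : forall Z, wiener_integral_process P H T B sigma Z -> forall t i, 0 <= t <= T ->
  {ae P, forall w, Z t w ord0 i = Zh t w ord0 i}.

Lemma solution_euler_limit x X : sde_solution P H T B b sigma x X ->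
  {ae P, forall w, forall e : R, 0 < e -> exists n0, forall n, (n0 <= n)%N ->
    `|X T w - euler_value T Zh b n x w| <= e}.
Proof.
move=> [_ cX [Z hZZ XE]].
have Zgrid : {ae P, forall w, forall n k, (k <= n.+1)%N -> Z (grid T n k) w = Zh (grid T n k) w}.
  apply: ae_foralln => n; apply: ae_foralln => k.
  have [kn|kn] := leqP k n.+1; last by apply: aeW => w.
  have h i := hZ hZZ i (grid_in T0 kn).
  have : {ae P, forall w, forall i, Z (grid T n k) w ord0 i = Zh (grid T n k) w ord0 i}.
    exact: filter_forall h.
  by apply: filterS => w hw _; apply/rowP => i; exact: hw.
move: cX XE Zgrid; apply: filterS3 => w cX XE Zg e e0.
have [n0 hn0] := euler_cvg K0 bK T0 cX XE e0.
exists n0 => n nn; have := hn0 n.+1 (leqW nn) (ltn0Sn n).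
by rewrite /euler_value (euler_ext _ _ _ (fun k kn => Zg n k kn)).
Qed.

(** The schemes for x and y share the driving path Zh, so the bound holds for them
    by induction and passes to the limit. *)
Lemma solution_lipschitz x y X X' : sde_solution P H T B b sigma x X -> sde_solution P H T B b sigma y X' ->
  {ae P, forall w, `|X T w - X' T w| <= expR (K * T) * `|x - y|}.
Proof.
move=> /solution_euler_limit hX /solution_euler_limit hX'.
move: hX hX'; apply: filterS2 => w h h'; apply/ler_addgt0Pr => e e0.
have [n1 h1] := h (e / 2) (divr_gt0 e0 (ltr0n R 2)).
have [n2 h2] := h' (e / 2) (divr_gt0 e0 (ltr0n R 2)).
pose n := maxn n1 n2.
have := h1 n (leq_maxl _ _); have := h2 n (leq_maxr _ _).
have Tn : 0 <= T / n.+1%:R by rewrite divr_ge0// ltW.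
have := euler_start K0 bK x y (fun k => Zh (grid T n k) w) n.+1 Tn.
rewrite -/(euler_value T Zh b n x w) -/(euler_value T Zh b n y w).
have := exp_bound n.+1 (mulr_ge0 K0 Tn).
have -> : n.+1%:R * (K * (T / n.+1%:R)) = K * T by field; rewrite nat1r pnatr_eq0.
move=> eb st c2 c1.
have st' : `|euler_value T Zh b n x w - euler_value T Zh b n y w| <= expR (K * T) * `|x - y|.
  by apply: (le_trans st); rewrite ler_wpM2r.
rewrite -(subrKA (euler_value T Zh b n x w)) (le_trans (ler_normD _ _))//.
rewrite -[X in _ + `|X|](subrKA (euler_value T Zh b n y w)).
rewrite distrC in c2.
rewrite (le_trans (lerD c1 (le_trans (ler_normD _ _) (lerD st' c2))))//.
by rewrite addrCA -splitr.
Qed.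

End solution.

Theorem mainTheorem5 (R : realType) (dO : measure_display)
    (Omega : measurableType dO) (P : probability Omega R)
    (d : nat) (H T : R) (B : R -> Omega -> 'rV[R]_d)
    (b : 'rV[R]_d -> 'rV[R]_d) (sigma : R -> 'M[R]_d)
    (K Kt L alpha0 beta0 : R)
    (X : 'rV[R]_d -> R -> Omega -> 'rV[R]_d) :
  1 / 2 < H < 1 -> 0 < T ->
  fBm P H T B ->
  (forall x : 'rV[R]_d, differentiable b x) ->
  (forall t : R, 0 <= t <= T -> sigma t \in unitmx) ->
  0 < K -> 0 < Kt -> 0 <= L ->
  H - 1 / 2 < alpha0 <= 1 ->
  1 - 1 / (2 * H) < beta0 <= 1 ->
  (forall x : 'rV[R]_d, enorm ('J b x) <= K) ->
  (exists M : R, forall t : R, 0 <= t <= T -> enorm (sigma t) <= M) ->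
  (forall s t : R, 0 <= s <= T -> 0 <= t <= T ->
     enorm (invmx (sigma t) - invmx (sigma s)) <= Kt * `|t - s| `^ alpha0) ->
  (forall x y : 'rV[R]_d, enorm ('J b x - 'J b y) <= L * enorm (x - y) `^ beta0) ->
  (forall x : 'rV[R]_d, sde_solution P H T B b sigma x (X x)) ->
  strong_feller (semigroup P X T).
Proof.
move=> /andP[H1 H2] T0 fB db sU K0 Kt0 _ /andP[al _] _ bJ [M sM] sH _ hX.
have al0 : 0 < alpha0 by lra.
have TT : 0 <= T <= T by rewrite lexx ltW.
pose K' := d%:R * K; have K'0 : 0 <= K' by rewrite mulr_ge0// ltW.
have bK : forall x y, `|b x - b y| <= K' * `|x - y|.
  exact: bounded_jacobian_lipschitz (ltW K0) db bJ.
have sC := holder_inverse_continuous al0 (ltW Kt0) sU sM sH.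
have sI i j : (@lebesgue_measure R).-integrable `[0, T] (EFin \o (fun r => sigma r i j)).
  apply: continuous_compact_integrable; first exact: segment_compact.
  apply/subspace_continuousP => t; rewrite /= in_itv/= => tT.
  apply/cvgrPdist_le => w w0; have [eta eta0 heta] := sC t tT w w0.
  rewrite near_withinE; exists eta => //= r hr; rewrite in_itv/= => rT.
  by rewrite distrC; apply: heta => //; rewrite distrC.
have sM' t i j : 0 <= t <= T -> `|sigma t i j| <= M.
  by move=> /sM; apply: le_trans; exact: coord_le_enorm.
have sCT : forall w : R, 0 < w -> exists2 eta, 0 < eta &
    forall r i j, 0 <= r -> T - eta <= r -> r <= T -> `|sigma r i j - sigma T i j| <= w.
  move=> w w0; have [eta eta0 heta] := sC T TT w w0.
  exists (eta / 2) => [|r i j r0 r1 r2]; first by rewrite divr_gt0.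
  by apply: heta; rewrite ?r0// ltr_norml; apply/andP; split; lra.
have [_ _ [Z0 hZ0 _]] := hX 0.
have [Zh [wZ mZ hZ]] := driving_version H1 H2 T0 fB sI hZ0.
have q1 : 1 < 2 * H by lra.
have q2 : 2 * H < 2 by lra.
have KE0 : 0 <= K' * expR (K' * T) by rewrite mulr_ge0// expR_ge0.
have [e [c [e0 eT c0 hc]]] := response_dominates q1 q2 T0 sM' sI sCT (sU T TT) KE0.
pose G w : 'rV[R]_d := \row_j noise T B e j w.
have nG j := noise_gaussian H1 H2 T0 fB e0 eT j.
have GE j : (fun w => G w ord0 j) = noise T B e j by apply/funext => w; rewrite mxE.
have mG j : measurable_fun setT (fun w => G w ord0 j).
  by rewrite GE; exact: (noise_measurable T0 fB e0 eT).
have mX x : measurable_fun setT (X x T : Omega -> borel_rV R d) by case: (hX x) => /(_ T TT).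
have pj j : exists p : R, 0 < p /\ forall a a' : R, a <= a' ->
    (P (noise T B e j @^-1` `[a, a']) <= (p * (a' - a))%:E)%E.
  have [g1 g2 g3] := nG j; have [p p0 hp] := gaussian_interval_le g1 g2 g3.
  by exists p.
have [p hp] := choice pj.
(* The constant of the density bound; it depends neither on x nor on the mesh. *)
pose Cst := \prod_(j < d) (p j * (4 * noise_var H e / c)).
have v0 := noise_var_gt0 H2 e0.
have Cst0 : 0 <= Cst.
  apply: prodr_ge0 => j _; rewrite mulr_ge0 ?(ltW (hp j).1)//.
  by rewrite divr_ge0 ?(ltW c0)// mulr_ge0// ltW.
have sF n x : spread P Cst (euler_value T Zh b n x).
  move=> y r r0.
  apply: (euler_density H1 H2 T0 fB sI wZ mZ K'0 bK e0 eT c0 hc) => // j; by case: (hp j).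
have mGr := measurable_rV mG.
have dom (N : nat) : exists2 C : R, 0 <= C & forall x O, open O ->
    pr P (X x T @^-1` (O `&` open_box N)) <= C * pr P (G @^-1` O).
  have cj j : exists k : R, 0 < k /\ forall a a' : R, - N%:R <= a -> a <= a' -> a' <= N%:R ->
      ((k * (a' - a))%:E <= P (noise T B e j @^-1` `[a, a'[))%E.
    have [g1 g2 g3] := nG j; have [k k0 hk] := gaussian_interval_ge N%:R g1 g2 g3.
    by exists k.
  have [k hk] := choice cj.
  have k0 : 0 < \prod_(j < d) k j by apply: prodr_gt0 => j _; exact: (hk j).1.
  have lower (a : 'rV[R]_d) (r : R) : 0 < r ->
      (forall i, - N%:R <= a ord0 i /\ a ord0 i + r <= N%:R) ->
      (\prod_(j < d) k j) * r ^+ d <= pr P [set w | forall i, a ord0 i <= G w ord0 i < a ord0 i + r].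
    move=> r0 ha.
    have -> : [set w | forall i, a ord0 i <= G w ord0 i < a ord0 i + r] =
        [set w | forall i, (`[a ord0 i, a ord0 i + r[%classic : set R) (noise T B e i w)].
      by apply/seteqP; split => w /= h i; have := h i; rewrite /= !mxE in_itv.
    have mC j : measurable (`[a ord0 j, a ord0 j + r[%classic : set R) by exact: measurable_itv.
    rewrite /pr (noise_box H1 T0 fB e0 eT mC)/=.
    rewrite -[in r ^+ d](card_ord d) -prodr_const -big_split/=.
    apply: ler_prod => j _; have [h1 h2] := ha j.
    rewrite mulr_ge0 ?(ltW (hk j).1) ?(ltW r0)//=.
    have mj : measurable (noise T B e j @^-1` `[a ord0 j, a ord0 j + r[).
      by rewrite -[X in measurable X]setTI; exact: (noise_measurable T0 fB e0 eT).
    have := (hk j).2 (a ord0 j) (a ord0 j + r) h1; rewrite lerDl => /(_ (ltW r0) h2).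
    by rewrite (prE P mj) lee_fin addrC addKr.
  exists (Cst / \prod_(j < d) k j) => [|x O oO]; first by rewrite divr_ge0// ltW.
  apply: (limit_domination mG Cst0 k0 lower (F := fun n => euler_value T Zh b n x) _ _ (mX x) _ oO).
  - by move=> n i; exact: (euler_value_measurable T mZ K'0 bK).
  - by move=> n; exact: sF.
  - exact: (solution_euler_limit T0 K'0 bK hZ (hX x)).
have lip x y : {ae P, forall w, `|X x T w - X y T w| <= expR (K' * T) * `|x - y|}.
  exact: (solution_lipschitz T0 K'0 bK hZ (hX x) (hX y)).
move=> f mf [M' [_ hM']].
have fM y : `|f y| <= M' + 1 by apply: (hM' (M' + 1)) => //; rewrite ltrDl.
have semE x : semigroup P X T f x = \int[P]_w f (X x T w) by rewrite /semigroup unlock.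
split.
  exists (M' + 1); split; first by rewrite num_real.
  move=> N MN x _ /=; rewrite semE.
  have mfX : measurable_fun setT (fun w => f (X x T w)) by exact: measurableT_comp mf (mX x).
  have ifX : P.-integrable setT (EFin \o (fun w => f (X x T w))) by apply: (@integrable_bounded _ _ _ P _ (M' + 1)).
  rewrite (le_trans (le_normr_Rintegral _ ifX))// (le_trans _ (ltW MN))//.
  rewrite -[leRHS](Rintegral_prob_cst P); apply: le_Rintegral => //.
  - exact: integrable_norm.
  - exact: finite_measure_integrable_cst.
move=> x A /nbhs_ballP[r /= r0 rA]; apply/nbhs_ballP.
have [rho rho0 hrho] := integral_stable (X := fun x => X x T) (G := G) mX mGr (expR_ge0 _) lip dom x mf fM (divr_gt0 r0 (ltr0n R 2)).
exists rho => //= y; rewrite mx_norm_ball /ball_/= distrC => /hrho h; apply: rA.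
rewrite /ball/= !semE distrC (le_lt_trans h)//.
by rewrite ltr_pdivrMr// ltr_pMr// ltr1n.
Qed.
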